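(* Suppose $(p_{XY},p_{Z|XY})$ is computable with asymptotic security. Then \[R_S=\min_{p_{U|XYZ}} I(Z;U|Y),\] where the minimum is over all conditional p.m.f.'s $p_{U|XYZ}$ (with $(U,X,Y,Z)\sim p_{XY}p_{Z|XY}p_{U|XYZ}$) such that $U-X-Y$, $Z-(U,Y)-X$ and $U-(Y,Z)-X$ are Markov chains, and where the alphabet $\mathcal{U}$ of $U$ may be taken to satisfy $|\mathcal{U}|\le|\mathcal{X}|\cdot|\mathcal{Y}|\cdot|\mathcal{Z}|+2$.
   Context: Setup: $\mathcal{X},\mathcal{Y},\mathcal{Z}$ finite; Alice observes $X^n$, Bob observes $Y^n$, where $(X_i,Y_i)$ are i.i.d. according to $p_{XY}$; Bob wants an output distributed according to $p_{Z^n|X^nY^n}(z^n|x^n,y^n)=\prod_{i=1}^n p_{Z|XY}(z_i|x_i,y_i)$, and $p_{X^nY^nZ^n}$ denotes the resulting joint p.m.f. An $(n,2^{nR})$-code is a pair of stochastic maps $(p_{M|X^n},p_{\hat Z^n|MY^n})$ with $M\in\{1,\dots,2^{nR}\}$ (Alice sends $M$, Bob outputs $\hat Z^n$); it induces $p_{X^nY^nM\hat Z^n}=p_{X^nY^n}p_{M|X^n}p_{\hat Z^n|MY^n}$. Total variation distance: $\|p-q\|_1=\frac12\sum_u|p(u)-q(u)|$. A rate $R$ is achievable if there is a sequence of codes of rate $R$ such that for every $\epsilon>0$ there is a large enough $n$ with $\|p_{X^nY^n\hat Z^n}-p_{X^nY^nZ^n}\|_1\le\epsilon$ and $I(M;X^n|Y^n,\hat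 Z^n)\le n\epsilon$. $R_S$ is the infimum of achievable rates ($R_S=\infty$ if none); $(p_{XY},p_{Z|XY})$ is computable with asymptotic security if $R_S<\infty$. *)

(* Defs.v *)
From mathcomp Require Import all_boot.
From Stdlib Require Import Reals.
Set Implicit Arguments.
Unset Strict Implicit.
Unset Printing Implicit Defensive.

Local Open Scope R_scope.

Definition rsum (T : finType) (f : T -> R) : R := \big[Rplus/R0]_(t : T) f t.
Definition rprod (n : nat) (f : 'I_n -> R) : R := \big[Rmult/R1]_(i < n) f i.

Definition log2 (x : R) : R := ln x / ln 2.

Definition is_pmf2 (A B : finType) (p : A -> B -> R) : Prop :=
  (forall a b, 0 <= p a b) /\ rsum (fun a => rsum (fun b => p a b)) = 1.

Definition is_kernel (A B : finType) (k : A -> B -> R) : Prop :=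
  (forall a b, 0 <= k a b) /\ (forall a, rsum (fun b => k a b) = 1).

Section Marg.
Variables (A B C : finType) (j : A -> B -> C -> R).
Definition margB (b : B) : R := rsum (fun a => rsum (fun c => j a b c)).
Definition margC (c : C) : R := rsum (fun a => rsum (fun b => j a b c)).
Definition margAB (a : A) (b : B) : R := rsum (fun c => j a b c).
Definition margAC (a : A) (c : C) : R := rsum (fun b => j a b c).
Definition margBC (b : B) (c : C) : R := rsum (fun a => j a b c).
End Marg.

Definition condMI (A B C : finType) (j : A -> B -> C -> R) : R :=
  rsum (fun a => rsum (fun b => rsum (fun c =>
    if Rlt_dec 0 (j a b c) then
      j a b c * log2 (j a b c * margC j c / (margAC j a c * margBC j b c))
    else 0))).

Definition markov (A B C : finType) (j : A -> B -> C -> R) : Prop :=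
  forall a b c, j a b c * margB j b = margAB j a b * margBC j b c.

(* an n-block code: nmsg messages M in 'I_nmsg (i.e. {1,..,nmsg}),
   stochastic encoder enc x m = p_{M|X^n}(m|x),
   stochastic decoder dec (m, y) z = p_{Zhat^n|M Y^n}(z|m,y) *)
Record code (X Y Z : finType) (n : nat) := Code {
  nmsg : nat;
  enc : {ffun 'I_n -> X} -> 'I_nmsg -> R;
  dec : ('I_nmsg * {ffun 'I_n -> Y}) -> {ffun 'I_n -> Z} -> R
}.
Arguments nmsg {X Y Z n} c.
Arguments enc {X Y Z n} c _ _.
Arguments dec {X Y Z n} c _ _.

Definition valid_code (X Y Z : finType) (n : nat) (c : code X Y Z n) : Prop :=
  is_kernel (enc c) /\ is_kernel (dec c).

Section Coding.
Variables (X Y Z : finType).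
Variables (pXY : X -> Y -> R) (pZ : X -> Y -> Z -> R). (* pZ x y z = p(z|x,y) *)

Definition pXYn (n : nat) (x : {ffun 'I_n -> X}) (y : {ffun 'I_n -> Y}) : R :=
  rprod (fun i => pXY (x i) (y i)).

Definition pXYZn (n : nat) (x : {ffun 'I_n -> X}) (y : {ffun 'I_n -> Y})
  (z : {ffun 'I_n -> Z}) : R :=
  rprod (fun i => pXY (x i) (y i) * pZ (x i) (y i) (z i)).

Definition code_joint (n : nat) (c : code X Y Z n) (x : {ffun 'I_n -> X})
  (y : {ffun 'I_n -> Y}) (m : 'I_(nmsg c)) (z : {ffun 'I_n -> Z}) : R :=
  pXYn x y * enc c x m * dec c (m, y) z.

Definition code_tv (n : nat) (c : code X Y Z n) : R :=
  / 2 * rsum (fun x => rsum (fun y => rsum (fun z =>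
    Rabs (rsum (fun m => @code_joint n c x y m z) - pXYZn x y z)))).

Definition code_leak (n : nat) (c : code X Y Z n) : R :=
  condMI (fun (m : 'I_(nmsg c)) (x : {ffun 'I_n -> X})
              (yz : {ffun 'I_n -> Y} * {ffun 'I_n -> Z}) =>
            @code_joint n c x yz.1 m yz.2).

Definition achievable (Rt : R) : Prop :=
  exists cs : forall n, code X Y Z n,
    (forall n, valid_code (cs n) /\ INR (nmsg (cs n)) <= Rpower 2 (INR n * Rt)) /\
    forall eps, 0 < eps -> exists N : nat, forall n : nat, (N <= n)%nat ->
      code_tv (cs n) <= eps /\ code_leak (cs n) <= INR n * eps.

(* R_S < infinity *)
Definition computable_asym_secure : Prop := exists Rt, achievable Rt.

Definition is_inf (E : R -> Prop) (v : R) : Prop :=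
  (forall r, E r -> v <= r) /\ (forall w, (forall r, E r -> w <= r) -> w <= v).

Definition jointU (U : finType) (q : (X * Y * Z) -> U -> R)
  (u : U) (x : X) (y : Y) (z : Z) : R :=
  pXY x y * pZ x y z * q (x, y, z) u.

Definition admissible (U : finType) (q : (X * Y * Z) -> U -> R) : Prop :=
  is_kernel q /\
  markov (fun (u : U) (x : X) (y : Y) => rsum (fun z => jointU q u x y z)) /\
  markov (fun (z : Z) (uy : U * Y) (x : X) => jointU q uy.1 x uy.2 z) /\
  markov (fun (u : U) (yz : Y * Z) (x : X) => jointU q u x yz.1 yz.2).

Definition objU (U : finType) (q : (X * Y * Z) -> U -> R) : R :=
  condMI (fun (z : Z) (u : U) (y : Y) => rsum (fun x => jointU q u x y z)).

End Coding.

(* Main.v *)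
(* Achievability uses a random codebook of i.i.d. words u(m,l), of which Alice
   sends only m.  In the ideal experiment (m,l) is uniform and (X,Y,Z)^n is drawn
   from the memoryless channel given u(m,l); the Markov chains split this channel
   into p(x|u) p(y|x) p(z|u,y).  If there are more than 2^{n I(U;XYZ)} words, soft
   covering makes the law of (X,Y,Z)^n close to the target, so Alice can sample
   (m,l) given X^n; if there are fewer than 2^{n I(U;Y)} values of l, Bob recovers l
   from m and Y^n.  The rate is I(U;XYZ) - I(U;Y) = I(Z;U|Y).  In the ideal
   experiment (m,l) - (Y,Z)^n - X^n is Markov, so the leakage of the actual code is
   controlled by its distance to the ideal one.

   For the converse put U_i = (M, Y^n without Y_i).  The chains U_i - X_i - Y_i and
   Z_i - (U_i,Y_i) - X_i are exact.  Summing over i, with chain rules along prefixes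
   of Z^n and X^n, bounds the average of I(Z_i;U_i|Y_i) by the rate and the average
   of I(U_i;X_i|Y_i,Z_i) by a vanishing quantity, so a single good i satisfies all
   single-letter constraints up to eta.  Conic Caratheodory bounds the alphabet of U
   and compactness lets eta tend to 0; applied at the infimum of the achievable
   rates this also shows that the minimum is attained. *)

(* The leakage must be o(n) while total variation comes with no rate of decay. Continuity of
   conditional mutual information is therefore used in a form whose error is a distance times the
   logarithm of the alphabet of one argument only: |X|^n for the code, |X| or |Z| for a single
   letter. The sizes of M and U never enter. Hence errors of order 1/n from Chebyshev's inequality
   suffice in the direct part, and a vanishing distance suffices in the converse.

   In the converse only the law of (X_i,Y_i,Z_i) and the third Markov chain are approximate. The two
   exact chains constrain each slice u of the joint law separately and are invariant under rescaling
   that slice, so Caratheodory's theorem may reweight the slices freely. What must be preserved is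
   p(x,y,z) and two entropies, which explains |X||Y||Z| + 2. This reduction has to precede the
   limit, because the alphabet of U_i grows with n. *)
From HB Require Import structures.
Require Import Defs.
From mathcomp Require Import all_boot.
From Stdlib Require Import Reals Lra Lia Psatz Classical ClassicalEpsilon FunctionalExtensionality.
Set Implicit Arguments.
Unset Strict Implicit.
Unset Printing Implicit Defensive.
Local Open Scope R_scope.

(** * Finite sums of reals *)

HB.instance Definition _ := Monoid.isComLaw.Build R R0 Rplus
  (fun x y z => esym (Rplus_assoc x y z)) Rplus_comm Rplus_0_l.
HB.instance Definition _ := Monoid.isComLaw.Build R R1 Rmult
  (fun x y z => esym (Rmult_assoc x y z)) Rmult_comm Rmult_1_l.
HB.instance Definition _ := Monoid.isMulLaw.Build R R0 Rmult Rmult_0_l Rmult_0_r.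
HB.instance Definition _ := Monoid.isAddLaw.Build R Rmult Rplus
  Rmult_plus_distr_r Rmult_plus_distr_l.

Definition ind (b : bool) : R := if b then 1 else 0.

Lemma ind_ge0 b : 0 <= ind b. Proof. case: b => /=; lra. Qed.
Lemma ind_le1 b : ind b <= 1. Proof. case: b => /=; lra. Qed.
Lemma ind_and b c : ind (b && c) = ind b * ind c.
Proof. case: b; case: c; rewrite /ind /=; lra. Qed.

Lemma eq_rsum (T : finType) (f g : T -> R) : f =1 g -> rsum f = rsum g.
Proof. by move=> e; apply: eq_bigr => t _; apply: e. Qed.

Lemma rsum_add (T : finType) (f g : T -> R) :
  rsum (fun t => f t + g t) = rsum f + rsum g.
Proof. exact: big_split. Qed.

Lemma rsum_mull (T : finType) c (f : T -> R) : rsum (fun t => c * f t) = c * rsum f.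
Proof. by rewrite /rsum big_distrr. Qed.

Lemma rsum_mulr (T : finType) c (f : T -> R) : rsum (fun t => f t * c) = rsum f * c.
Proof. by rewrite /rsum big_distrl. Qed.

Lemma rsum_opp (T : finType) (f : T -> R) : rsum (fun t => - f t) = - rsum f.
Proof.
rewrite (_ : - rsum f = -1 * rsum f); last by ring.
by rewrite -rsum_mull; apply: eq_rsum => t; ring.
Qed.

Lemma rsum_sub (T : finType) (f g : T -> R) :
  rsum (fun t => f t - g t) = rsum f - rsum g.
Proof. by rewrite /Rminus rsum_add rsum_opp. Qed.

Lemma rsum_exch (S T : finType) (f : S -> T -> R) :
  rsum (fun s => rsum (fun t => f s t)) = rsum (fun t => rsum (fun s => f s t)).
Proof. exact: exchange_big. Qed.

Lemma rsum_pair (S T : finType) (f : S -> T -> R) :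
  rsum (fun st : S * T => f st.1 st.2) = rsum (fun s => rsum (fun t => f s t)).
Proof. by rewrite /rsum pair_bigA. Qed.

Lemma rsum_pairE (S T : finType) (f : S * T -> R) :
  rsum f = rsum (fun s => rsum (fun t => f (s, t))).
Proof. by rewrite -rsum_pair; apply: eq_rsum; case. Qed.

Lemma rsum_reindex (S T : finType) (h : S -> T) (f : T -> R) :
  bijective h -> rsum f = rsum (fun s => f (h s)).
Proof. by move=> hb; rewrite /rsum (reindex h) //; apply: onW_bij. Qed.

Lemma rsum_le (T : finType) (f g : T -> R) :
  (forall t, f t <= g t) -> rsum f <= rsum g.
Proof.
move=> h; rewrite /rsum; elim/big_rec2: _ => [|t x y _ l]; first lra.
have := h t; lra.
Qed.

Lemma rsum0 (T : finType) : rsum (fun _ : T => 0) = 0.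
Proof. by rewrite /rsum big1. Qed.

Lemma rsum_eq0f (T : finType) (f : T -> R) : (forall t, f t = 0) -> rsum f = 0.
Proof. by move=> h; rewrite (eq_rsum h) rsum0. Qed.

Lemma rsum_ge0 (T : finType) (f : T -> R) : (forall t, 0 <= f t) -> 0 <= rsum f.
Proof. by move=> h; rewrite -(rsum0 T); apply: rsum_le. Qed.

Lemma rsum_const (T : finType) c : rsum (fun _ : T => c) = INR #|T| * c.
Proof.
rewrite /rsum big_const; elim: #|T| => [|k IH]; first by rewrite /=; ring.
by rewrite iterS IH S_INR; ring.
Qed.

Lemma rsum_abs (T : finType) (f : T -> R) :
  Rabs (rsum f) <= rsum (fun t => Rabs (f t)).
Proof.
rewrite /rsum; elim/big_rec2: _ => [|t x y _ l]; first by rewrite Rabs_R0; lra.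
by apply: Rle_trans (Rabs_triang _ _) _; lra.
Qed.

Lemma rsum_D1 (T : finType) (t : T) (f : T -> R) :
  rsum f = f t + \big[Rplus/R0]_(s | s != t) f s.
Proof. by rewrite /rsum (bigD1 t). Qed.

Lemma rsum_term (T : finType) (t : T) (f : T -> R) :
  (forall s, 0 <= f s) -> f t <= rsum f.
Proof.
move=> h; rewrite (rsum_D1 t).
have : 0 <= \big[Rplus/R0]_(s | s != t) f s.
  by elim/big_rec: _ => [|s x _ l]; [lra | have := h s; lra].
lra.
Qed.

Lemma rsum_eq0 (T : finType) (f : T -> R) :
  (forall s, 0 <= f s) -> rsum f = 0 -> forall t, f t = 0.
Proof. by move=> h e t; have := rsum_term t h; have := h t; lra. Qed.

Lemma rsum_delta (T : finType) (t : T) (f : T -> R) :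
  rsum (fun s => f s * ind (t == s)) = f t.
Proof.
rewrite (rsum_D1 t) eqxx /= big1; first by rewrite /ind; ring.
by move=> s /negbTE; rewrite eq_sym => -> /=; rewrite /ind; ring.
Qed.

(** The selected point has positive weight. For a random codebook this puts every codeword in the
    support of the input law, where the third Markov chain gives the factorization [eE]. *)
Lemma rsum_exists_le (T : finType) (p f : T -> R) c :
  (forall t, 0 <= p t) -> rsum p = 1 -> rsum (fun t => p t * f t) <= c ->
  exists2 t, 0 < p t & f t <= c.
Proof.
move=> p0 p1 le.
apply: NNPP => no.
have lt t : 0 <= p t * (f t - c).
  case: (Rle_lt_or_eq_dec _ _ (p0 t)) => [pt|<-]; last by rewrite Rmult_0_l; lra.
  case: (Rle_lt_dec (f t) c) => l; first by case: no; exists t.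
  by apply: Rmult_le_pos; lra.
have e : rsum (fun t => p t * (f t - c)) = rsum (fun t => p t * f t) - c.
  rewrite -[X in _ - X]Rmult_1_l -p1 -rsum_mulr -rsum_sub.
  by apply: eq_rsum => t; ring.
have z := rsum_eq0 lt.
have z0 : rsum (fun t => p t * (f t - c)) = 0.
  by apply: Rle_antisym; [rewrite e; lra | apply: rsum_ge0].
have p00 t : p t = 0.
  apply: Rle_antisym; last by [].
  apply: Rnot_lt_le => pt; apply: no; exists t => //.
  have := z z0 t; case/Rmult_integral; lra.
by move: p1; rewrite (rsum_eq0f p00); lra.
Qed.

(** * Conditional mutual information *)

Lemma Rle_div_l x y z : 0 < z -> x <= y * z -> x / z <= y.
Proof.
move=> z0 h; apply: (Rmult_le_reg_r z) => //.
by rewrite /Rdiv Rmult_assoc Rinv_l; lra.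
Qed.

Lemma Rle_div_r x y z : 0 < z -> x * z <= y -> x <= y / z.
Proof.
move=> z0 h; apply: (Rmult_le_reg_r z) => //.
by rewrite /Rdiv Rmult_assoc Rinv_l; lra.
Qed.

Lemma ln2_gt0 : 0 < ln 2.
Proof. by rewrite -ln_1; apply: ln_increasing; lra. Qed.

Lemma ln_le_sub1 t : 0 < t -> ln t <= t - 1.
Proof.
move=> t0; case: (Req_dec (ln t) 0) => [e|ne].
  have : t = 1 by rewrite -(exp_ln t t0) e exp_0.
  by move=> ->; rewrite ln_1; lra.
by have := exp_ineq1 _ ne; rewrite exp_ln //; lra.
Qed.

Lemma ln_lt_sub1 t : 0 < t -> t <> 1 -> ln t < t - 1.
Proof.
move=> t0 t1; have ne : ln t <> 0.
  by move=> e; apply: t1; rewrite -(exp_ln t t0) e exp_0.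
by have := exp_ineq1 _ ne; rewrite exp_ln //; lra.
Qed.

Lemma log2_mul x y : 0 < x -> 0 < y -> log2 (x * y) = log2 x + log2 y.
Proof. by move=> x0 y0; rewrite /log2 ln_mult //; field; have := ln2_gt0; lra. Qed.

Lemma log2_div x y : 0 < x -> 0 < y -> log2 (x / y) = log2 x - log2 y.
Proof.
move=> x0 y0; rewrite /Rdiv log2_mul //; last exact: Rinv_0_lt_compat.
by rewrite /log2 ln_Rinv //; field; have := ln2_gt0; lra.
Qed.

Lemma log2_1 : log2 1 = 0. Proof. by rewrite /log2 ln_1 /Rdiv Rmult_0_l. Qed.

Lemma log2_2 : log2 2 = 1.
Proof. by rewrite /log2; field; have := ln2_gt0; lra. Qed.

Lemma log2_le x y : 0 < x -> x <= y -> log2 x <= log2 y.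
Proof.
move=> x0 le; rewrite /log2 /Rdiv; apply: Rmult_le_compat_r.
  by apply/Rlt_le/Rinv_0_lt_compat/ln2_gt0.
by case: le => [lt|->]; [apply/Rlt_le/ln_increasing | lra].
Qed.

Lemma log2_ge0 x : 1 <= x -> 0 <= log2 x.
Proof. by move=> h; rewrite -log2_1; apply: log2_le; lra. Qed.

Lemma log2_Rpower x : log2 (Rpower 2 x) = x.
Proof. by rewrite /log2 /Rpower ln_exp; field; have := ln2_gt0; lra. Qed.

Lemma Rpower2_gt0 x : 0 < Rpower 2 x.
Proof. exact: exp_pos. Qed.

Lemma log2_sub1 p q : 0 < p -> 0 < q -> p * log2 (q / p) <= (q - p) / ln 2.
Proof.
move=> p0 q0; have l := ln2_gt0.
have qp : 0 < q / p by apply: Rdiv_lt_0_compat.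
have -> : p * log2 (q / p) = (p * ln (q / p)) / ln 2 by rewrite /log2; field; lra.
apply: Rmult_le_compat_r; first exact/Rlt_le/Rinv_0_lt_compat.
have -> : q - p = p * (q / p - 1) by field; lra.
by apply: Rmult_le_compat_l; [lra | apply: ln_le_sub1].
Qed.

(** The equality case turns vanishing mutual information into an exact factorization. *)
Lemma log2_sub1_eq p q :
  0 < p -> 0 < q -> (q - p) / ln 2 <= p * log2 (q / p) -> q = p.
Proof.
move=> p0 q0 h; have l := ln2_gt0.
have qp : 0 < q / p by apply: Rdiv_lt_0_compat.
case: (Req_dec (q / p) 1) => [e|ne].
  by rewrite -[q](_ : q / p * p = q); [rewrite e; ring | field; lra].
have lt : p * ln (q / p) < q - p.
  have -> : q - p = p * (q / p - 1) by field; lra.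
  by apply: Rmult_lt_compat_l => //; apply: ln_lt_sub1.
have e1 : p * log2 (q / p) = (p * ln (q / p)) / ln 2 by rewrite /log2; field; lra.
have : p * ln (q / p) / ln 2 < (q - p) / ln 2.
  by apply: Rmult_lt_compat_r => //; apply: Rinv_0_lt_compat.
lra.
Qed.

(** Only the total masses are compared, so that it applies to unnormalized joint tables. *)
Lemma gibbs (T : finType) (p q : T -> R) :
  (forall t, 0 <= p t) -> (forall t, 0 <= q t) -> (forall t, 0 < p t -> 0 < q t) ->
  rsum q <= rsum p -> rsum (fun t => p t * log2 (q t / p t)) <= 0.
Proof.
move=> p0 q0 pq le; have l := ln2_gt0.
apply: (Rle_trans _ (rsum (fun t => (q t - p t) * / ln 2))).
  apply: rsum_le => t; case: (Rle_lt_or_eq_dec _ _ (p0 t)) => [pt|<-].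
    by apply: log2_sub1 => //; apply: pq.
  rewrite Rmult_0_l; apply: Rmult_le_pos; first by have := q0 t; lra.
  by apply/Rlt_le/Rinv_0_lt_compat.
rewrite rsum_mulr rsum_sub.
have : 0 <= (rsum p - rsum q) * / ln 2.
  by apply: Rmult_le_pos; [lra | apply/Rlt_le/Rinv_0_lt_compat].
lra.
Qed.

Lemma rsum3 (A B C : finType) (f : A -> B -> C -> R) :
  rsum (fun t : A * B * C => f t.1.1 t.1.2 t.2) =
  rsum (fun a => rsum (fun b => rsum (fun c => f a b c))).
Proof. by rewrite !rsum_pairE. Qed.

Lemma rsum3_rot (A B C : finType) (f : A -> B -> C -> R) :
  rsum (fun a => rsum (fun b => rsum (fun c => f a b c))) =
  rsum (fun c => rsum (fun a => rsum (fun b => f a b c))).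
Proof.
rewrite [RHS]rsum_exch; apply: eq_rsum => a; exact: rsum_exch.
Qed.

Lemma rsum3_le (A B C : finType) (f g : A -> B -> C -> R) :
  (forall a b c, f a b c <= g a b c) ->
  rsum (fun a => rsum (fun b => rsum (fun c => f a b c))) <=
  rsum (fun a => rsum (fun b => rsum (fun c => g a b c))).
Proof. by move=> h; do 3! [apply: rsum_le => ?]; apply: h. Qed.

Lemma eq_rsum3 (A B C : finType) (f g : A -> B -> C -> R) :
  (forall a b c, f a b c = g a b c) ->
  rsum (fun a => rsum (fun b => rsum (fun c => f a b c))) =
  rsum (fun a => rsum (fun b => rsum (fun c => g a b c))).
Proof. by move=> h; do 3! [apply: eq_rsum => ?]; apply: h. Qed.

Section CondMI.
Variables (A B C : finType) (j : A -> B -> C -> R).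
Hypothesis j0 : forall a b c, 0 <= j a b c.

Lemma margAC_ge0 a c : 0 <= margAC j a c. Proof. exact: rsum_ge0. Qed.
Lemma margBC_ge0 b c : 0 <= margBC j b c. Proof. exact: rsum_ge0. Qed.
Lemma margC_ge0 c : 0 <= margC j c.
Proof. by do 2! apply: rsum_ge0 => ?. Qed.

Lemma j_le_margAC a b c : j a b c <= margAC j a c.
Proof. by apply: (rsum_term b (f := fun b => j a b c)). Qed.
Lemma j_le_margBC a b c : j a b c <= margBC j b c.
Proof. by apply: (rsum_term a (f := fun a => j a b c)). Qed.
Lemma margAC_le_margC a c : margAC j a c <= margC j c.
Proof. by apply: (rsum_term a (f := fun a => margAC j a c)) => ?; apply: margAC_ge0. Qed.
Lemma j_le_margC a b c : j a b c <= margC j c.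
Proof. exact: Rle_trans (j_le_margAC a b c) (margAC_le_margC a c). Qed.

Lemma rsum_margAC c : rsum (fun a => margAC j a c) = margC j c.
Proof. by []. Qed.
Lemma rsum_margBC c : rsum (fun b => margBC j b c) = margC j c.
Proof. by rewrite /margBC rsum_exch. Qed.

Lemma condMIE : condMI j = rsum (fun a => rsum (fun b => rsum (fun c =>
   j a b c * log2 (j a b c * margC j c / (margAC j a c * margBC j b c))))).
Proof.
apply: eq_rsum3 => a b c; case: Rlt_dec => // h.
have e : j a b c = 0 by have := j0 a b c; lra.
by rewrite /= {1}e Rmult_0_l.
Qed.

(** The law with the same marginals on (A,C) and (B,C) that makes A and B independent given C;
    [condMI] is the divergence of [j] from it. Where [margC j c = 0] the convention [/ 0 = 0] yields
    the correct value 0. *)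
Definition cprod a b c := margAC j a c * margBC j b c / margC j c.

Lemma cprod_ge0 a b c : 0 <= cprod a b c.
Proof.
apply: Rmult_le_pos; first by apply: Rmult_le_pos; [apply: margAC_ge0 | apply: margBC_ge0].
case: (Rle_lt_or_eq_dec _ _ (margC_ge0 c)) => [h|<-]; last by rewrite Rinv_0; lra.
exact/Rlt_le/Rinv_0_lt_compat.
Qed.

Lemma cprod_gt0 a b c : 0 < j a b c -> 0 < cprod a b c.
Proof.
move=> h; have := j_le_margAC a b c; have := j_le_margBC a b c.
have := j_le_margC a b c => *.
by apply: Rdiv_lt_0_compat; [apply: Rmult_lt_0_compat | ]; lra.
Qed.

Lemma rsum_cprod : rsum (fun a => rsum (fun b => rsum (fun c => cprod a b c))) =
  rsum (fun a => rsum (fun b => rsum (fun c => j a b c))).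
Proof.
rewrite rsum3_rot [RHS]rsum3_rot; apply: eq_rsum => c; rewrite -/(margC j c).
case: (Req_dec (margC j c) 0) => [e|ne].
  rewrite e; apply: rsum_eq0f => a; apply: rsum_eq0f => b.
  by rewrite /cprod e /Rdiv Rinv_0 Rmult_0_r.
transitivity (rsum (fun a => margAC j a c * rsum (fun b => margBC j b c / margC j c))).
  apply: eq_rsum => a; rewrite -rsum_mull; apply: eq_rsum => b; rewrite /cprod; field.
  exact: ne.
by rewrite rsum_mulr rsum_margAC /Rdiv rsum_mulr rsum_margBC; field.
Qed.

Lemma condMI_cprod : condMI j = - rsum (fun a => rsum (fun b => rsum (fun c =>
   j a b c * log2 (cprod a b c / j a b c)))).
Proof.
rewrite condMIE -rsum_opp; apply: eq_rsum => a; rewrite -rsum_opp; apply: eq_rsum => b.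
rewrite -rsum_opp; apply: eq_rsum => c.
case: (Rle_lt_or_eq_dec _ _ (j0 a b c)) => [h|<-]; last by ring.
have := j_le_margAC a b c; have := j_le_margBC a b c; have := j_le_margC a b c => h1 h2 h3.
rewrite [in RHS]log2_div //; last exact: cprod_gt0.
rewrite /cprod !log2_div ?log2_mul; try lra; try (apply: Rmult_lt_0_compat; lra).
Qed.

Lemma condMI_ge0 : 0 <= condMI j.
Proof.
rewrite condMI_cprod -rsum3.
have := @gibbs (A * B * C)%type (fun t => j t.1.1 t.1.2 t.2)
  (fun t => cprod t.1.1 t.1.2 t.2).
move=> /(_ (fun _ => j0 _ _ _) (fun _ => cprod_ge0 _ _ _) (fun _ => @cprod_gt0 _ _ _)).
rewrite (rsum3 cprod) (rsum3 j) rsum_cprod => /(_ (Rle_refl _)) => h; rewrite -Ropp_0; apply: Ropp_le_contravar; exact: h.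
Qed.

(** The middle argument of [markov] is the conditioning variable, hence the permuted order. *)
Lemma condMI_eq0 : condMI j <= 0 -> markov (fun a c b => j a b c).
Proof.
move=> le.
(* The deficit of one term in Gibbs' inequality. All deficits are nonnegative and they sum to 0, so
   every term is an equality case. *)
pose d a b c := (cprod a b c - j a b c) / ln 2 - j a b c * log2 (cprod a b c / j a b c).
have l := ln2_gt0.
have d0 a b c : 0 <= d a b c.
  rewrite /d; case: (Rle_lt_or_eq_dec _ _ (j0 a b c)) => [h|<-].
    by have := log2_sub1 h (cprod_gt0 h); lra.
  rewrite Rmult_0_l !Rminus_0_r; apply: Rmult_le_pos; first exact: cprod_ge0.
  exact/Rlt_le/Rinv_0_lt_compat.
have s0 : rsum (fun t : A * B * C => d t.1.1 t.1.2 t.2) = 0.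
  apply: Rle_antisym; last by apply: rsum_ge0 => t; apply: d0.
  rewrite /d rsum_sub rsum_mulr rsum_sub.
  rewrite (rsum3 cprod) (rsum3 j) rsum_cprod.
  rewrite (rsum3 (fun a b c => j a b c * log2 (cprod a b c / j a b c))).
  move: le; rewrite condMI_cprod; lra.
have e a b c : cprod a b c = j a b c.
  have dz : d a b c = 0.
    by apply: (rsum_eq0 (f := fun t : A * B * C => d t.1.1 t.1.2 t.2) _ s0 (a, b, c)).
  case: (Rle_lt_or_eq_dec _ _ (j0 a b c)) => [h|h].
    by apply: log2_sub1_eq => //; [apply: cprod_gt0 | rewrite -/(d a b c); move: dz; rewrite /d; lra].
  move: dz; rewrite /d -h Rmult_0_l !Rminus_0_r => /Rmult_integral[] // z.
  by have := Rinv_0_lt_compat _ l; lra.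
move=> a c b.
have -> : margB (fun a c b => j a b c) c = margC j c by [].
have -> : margAB (fun a c b => j a b c) a c = margAC j a c by [].
have -> : margBC (fun a c b => j a b c) c b = margBC j b c by [].
rewrite -(e a b c) /cprod.
case: (Req_dec (margC j c) 0) => [z|nz]; last by field.
have := margAC_le_margC a c; have := margAC_ge0 a c => h1 h2.
have -> : margAC j a c = 0 by lra.
by rewrite /Rdiv !Rmult_0_l.
Qed.

(* Replacing the conditional law of B given C by any kernel can only increase the
   divergence, so condMI is at most the divergence from margAC * r', where r' mixes r
   with the uniform law to make the logarithm at most log2 (#|B| / t).  Where
   j <= (1 + s) * margAC * r the logarithm is small; elsewhere j is at most
   (1 + s) / s times the pointwise distance. *)
Lemma condMI_close (r : C -> B -> R) (d s t : R) :
  is_kernel r -> rsum (fun a => rsum (fun b => rsum (fun c => j a b c))) <= 1 ->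
  rsum (fun a => rsum (fun b => rsum (fun c =>
    Rabs (j a b c - margAC j a c * r c b)))) <= d ->
  0 < s -> 0 < t < 1 -> (0 < #|B|)%nat ->
  condMI j <= log2 ((1 + s) / (1 - t)) + (1 + s) / s * d * log2 (INR #|B| / t).
Proof.
move=> [r0 r1] j1 jd s0 [t0 t1] cB.
have b1 : 1 <= INR #|B| by apply: (le_INR 1); apply/leP.
pose r' c b := (1 - t) * r c b + t / INR #|B|.
have tb : 0 < t / INR #|B| by apply: Rdiv_lt_0_compat; lra.
have r'0 c b : 0 < r' c b.
  by have := Rmult_le_pos (1 - t) (r c b) ltac:(lra) (r0 _ _); rewrite /r'; lra.
have r'1 c : rsum (r' c) = 1.
  by rewrite /r' rsum_add rsum_mull r1 rsum_const; field; lra.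
pose L1 := log2 ((1 + s) / (1 - t)).
pose L2 := log2 (INR #|B| / t).
have L10 : 0 <= L1.
  by apply: log2_ge0; apply: Rle_div_r; lra.
have L20 : 0 <= L2.
  by apply: log2_ge0; apply: Rle_div_r; lra.
have G : rsum (fun a => rsum (fun b => rsum (fun c =>
    j a b c * log2 (margC j c * r' c b / margBC j b c)))) <= 0.
  rewrite rsum3_rot.
  have -> : rsum (fun c => rsum (fun a => rsum (fun b =>
    j a b c * log2 (margC j c * r' c b / margBC j b c)))) =
    rsum (fun t : C * B => margBC j t.2 t.1 *
      log2 (margC j t.1 * r' t.1 t.2 / margBC j t.2 t.1)).
    rewrite (rsum_pair (fun c b => margBC j b c * log2 (margC j c * r' c b / margBC j b c))).
    by apply: eq_rsum => c; rewrite rsum_exch; apply: eq_rsum => b; rewrite rsum_mulr.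
  apply: gibbs => [[c b]|[c b]|[c b]|] /=.
  - exact: margBC_ge0.
  - by apply: Rmult_le_pos; [apply: margC_ge0 | apply/Rlt_le/r'0].
  - move=> h; apply: Rmult_lt_0_compat => //; apply: Rlt_le_trans h _.
    by rewrite -(rsum_margBC c); apply: (rsum_term b (f := fun b => margBC j b c)) => ?; apply: margBC_ge0.
  - rewrite (rsum_pair (fun c b => margC j c * r' c b)) (rsum_pair (fun c b => margBC j b c)).
    apply: rsum_le => c; rewrite rsum_mull r'1 rsum_margBC; lra.
pose K := (1 + s) / s.
have K0 : 0 <= K by apply/Rlt_le/Rdiv_lt_0_compat; lra.
have P a b c : j a b c * log2 (j a b c * margC j c / (margAC j a c * margBC j b c)) <=
   j a b c * log2 (margC j c * r' c b / margBC j b c) +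
   (j a b c * L1 + Rabs (j a b c - margAC j a c * r c b) * (K * L2)).
  have ab0 := Rabs_pos (j a b c - margAC j a c * r c b).
  case: (Rle_lt_or_eq_dec _ _ (j0 a b c)) => [h|e]; last first.
    have z x : j a b c * x = 0 by rewrite -e Rmult_0_l.
    have := Rmult_le_pos _ _ ab0 (Rmult_le_pos _ _ K0 L20).
    by rewrite !z; lra.
  have h1 := j_le_margAC a b c; have h2 := j_le_margBC a b c; have h3 := j_le_margC a b c.
  have r'p := r'0 c b.
  have -> : log2 (j a b c * margC j c / (margAC j a c * margBC j b c)) =
     log2 (margC j c * r' c b / margBC j b c) + log2 (j a b c / (margAC j a c * r' c b)).
    by rewrite !log2_div ?log2_mul; try lra; try (apply: Rmult_lt_0_compat; lra).
  rewrite Rmult_plus_distr_l; apply: Rplus_le_compat_l.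
  have m0 : 0 < margAC j a c by lra.
  have mr : 0 < margAC j a c * r' c b by apply: Rmult_lt_0_compat.
  case: (Rle_lt_dec (j a b c) ((1 + s) * (margAC j a c * r c b))) => cs.
    have : log2 (j a b c / (margAC j a c * r' c b)) <= L1.
      apply: log2_le; first exact: Rdiv_lt_0_compat.
      apply: Rle_div_l => //.
      have -> : (1 + s) / (1 - t) * (margAC j a c * r' c b) =
        (1 + s) * (margAC j a c * r c b) + (1 + s) / (1 - t) * (margAC j a c * (t / INR #|B|)).
        by rewrite /r'; field; lra.
      have : 0 <= (1 + s) / (1 - t) * (margAC j a c * (t / INR #|B|)).
        apply: Rmult_le_pos; first by apply/Rlt_le/Rdiv_lt_0_compat; lra.
        by apply: Rmult_le_pos; lra.
      lra.
    move=> le; have := Rmult_le_compat_l _ _ _ (Rlt_le _ _ h) le.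
    have : 0 <= Rabs (j a b c - margAC j a c * r c b) * (K * L2).
      by apply: Rmult_le_pos => //; apply: Rmult_le_pos.
    lra.
  have le : log2 (j a b c / (margAC j a c * r' c b)) <= L2.
    apply: log2_le; first exact: Rdiv_lt_0_compat.
    apply: Rle_div_l => //.
    have -> : INR #|B| / t * (margAC j a c * r' c b) = margAC j a c +
       INR #|B| / t * (margAC j a c * ((1 - t) * r c b)).
      by rewrite /r'; field; lra.
    have : 0 <= INR #|B| / t * (margAC j a c * ((1 - t) * r c b)).
      apply: Rmult_le_pos; first by apply/Rlt_le/Rdiv_lt_0_compat; lra.
      by apply: Rmult_le_pos; [lra | apply: Rmult_le_pos; [lra | apply: r0]].
    lra.
  have jk : j a b c <= Rabs (j a b c - margAC j a c * r c b) * K.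
    apply: Rle_trans (_ : (j a b c - margAC j a c * r c b) * K <= _); last first.
      by apply: Rmult_le_compat_r => //; apply: Rle_abs.
    have -> : j a b c = (j a b c - j a b c / (1 + s)) * K by rewrite /K; field; lra.
    apply: Rmult_le_compat_r => //.
    have : margAC j a c * r c b <= j a b c / (1 + s).
      by apply: Rle_div_r; lra.
    have -> : (j a b c - j a b c / (1 + s)) * K = j a b c by rewrite /K; field; lra.
    lra.
  have := Rmult_le_compat_l _ _ _ (Rlt_le _ _ h) le.
  have := Rmult_le_compat_r _ _ _ L20 jk.
  have := Rmult_le_pos _ _ (Rlt_le _ _ h) L10.
  rewrite Rmult_assoc; lra.
rewrite condMIE; apply: Rle_trans (rsum3_le P) _.
have -> : rsum (fun a => rsum (fun b => rsum (fun c =>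
   j a b c * log2 (margC j c * r' c b / margBC j b c) +
   (j a b c * L1 + Rabs (j a b c - margAC j a c * r c b) * (K * L2))))) =
   rsum (fun a => rsum (fun b => rsum (fun c =>
    j a b c * log2 (margC j c * r' c b / margBC j b c)))) +
   (rsum (fun a => rsum (fun b => rsum (fun c => j a b c))) * L1 +
   rsum (fun a => rsum (fun b => rsum (fun c =>
    Rabs (j a b c - margAC j a c * r c b)))) * (K * L2)).
  rewrite -!rsum_mulr -!rsum_add; apply: eq_rsum => a.
  rewrite -!rsum_mulr -!rsum_add; apply: eq_rsum => b.
  by rewrite -!rsum_mulr -!rsum_add; apply: eq_rsum => c.
have := Rmult_le_compat_r _ _ _ L10 j1.
have := Rmult_le_compat_r (K * L2) _ _ (Rmult_le_pos _ _ K0 L20) jd.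
rewrite -/L1 -/L2 -/K; lra.
Qed.

Definition xlg x := x * log2 x.

(** Without quotients or a test for positivity, continuity and the comparison with entropies both
    reduce to the single function [xlg]. *)
Lemma condMI_xlg : condMI j =
  rsum (fun a => rsum (fun b => rsum (fun c => xlg (j a b c)))) +
  rsum (fun c => xlg (margC j c)) -
  rsum (fun a => rsum (fun c => xlg (margAC j a c))) -
  rsum (fun b => rsum (fun c => xlg (margBC j b c))).
Proof.
have e a b c : j a b c * log2 (j a b c * margC j c / (margAC j a c * margBC j b c)) =
   xlg (j a b c) + j a b c * log2 (margC j c) - j a b c * log2 (margAC j a c)
   - j a b c * log2 (margBC j b c).
  rewrite /xlg; case: (Rle_lt_or_eq_dec _ _ (j0 a b c)) => [h|<-]; last by ring.
  have h1 := j_le_margAC a b c; have h2 := j_le_margBC a b c; have h3 := j_le_margC a b c.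
  rewrite !log2_div ?log2_mul; try lra; try (apply: Rmult_lt_0_compat; lra).
rewrite condMIE (eq_rsum3 e).
have -> : rsum (fun c => xlg (margC j c)) = rsum (fun a => rsum (fun b => rsum (fun c =>
  j a b c * log2 (margC j c)))).
  rewrite rsum3_rot; apply: eq_rsum => c; rewrite /xlg /margC -rsum_mulr.
  by apply: eq_rsum => a; rewrite rsum_mulr.
have -> : rsum (fun a => rsum (fun c => xlg (margAC j a c))) =
  rsum (fun a => rsum (fun b => rsum (fun c => j a b c * log2 (margAC j a c)))).
  apply: eq_rsum => a; rewrite rsum_exch; apply: eq_rsum => c.
  by rewrite rsum_mulr.
have -> : rsum (fun b => rsum (fun c => xlg (margBC j b c))) =
  rsum (fun a => rsum (fun b => rsum (fun c => j a b c * log2 (margBC j b c)))).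
  rewrite rsum_exch rsum3_rot; apply: eq_rsum => c; rewrite rsum_exch; apply: eq_rsum => b.
  by rewrite rsum_mulr.
rewrite -rsum_add -!rsum_sub; apply: eq_rsum => a.
rewrite -rsum_add -!rsum_sub; apply: eq_rsum => b.
by rewrite -rsum_add -!rsum_sub; apply: eq_rsum => c.
Qed.
End CondMI.

(** * Product measures, soft covering and threshold decoding *)

Definition Rltb x y : bool := if Rlt_dec x y then true else false.
Lemma RltbP x y : reflect (x < y) (Rltb x y).
Proof. by rewrite /Rltb; case: Rlt_dec => h; constructor. Qed.

(** The variance of [Rabs (f t)] is nonnegative. *)
Lemma abs_mean_le (T : finType) (p f : T -> R) v :
  (forall t, 0 <= p t) -> rsum p = 1 -> 0 <= v ->
  rsum (fun t => p t * (f t * f t)) <= v * v -> rsum (fun t => p t * Rabs (f t)) <= v.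
Proof.
move=> p0 p1 v0 le; have [m mE] : exists m, rsum (fun t => p t * Rabs (f t)) = m by eexists.
rewrite mE; have m0 : 0 <= m by rewrite -mE; apply: rsum_ge0 => t; apply: Rmult_le_pos => //; apply: Rabs_pos.
have : 0 <= rsum (fun t => p t * ((Rabs (f t) - m) * (Rabs (f t) - m))).
  by apply: rsum_ge0 => t; apply: Rmult_le_pos => //; apply: Rle_0_sqr.
have -> : rsum (fun t => p t * ((Rabs (f t) - m) * (Rabs (f t) - m))) =
   rsum (fun t => p t * (f t * f t)) - 2 * m * m + m * m.
  transitivity (rsum (fun t => p t * (f t * f t)) -
     2 * m * rsum (fun t => p t * Rabs (f t)) + m * m * rsum p); last first.
    by rewrite p1 mE; ring.
  rewrite -!rsum_mull -rsum_sub -rsum_add; apply: eq_rsum => t.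
  have -> : f t * f t = Rabs (f t) * Rabs (f t) by rewrite -Rabs_mult Rabs_pos_eq //; apply: Rle_0_sqr.
  by ring.
nra.
Qed.

(** * Product measures: resampling, variance and Chebyshev's inequality *)

Section Pm.
Variables (I A : finType) (p : A -> R).

(** Used at two levels: for words of length n, and for random codebooks, whose index set is the set
    of pairs (m,l) and whose letters are whole words. *)
Definition pm (C : {ffun I -> A}) : R := \big[Rmult/R1]_(i : I) p (C i).
Definition upd (C : {ffun I -> A}) (i : I) (a : A) : {ffun I -> A} :=
  [ffun j => if j == i then a else C j].

Lemma upd_same (C : {ffun I -> A}) i a : upd C i a i = a. Proof. by rewrite ffunE eqxx. Qed.
Lemma upd_other (C : {ffun I -> A}) i a j : j != i -> upd C i a j = C j.
Proof. by rewrite ffunE => /negbTE ->. Qed.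
Lemma upd_upd (C : {ffun I -> A}) i a : upd (upd C i a) i (C i) = C.
Proof. by apply/ffunP => j; rewrite !ffunE; case: eqP => // ->. Qed.

Lemma rsum_ffun (g : I -> A -> R) :
  rsum (fun C : {ffun I -> A} => \big[Rmult/R1]_(i : I) g i (C i)) =
  \big[Rmult/R1]_(i : I) rsum (g i).
Proof. by rewrite /rsum bigA_distr_bigA. Qed.

Lemma pm_upd (C : {ffun I -> A}) i a : p (C i) * pm (upd C i a) = p a * pm C.
Proof.
rewrite /pm (bigD1 i) //= [X in p a * X](bigD1 i) //= upd_same.
rewrite (eq_bigr (fun j => p (C j))); first by rewrite -!Rmult_assoc [p a * p (C i)]Rmult_comm.
by move=> j ji; rewrite upd_other.
Qed.

Hypothesis p0 : forall a, 0 <= p a.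
Hypothesis p1 : rsum p = 1.

Lemma pm_ge0 (C : {ffun I -> A}) : 0 <= pm C.
Proof. by rewrite /pm; elim/big_rec: _ => [|i x _ h]; [lra | apply: Rmult_le_pos]. Qed.

Lemma pm_gt0 (C : {ffun I -> A}) : 0 < pm C -> forall i, 0 < p (C i).
Proof.
move=> h i; case: (Rle_lt_or_eq_dec _ _ (p0 (C i))) => // e.
by move: h; rewrite /pm (bigD1 i) //= -e Rmult_0_l; lra.
Qed.

Lemma pm_sum1 : rsum pm = 1.
Proof. by rewrite (rsum_ffun (fun _ => p)) big1. Qed.

(** Swapping coordinate i with an independent fresh letter is a measure preserving involution. The
    moments of [pm] and the conditional independence in [cond_resample] all come from this
    identity. *)
Lemma pm_resample i (F : {ffun I -> A} -> R) :
  rsum (fun C => pm C * F C) =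
  rsum (fun C => pm C * rsum (fun a => p a * F (upd C i a))).
Proof.
pose h (t : {ffun I -> A} * A) := (upd t.1 i t.2, t.1 i).
have hK : involutive h by move=> [C a]; rewrite /h /= upd_same upd_upd.
transitivity (rsum (fun t : {ffun I -> A} * A => pm t.1 * p t.2 * F t.1)).
  rewrite (rsum_pair (fun C a => pm C * p a * F C)); apply: eq_rsum => C.
  by rewrite rsum_mulr rsum_mull p1; ring.
rewrite (rsum_reindex _ (inv_bij hK)) rsum_pairE; apply: eq_rsum => C.
rewrite -rsum_mull; apply: eq_rsum => a /=.
by rewrite (Rmult_comm (pm _)) pm_upd; ring.
Qed.

Lemma pm_E1 i (g : A -> R) :
  rsum (fun C : {ffun I -> A} => pm C * g (C i)) = rsum (fun a => p a * g a).
Proof.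
rewrite (pm_resample i) -[RHS]Rmult_1_l -pm_sum1 -rsum_mulr.
apply: eq_rsum => C; congr (_ * _); apply: eq_rsum => a; by rewrite upd_same.
Qed.

Lemma pm_E2 i j (g : A -> A -> R) : i != j ->
  rsum (fun C : {ffun I -> A} => pm C * g (C i) (C j)) =
  rsum (fun a => p a * rsum (fun b => p b * g a b)).
Proof.
move=> ij; rewrite (pm_resample i).
transitivity (rsum (fun C : {ffun I -> A} => pm C *
   (fun b => rsum (fun a => p a * g a b)) (C j))).
  apply: eq_rsum => C; congr (_ * _); apply: eq_rsum => a.
  by rewrite upd_same upd_other // eq_sym.
rewrite (pm_E1 j (fun b => rsum (fun a => p a * g a b))).
under eq_rsum => b do rewrite -rsum_mull.
rewrite rsum_exch; apply: eq_rsum => a; rewrite -rsum_mull; apply: eq_rsum => b; ring.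
Qed.

(** Distinct coordinates are independent and centred, so only the diagonal of the double sum
    survives. *)
Lemma pm_var (h : A -> R) : rsum (fun a => p a * h a) = 0 ->
  rsum (fun C => pm C * (rsum (fun i => h (C i)) * rsum (fun i => h (C i)))) =
  INR #|I| * rsum (fun a => p a * (h a * h a)).
Proof.
move=> h0.
transitivity (rsum (fun i : I => rsum (fun j : I =>
    rsum (fun C => pm C * (h (C i) * h (C j)))))).
  rewrite rsum3_rot; apply: eq_rsum => C.
  rewrite -rsum_mulr -rsum_mull; apply: eq_rsum => i.
  by rewrite -rsum_mull -rsum_mull; apply: eq_rsum => j.
rewrite -rsum_const; apply: eq_rsum => i.
rewrite -[RHS](rsum_delta i (fun _ => rsum (fun a => p a * (h a * h a)))).
apply: eq_rsum => j; case: (eqVneq i j) => [->|ij].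
  by rewrite (pm_E1 j (fun a => h a * h a)) /ind Rmult_1_r.
rewrite (pm_E2 (fun a b => h a * h b) ij) /ind Rmult_0_r.
apply: rsum_eq0f => a.
rewrite (_ : rsum _ = rsum (fun b => p b * h b) * h a); first by rewrite h0; ring.
by rewrite -rsum_mulr; apply: eq_rsum => b; ring.
Qed.

End Pm.

(** The event has to imply a large deviation only on words of positive mass; this is where the
    logarithms taken later have positive arguments. *)
Lemma pm_chebyshev (n : nat) (A : finType) (p f : A -> R) (mu d : R)
  (ev : {ffun 'I_n -> A} -> bool) :
  (forall a, 0 <= p a) -> rsum p = 1 -> mu = rsum (fun a => p a * f a) ->
  0 < d -> (0 < n)%nat ->
  (forall C : {ffun _ -> A}, (forall i, 0 < p (C i)) -> ev C ->
     INR n * d <= Rabs (rsum (fun i => f (C i)) - INR n * mu)) ->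
  rsum (fun C => pm p C * ind (ev C)) <=
  rsum (fun a => p a * ((f a - mu) * (f a - mu))) / (INR n * d * d).
Proof.
move=> p0 p1 mE d0 n0 evP.
have n1 : 0 < INR n by apply: lt_0_INR; apply/ltP.
pose h a := f a - mu.
have h0 : rsum (fun a => p a * h a) = 0.
  transitivity (rsum (fun a => p a * f a - p a * mu)).
    by apply: eq_rsum => a; rewrite /h; ring.
  by rewrite rsum_sub rsum_mulr p1 -mE; ring.
have V := pm_var 'I_n p1 h0; rewrite card_ord in V.
have nd : 0 < INR n * d by apply: Rmult_lt_0_compat.
apply: Rle_div_r; first by apply: Rmult_lt_0_compat.
apply: (Rmult_le_reg_r (INR n)) => //.
rewrite [X in _ <= X]Rmult_comm -V Rmult_assoc -rsum_mulr.
apply: rsum_le => C.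
have C0 := pm_ge0 p0 C.
have -> : rsum (fun i => h (C i)) = rsum (fun i => f (C i)) - INR n * mu.
  by rewrite /h rsum_sub rsum_const card_ord.
set S := _ - INR n * mu.
rewrite Rmult_assoc; case: (Rle_lt_or_eq_dec _ _ C0) => [Cp|<-]; last by lra.
apply: Rmult_le_compat_l => //.
case e : (ev C); rewrite /ind; last by rewrite Rmult_0_l; apply: Rle_0_sqr.
have := evP C (pm_gt0 p0 Cp) e; rewrite -/S => le.
have -> : S * S = Rabs S * Rabs S by rewrite -Rabs_mult Rabs_pos_eq //; apply: Rle_0_sqr.
have := Rmult_le_compat _ _ _ _ (Rlt_le _ _ nd) (Rlt_le _ _ nd) le le; lra.
Qed.

(** * Soft covering by a random codebook *)

Section Covering.
Variables (A B K : finType) (pA : A -> R) (V : A -> B -> R).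
Hypothesis pA0 : forall a, 0 <= pA a.
Hypothesis pA1 : rsum pA = 1.
Hypothesis V0 : forall a b, 0 <= V a b.
Definition outp b := rsum (fun a => pA a * V a b).
Hypothesis K0 : (0 < #|K|)%nat.

Lemma outp_ge0 b : 0 <= outp b.
Proof. by apply: rsum_ge0 => a; apply: Rmult_le_pos. Qed.

(* V is truncated at [tau * outp]: the truncated part has small variance, the rest has
   small expectation. *)
Lemma soft_covering (tau : R) : 0 < tau -> rsum outp = 1 ->
  rsum (fun C : {ffun K -> A} => pm pA C *
    rsum (fun b => Rabs (/ INR #|K| * rsum (fun k => V (C k) b) - outp b))) <=
  sqrt (tau / INR #|K|) +
  2 * rsum (fun a => rsum (fun b => pA a * V a b * ind (Rltb (tau * outp b) (V a b)))).
Proof.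
move=> t0 o1; set N := INR #|K|.
have N0 : 0 < N by apply: lt_0_INR; apply/ltP.
have Ni : 0 < / N by apply: Rinv_0_lt_compat.
pose V2 a b := V a b * ind (Rltb (tau * outp b) (V a b)).
pose V1 a b := V a b * ind (~~ Rltb (tau * outp b) (V a b)).
have V12 a b : V a b = V1 a b + V2 a b by rewrite /V1 /V2; case: Rltb; rewrite /ind /=; ring.
have V10 a b : 0 <= V1 a b by apply: Rmult_le_pos => //; apply: ind_ge0.
have V20 a b : 0 <= V2 a b by apply: Rmult_le_pos => //; apply: ind_ge0.
have V1le a b : V1 a b <= tau * outp b.
  rewrite /V1; case: RltbP => h; rewrite /ind /=; last by lra.
  by rewrite Rmult_0_r; apply: Rmult_le_pos; [lra | apply: outp_ge0].
pose p1 b := rsum (fun a => pA a * V1 a b); pose p2 b := rsum (fun a => pA a * V2 a b).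
have p12 b : outp b = p1 b + p2 b.
  by rewrite -rsum_add; apply: eq_rsum => a; rewrite V12; ring.
have p20 b : 0 <= p2 b by apply: rsum_ge0 => a; apply: Rmult_le_pos.
pose h b a := V1 a b - p1 b.
have ineq (C : {ffun K -> A}) b : Rabs (/ N * rsum (fun k => V (C k) b) - outp b) <=
   Rabs (/ N * rsum (fun k => h b (C k))) + (/ N * rsum (fun k => V2 (C k) b) + p2 b).
  have -> : / N * rsum (fun k => V (C k) b) - outp b =
    / N * rsum (fun k => h b (C k)) + (/ N * rsum (fun k => V2 (C k) b) - p2 b).
    have -> : rsum (fun k => V (C k) b) = rsum (fun k => h b (C k)) + N * p1 b + rsum (fun k => V2 (C k) b).
      rewrite -(rsum_const K) -!rsum_add; apply: eq_rsum => k; rewrite V12 /h; ring.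
    rewrite p12; field; lra.
  apply: Rle_trans (Rabs_triang _ _) _; apply: Rplus_le_compat_l.
  have : 0 <= / N * rsum (fun k => V2 (C k) b).
    by apply: Rmult_le_pos; [lra | apply: rsum_ge0].
  by have := p20 b; rewrite /Rabs; case: Rcase_abs; lra.
pose kap := sqrt (tau / N).
have k0 : 0 <= kap by apply: sqrt_pos.
have tN : 0 < tau / N by apply: Rdiv_lt_0_compat.
have kk : kap * kap = tau / N by apply: sqrt_sqrt; lra.
have first b : rsum (fun C => pm pA C * Rabs (/ N * rsum (fun k : K => h b (C k)))) <= kap * outp b.
  apply: abs_mean_le; [exact: pm_ge0 | exact: pm_sum1 | | ].
    by apply: Rmult_le_pos => //; apply: outp_ge0.
  have hz : rsum (fun a => pA a * h b a) = 0.
    transitivity (rsum (fun a => pA a * V1 a b - pA a * p1 b)).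
      by apply: eq_rsum => a; rewrite /h; ring.
    by rewrite rsum_sub rsum_mulr pA1 -/(p1 b); ring.
  have -> : rsum (fun C => pm pA C * (/ N * rsum (fun k : K => h b (C k)) * (/ N * rsum (fun k => h b (C k)))))
     = / N * / N * rsum (fun C => pm pA C * (rsum (fun k : K => h b (C k)) * rsum (fun k => h b (C k)))).
    by rewrite -rsum_mull; apply: eq_rsum => C; ring.
  rewrite pm_var // -/N.
  (* The variance is at most the second moment of [V1]. One factor [V1] is at most [tau * outp b],
     the other at most [V a b], whose mean is [outp b]. *)
  have hh : rsum (fun a => pA a * (h b a * h b a)) <= tau * outp b * outp b.
    apply: Rle_trans (_ : rsum (fun a => pA a * (V1 a b * V1 a b)) <= _).
      have -> : rsum (fun a => pA a * (h b a * h b a)) =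
        rsum (fun a => pA a * (V1 a b * V1 a b)) - p1 b * p1 b.
        transitivity (rsum (fun a => pA a * (V1 a b * V1 a b)) -
          2 * p1 b * rsum (fun a => pA a * V1 a b) + p1 b * p1 b * rsum pA); last first.
          by rewrite pA1 -/(p1 b); ring.
        rewrite -(rsum_mull (2 * p1 b)) -(rsum_mull (p1 b * p1 b)) -rsum_sub -rsum_add.
        by apply: eq_rsum => a; rewrite /h; ring.
      have := Rle_0_sqr (p1 b); rewrite /Rsqr; lra.
    apply: Rle_trans (_ : rsum (fun a => tau * outp b * (pA a * V a b)) <= _); last first.
      by rewrite rsum_mull -/(outp b); lra.
    apply: rsum_le => a.
    have -> : tau * outp b * (pA a * V a b) = pA a * (tau * outp b * V a b) by ring.
    apply: Rmult_le_compat_l => //; apply: Rmult_le_compat => //.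
    by rewrite [V a b]V12; have := V20 a b; lra.
  have -> : kap * outp b * (kap * outp b) = / N * (tau * outp b * outp b).
    by rewrite (_ : _ * _ = (kap * kap) * (outp b * outp b)); [rewrite kk /Rdiv; ring | ring].
  have -> : / N * / N * (N * rsum (fun a => pA a * (h b a * h b a))) = / N * rsum (fun a => pA a * (h b a * h b a)).
    by field; lra.
  by apply: Rmult_le_compat_l; lra.
have second b : rsum (fun C => pm pA C * (/ N * rsum (fun k : K => V2 (C k) b) + p2 b)) = 2 * p2 b.
  transitivity (rsum (fun C => / N * rsum (fun k : K => pm pA C * V2 (C k) b) + pm pA C * p2 b)).
    by apply: eq_rsum => C; rewrite rsum_mull; ring.
  rewrite rsum_add rsum_mulr pm_sum1 // rsum_mull rsum_exch.
  rewrite (eq_rsum (g := fun _ => p2 b)); last by move=> k; rewrite (pm_E1 pA1 k (fun a => V2 a b)).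
  by rewrite rsum_const -/N; field; lra.
apply: Rle_trans (_ : rsum (fun C : {ffun K -> A} => rsum (fun b =>
   pm pA C * Rabs (/ N * rsum (fun k => h b (C k))) +
   pm pA C * (/ N * rsum (fun k => V2 (C k) b) + p2 b))) <= _).
  apply: rsum_le => C; rewrite -rsum_mull; apply: rsum_le => b.
  by rewrite -Rmult_plus_distr_l; apply: Rmult_le_compat_l; [apply: pm_ge0 | apply: ineq].
rewrite [X in X <= _]rsum_exch.
apply: Rle_trans (_ : rsum (fun b => kap * outp b + 2 * p2 b) <= _).
  by apply: rsum_le => b; rewrite rsum_add second; have := first b; lra.
rewrite rsum_add !rsum_mull o1 /p2 rsum_exch.
have -> : rsum (fun a => rsum (fun b => pA a * V2 a b)) =
   rsum (fun a => rsum (fun b => pA a * V a b * ind (Rltb (tau * outp b) (V a b)))).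
  by apply: eq_rsum => a; apply: eq_rsum => b; rewrite /V2; ring.
rewrite /kap; lra.
Qed.
End Covering.

(** * Decoding by a likelihood ratio threshold *)

Section Decoding.
Variables (A B M L : finType) (pA : A -> R) (V : A -> B -> R) (l0 : L) (sg : R).
Hypothesis pA0 : forall a, 0 <= pA a.
Hypothesis pA1 : rsum pA = 1.
Hypothesis V0 : forall a b, 0 <= V a b.
Hypothesis V1 : forall a, rsum (V a) = 1.
Hypothesis M0 : (0 < #|M|)%nat.
Hypothesis sg0 : 0 < sg.

Definition fails a b := Rltb (V a b) (sg * outp pA V b).
Definition decode (C : {ffun M * L -> A}) (m : M) (b : B) : L :=
  odflt l0 [pick l | ~~ fails (C (m, l)) b].

(** Either the correct word fails its test or another word of row m passes. The default [l0] is
    covered too: it is returned only when all words fail, the correct one included. *)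
Lemma decode_err (C : {ffun M * L -> A}) (m : M) (l : L) (b : B) :
  ind (decode C m b != l) <=
  ind (fails (C (m, l)) b) + rsum (fun l' => ind (~~ fails (C (m, l')) b) * ind (l != l')).
Proof.
set S := rsum _.
have s0 l' : 0 <= ind (~~ fails (C (m, l')) b) * ind (l != l').
  by apply: Rmult_le_pos; apply: ind_ge0.
have S0 : 0 <= S by apply: rsum_ge0.
have St l' : ind (~~ fails (C (m, l')) b) * ind (l != l') <= S by apply: (rsum_term l' s0).
have f0 := ind_ge0 (fails (C (m, l)) b).
have i1 : ind true = 1 by [].
have i0 : ind false = 0 by [].
rewrite /decode; case: pickP => [l' h|h] /=; last first.
  by have := h l => /negbFE ->; have := ind_le1 (l0 != l); lra.
case: eqP => [_|ne] /=; first lra.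
have := St l'; rewrite h.
have /eqP/negbTE -> : l <> l' by move=> e; apply: ne.
by move: f0; rewrite {2 3}/ind /=; lra.
Qed.

(** Union bound over the wrong l'. A wrong word a' is independent of the word in use, so b has law
    [outp] for it. Where a' passes, [outp b <= V a' b / sg], and [V a'] has mass 1, so it passes
    with probability at most [/ sg]. *)
Lemma decoding :
  rsum (fun C : {ffun M * L -> A} => pm pA C *
    (/ INR #|{: M * L}| * rsum (fun k : M * L => rsum (fun b => V (C k) b * ind (decode C k.1 b != k.2)))))
  <= rsum (fun a => rsum (fun b => pA a * V a b * ind (fails a b))) + (INR #|L| - 1) / sg.
Proof.
set N := INR _.
have L0 : (0 < #|L|)%nat by apply/card_gt0P; exists l0.
have N0 : 0 < N by apply: lt_0_INR; apply/ltP; rewrite card_prod muln_gt0 M0.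
have Ni : 0 < / N by apply: Rinv_0_lt_compat.
set P1 := rsum (fun a => _).
pose e1 k := rsum (fun C : {ffun M * L -> A} => pm pA C * rsum (fun b => V (C k) b * ind (decode C k.1 b != k.2))).
suff H k : e1 k <= P1 + (INR #|L| - 1) / sg.
  have -> : rsum (fun C : {ffun M * L -> A} => pm pA C *
    (/ N * rsum (fun k : M * L => rsum (fun b => V (C k) b * ind (decode C k.1 b != k.2)))))
    = / N * rsum e1.
    rewrite /e1 [in RHS]rsum_exch -[RHS]rsum_mull; apply: eq_rsum => C.
    by rewrite [in RHS]rsum_mull -!Rmult_assoc [_ * / N]Rmult_comm.
  have := rsum_le H; rewrite rsum_const => le.
  have := Rmult_le_compat_l _ _ _ (Rlt_le _ _ Ni) le; rewrite -/N.
  rewrite -Rmult_assoc Rinv_l; lra.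
case: k => m l; rewrite /e1 /=.
pose g a a' := rsum (fun b => V a b * ind (~~ fails a' b)).
apply: Rle_trans (_ : rsum (fun C : {ffun M * L -> A} =>
   pm pA C * rsum (fun b => V (C (m, l)) b * ind (fails (C (m, l)) b)) +
   rsum (fun l' => pm pA C * g (C (m, l)) (C (m, l')) * ind (l != l'))) <= _).
  apply: rsum_le => C; rewrite (eq_rsum (g := fun l' => pm pA C * (g (C (m, l)) (C (m, l')) * ind (l != l')))); last by move=> ?; rewrite Rmult_assoc.
  rewrite rsum_mull -Rmult_plus_distr_l; apply: Rmult_le_compat_l; first exact: pm_ge0.
  under [X in _ <= _ + X]eq_rsum => l' do rewrite /g -rsum_mulr.
  rewrite rsum_exch -rsum_add; apply: rsum_le => b.
  rewrite (eq_rsum (g := fun l' => V (C (m, l)) b * (ind (~~ fails (C (m, l')) b) * ind (l != l')))); last by move=> ?; rewrite Rmult_assoc.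
  rewrite rsum_mull -Rmult_plus_distr_l; apply: Rmult_le_compat_l => //; exact: decode_err.
rewrite rsum_add; apply: Rplus_le_compat.
  rewrite (pm_E1 pA1 (m, l) (fun a => rsum (fun b => V a b * ind (fails a b)))) /P1.
  right; apply: eq_rsum => a; rewrite -rsum_mull; apply: eq_rsum => b; ring.
rewrite rsum_exch.
apply: Rle_trans (_ : rsum (fun l' => / sg * ind (l != l')) <= _); last first.
  have -> : rsum (fun l' => / sg * ind (l != l')) = / sg * (INR #|L| * 1 - 1).
    rewrite rsum_mull -rsum_const; congr (_ * _).
    rewrite -[X in _ - X](rsum_delta l (fun _ => 1)) -rsum_sub.
    by apply: eq_rsum => l'; case: eqP => _; rewrite /ind /=; ring.
  by apply: Req_le; rewrite Rmult_1_r; apply: Rmult_comm.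
apply: rsum_le => l'; rewrite rsum_mulr; case: (eqVneq l l') => [_|ne] /=; first by rewrite /ind; lra.
apply: Rmult_le_compat_r; first (rewrite ?/ind; lra).
have ne2 : (m, l) != (m, l') by rewrite xpair_eqE eqxx.
rewrite (pm_E2 pA1 g ne2).
have -> : rsum (fun a => pA a * rsum (fun a' => pA a' * g a a')) =
  rsum (fun a' => pA a' * rsum (fun b => outp pA V b * ind (~~ fails a' b))).
  under eq_rsum => a do rewrite -rsum_mull.
  rewrite rsum_exch; apply: eq_rsum => a'.
  rewrite /g /outp.
  under [in RHS]eq_rsum => b do rewrite -rsum_mulr.
  rewrite rsum_exch -rsum_mull; apply: eq_rsum => a.
  by rewrite -!rsum_mull; apply: eq_rsum => b; ring.
apply: Rle_trans (_ : rsum (fun a' => pA a' * / sg) <= _); last first.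
  by rewrite rsum_mulr pA1; lra.
apply: rsum_le => a'; apply: Rmult_le_compat_l => //.
rewrite -[/ sg]Rmult_1_l -(V1 a') -rsum_mulr; apply: rsum_le => b.
rewrite /fails; case: RltbP => h; rewrite /ind /=.
  by rewrite Rmult_0_r; apply: Rmult_le_pos => //; apply/Rlt_le/Rinv_0_lt_compat.
by rewrite Rmult_1_r; apply: Rle_div_r; lra.
Qed.
End Decoding.

(** * One-shot achievability *)

Arguments ind : simpl never.

Lemma kernel_mull (A B : finType) (k : A -> B -> R) a x :
  is_kernel k -> rsum (fun b => x * k a b) = x.
Proof. by move=> [_ k1]; rewrite rsum_mull k1 Rmult_1_r. Qed.

(** Conditional law of B given A for an unnormalized table. The uniform law on rows of mass zero
    makes it a kernel everywhere, and [disintE] still holds on those rows. *)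
Definition disint (A B : finType) (j : A -> B -> R) (a : A) (b : B) : R :=
  if Req_EM_T (rsum (j a)) 0 then / INR #|B| else j a b / rsum (j a).

Lemma disint_kernel (A B : finType) (j : A -> B -> R) :
  (forall a b, 0 <= j a b) -> (0 < #|B|)%nat -> is_kernel (disint j).
Proof.
move=> j0 B0.
have b0 : 0 < INR #|B| by apply: lt_0_INR; apply/ltP.
have s0 a : 0 <= rsum (j a) by apply: rsum_ge0.
split=> [a b|a]; rewrite /disint; case: Req_EM_T => h.
- by apply/Rlt_le/Rinv_0_lt_compat.
- apply: Rmult_le_pos => //; apply/Rlt_le/Rinv_0_lt_compat.
  by have := s0 a; lra.
- by rewrite rsum_const; field; lra.
- by rewrite /Rdiv rsum_mulr; field.
Qed.

Lemma disintE (A B : finType) (j : A -> B -> R) a b :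
  (forall a b, 0 <= j a b) -> j a b = rsum (j a) * disint j a b.
Proof.
move=> j0; rewrite /disint; case: Req_EM_T => h /=; last by field.
by rewrite {1}h Rmult_0_l; apply: (rsum_eq0 (f := j a)).
Qed.

Section OneShot.
Variables (A X Y Z M L : finType) (pA : A -> R) (pXY : X -> Y -> R).
Variables (a : A -> X -> R) (b : X -> Y -> R) (c : A * Y -> Z -> R).
Variables (e : Y * Z -> X -> R) (p : X -> Y -> Z -> R) (tau sg : R).
Hypothesis pA0 : forall u, 0 <= pA u.
Hypothesis pA1 : rsum pA = 1.
Hypothesis ka : is_kernel a.
Hypothesis kb : is_kernel b.
Hypothesis kc : is_kernel c.
Hypothesis ke : is_kernel e.
(** The factors [a], [b], [c] are p(x|u), p(y|x) and p(z|u,y). The kernel [e] is p(x|y,z); by [eE]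
    it is the same for every u of positive mass, which expresses U - (Y,Z) - X. *)
Definition testch (u : A) (w : X * Y * Z) : R :=
  a u w.1.1 * b w.1.1 w.1.2 * c (u, w.1.2) w.2.
Definition testchY (u : A) (y : Y) : R := rsum (fun x => a u x * b x y).
Hypothesis pE : forall w, outp pA testch w = p w.1.1 w.1.2 w.2.
Hypothesis bE : forall x y, pXY x y = rsum (pXY x) * b x y.
Hypothesis pXYE : forall x y, pXY x y = rsum (p x y).
Hypothesis eE : forall u x y z, 0 < pA u ->
  testch u (x, y, z) = rsum (fun x' => testch u (x', y, z)) * e (y, z) x.
Hypothesis t0 : 0 < tau.
Hypothesis s0 : 0 < sg.
Hypothesis M0 : (0 < #|M|)%nat.
Hypothesis L0 : (0 < #|L|)%nat.
Hypothesis X0 : (0 < #|X|)%nat.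
Variable l0 : L.

Lemma testch_ge0 u w : 0 <= testch u w.
Proof. by case: ka kb kc => ? _ [? _] [? _]; do 2! apply: Rmult_le_pos => //. Qed.

Lemma testch_sum u : rsum (testch u) = 1.
Proof.
rewrite rsum_pairE rsum_pairE /testch /=.
transitivity (rsum (a u)); last by case: ka.
apply: eq_rsum => x; transitivity (rsum (fun y => a u x * b x y)).
  by apply: eq_rsum => y; rewrite kernel_mull.
by rewrite kernel_mull.
Qed.

Lemma testchY_ge0 u y : 0 <= testchY u y.
Proof. by case: ka kb => ? _ [? _]; apply: rsum_ge0 => x; apply: Rmult_le_pos. Qed.

Lemma testchY_sum u : rsum (testchY u) = 1.
Proof.
rewrite /testchY rsum_exch; transitivity (rsum (a u)); last by case: ka.
by apply: eq_rsum => x; rewrite kernel_mull.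
Qed.

Definition covering_tail := rsum (fun u => rsum (fun w =>
   pA u * testch u w * ind (Rltb (tau * outp pA testch w) (testch u w)))).
Definition decoding_tail := rsum (fun u => rsum (fun y =>
   pA u * testchY u y * ind (fails pA testchY sg u y))).

(** * Analysis of a fixed codebook *)

Section Codebook.
Variable C : {ffun M * L -> A}.
Let N := INR #|{: M * L}|.

Lemma N_gt0 : 0 < N.
Proof. by apply: lt_0_INR; apply/ltP; rewrite card_prod muln_gt0 M0. Qed.
Let Ni : 0 < / N := Rinv_0_lt_compat _ N_gt0.

Definition idealX (x : X) (k : M * L) := / N * a (C k) x.
Definition qX x := rsum (idealX x).
Definition dec_l (m : M) (y : Y) : L := decode pA testchY l0 sg C m y.
Definition ideal (k : M * L) (w : X * Y * Z) := / N * testch (C k) w.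
(** The likelihood encoder: the posterior law of the index pair given x in the ideal experiment. *)
Definition genc := disint idealX.
(** The experiment run by the code. Alice's l is still recorded, although Bob uses his own estimate,
    so that this law can be compared with [ideal] index by index. *)
Definition real (k : M * L) (w : X * Y * Z) :=
  pXY w.1.1 w.1.2 * genc w.1.1 k * c (C (k.1, dec_l k.1 w.1.2), w.1.2) w.2.
Definition cov := rsum (fun w => Rabs (/ N * rsum (fun k => testch (C k) w) - outp pA testch w)).
Definition err := / N * rsum (fun k : M * L => rsum (fun y =>
  testchY (C k) y * ind (dec_l k.1 y != k.2))).

Lemma idealX_ge0 x k : 0 <= idealX x k.
Proof. by case: ka => ? _; apply: Rmult_le_pos => //; lra. Qed.

Lemma genc_kernel : is_kernel genc.
Proof.
by apply: disint_kernel; [apply: idealX_ge0 | rewrite card_prod muln_gt0 M0].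
Qed.

(* The two errors are separated by the law qX(x) genc(k|x) b(y|x) c(z|u(m,dec_l),y):
   it differs from [real] only in the law of x, and from [ideal] only when [dec_l] errs. *)
Lemma real_ideal k w : Rabs (real k w - ideal k w) <=
  Rabs (rsum (pXY w.1.1) - qX w.1.1) * genc w.1.1 k * b w.1.1 w.1.2 *
     c (C (k.1, dec_l k.1 w.1.2), w.1.2) w.2 +
  / N * (a (C k) w.1.1 * b w.1.1 w.1.2 * ind (dec_l k.1 w.1.2 != k.2)) *
     (c (C (k.1, dec_l k.1 w.1.2), w.1.2) w.2 + c (C k, w.1.2) w.2).
Proof.
case: w => [[x y] z] /=; rewrite /real /ideal /testch /=.
set ch := c (C (k.1, _), y) z.
have [g0 _] := genc_kernel; have [a0 _] := ka; have [b0 _] := kb; have [c0 _] := kc.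
have gE : / N * a (C k) x = qX x * genc x k.
  by rewrite /qX /genc -disintE //; apply: idealX_ge0.
have -> : pXY x y * genc x k * ch - / N * (a (C k) x * b x y * c (C k, y) z) =
  (rsum (pXY x) - qX x) * genc x k * b x y * ch +
  / N * (a (C k) x * b x y) * (ch - c (C k, y) z).
  transitivity ((rsum (pXY x)) * genc x k * b x y * ch - (qX x * genc x k) * b x y * ch +
     / N * (a (C k) x * b x y) * (ch - c (C k, y) z)); last by ring.
  by rewrite -gE bE; ring.
apply: Rle_trans (Rabs_triang _ _) _; apply: Rplus_le_compat.
  by rewrite !Rabs_mult (Rabs_pos_eq (genc _ _)) // (Rabs_pos_eq (b _ _)) // (Rabs_pos_eq ch) ?/ch //; lra.
case: (eqVneq (dec_l k.1 y) k.2) => [ek|ne].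
  rewrite /ch ek (_ : (k.1, k.2) = k); last by case: (k).
  by rewrite Rminus_diag Rmult_0_r Rabs_R0 /ind /= !(Rmult_0_r, Rmult_0_l); lra.
rewrite /ind /= Rmult_1_r Rabs_mult (Rabs_pos_eq (/ N * _)); last first.
  by do 2! [apply: Rmult_le_pos => //; try lra].
apply: Rmult_le_compat_l; first by do 2! [apply: Rmult_le_pos => //; try lra].
have := c0 (C (k.1, dec_l k.1 y), y) z; rewrite -/ch; have := c0 (C k, y) z => h1 h2.
by apply: Rabs_le; lra.
Qed.

(** Passing to the marginal of x cannot increase the distance. *)
Lemma qX_cov : rsum (fun x => Rabs (rsum (pXY x) - qX x)) <= cov.
Proof.
rewrite /cov rsum_pairE rsum_pairE.
apply: rsum_le => x; apply: Rle_trans (_ : rsum (fun y => Rabs (rsum (fun z =>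
  / N * rsum (fun k => testch (C k) (x, y, z)) - outp pA testch (x, y, z)))) <= _); last first.
  by apply: rsum_le => y; apply: rsum_abs.
apply: Rle_trans _ (rsum_abs _); right.
rewrite Rabs_minus_sym; congr Rabs.
rewrite /qX /idealX.
have -> : rsum (fun y => rsum (fun z =>
  / N * rsum (fun k => testch (C k) (x, y, z)) - outp pA testch (x, y, z))) =
  rsum (fun y => rsum (fun z => rsum (fun k => / N * testch (C k) (x, y, z)))) - rsum (pXY x).
  rewrite -rsum_sub; apply: eq_rsum => y; rewrite rsum_sub pXYE; congr (_ - _).
    by apply: eq_rsum => z; rewrite rsum_mull.
  by apply: eq_rsum => z; rewrite pE.
congr (_ - _); under [in RHS]eq_rsum => y do rewrite rsum_exch.
rewrite [in RHS]rsum_exch; apply: eq_rsum => k; rewrite /testch /=.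
transitivity (rsum (fun y => (/ N * a (C k) x) * b x y)).
  by rewrite kernel_mull.
apply: eq_rsum => y; rewrite -[LHS](kernel_mull (C k, y) _ kc).
by apply: eq_rsum => z; ring.
Qed.

(** The factor 2 arises because on a decoding error the two output laws, each of mass 1, are bounded
    separately. *)
Lemma real_ideal_dist :
  rsum (fun k => rsum (fun w => Rabs (real k w - ideal k w))) <= cov + 2 * err.
Proof.
apply: Rle_trans (_ : rsum (fun k => rsum (fun w =>
  Rabs (rsum (pXY w.1.1) - qX w.1.1) * genc w.1.1 k * b w.1.1 w.1.2 *
     c (C (k.1, dec_l k.1 w.1.2), w.1.2) w.2 +
  / N * (a (C k) w.1.1 * b w.1.1 w.1.2 * ind (dec_l k.1 w.1.2 != k.2)) *
     (c (C (k.1, dec_l k.1 w.1.2), w.1.2) w.2 + c (C k, w.1.2) w.2))) <= _).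
  by apply: rsum_le => k; apply: rsum_le => w; apply: real_ideal.
under eq_rsum => k do rewrite rsum_add.
rewrite rsum_add; apply: Rplus_le_compat.
  apply: Rle_trans qX_cov; right.
  transitivity (rsum (fun k => rsum (fun x => Rabs (rsum (pXY x) - qX x) * genc x k))).
    apply: eq_rsum => k; rewrite rsum_pairE rsum_pairE; apply: eq_rsum => x /=.
    rewrite -[RHS](kernel_mull x _ kb); apply: eq_rsum => y.
    by rewrite kernel_mull.
  rewrite rsum_exch; apply: eq_rsum => x.
  by rewrite kernel_mull //; apply: genc_kernel.
right; rewrite /err -2!rsum_mull; apply: eq_rsum => k.
rewrite rsum_pairE rsum_pairE /= rsum_exch -2!rsum_mull; apply: eq_rsum => y.
rewrite /testchY -rsum_mulr -2!rsum_mull; apply: eq_rsum => x.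
rewrite rsum_mull rsum_add.
have [_ c1] := kc; rewrite !c1; ring.
Qed.

Definition realm (m : M) (w : X * Y * Z) := rsum (fun l => real (m, l) w).
Definition idealm (m : M) (w : X * Y * Z) := rsum (fun l => ideal (m, l) w).

Lemma realm_dist :
  rsum (fun m => rsum (fun w => Rabs (realm m w - idealm m w))) <= cov + 2 * err.
Proof.
apply: Rle_trans real_ideal_dist; rewrite [X in _ <= X]rsum_pairE.
apply: rsum_le => m; rewrite [X in _ <= X]rsum_exch; apply: rsum_le => w.
by rewrite /realm /idealm -rsum_sub; apply: rsum_abs.
Qed.

Lemma realm_target :
  rsum (fun w => Rabs (rsum (fun m => realm m w) - p w.1.1 w.1.2 w.2)) <= 2 * (cov + 2 * err).
Proof.
have err0 : 0 <= err.
  apply: Rmult_le_pos; first lra.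
  by do 2! apply: rsum_ge0 => ?; apply: Rmult_le_pos; [apply: testchY_ge0 | apply: ind_ge0].
(* Real to ideal costs [cov + 2 * err], ideal to target costs [cov] again. *)
apply: Rle_trans (_ : cov + 2 * err + cov <= _); last lra.
apply: Rle_trans (_ : rsum (fun w => rsum (fun m => Rabs (realm m w - idealm m w)) +
   Rabs (/ N * rsum (fun k => testch (C k) w) - outp pA testch w)) <= _); last first.
  by rewrite rsum_add rsum_exch -/cov; have := realm_dist; lra.
apply: rsum_le => w; rewrite pE.
have -> : / N * rsum (fun k => testch (C k) w) = rsum (fun m => idealm m w).
  by rewrite -rsum_mull rsum_pairE.
have -> : rsum (fun m => realm m w) - p w.1.1 w.1.2 w.2 =
  rsum (fun m => realm m w - idealm m w) + (rsum (fun m => idealm m w) - p w.1.1 w.1.2 w.2).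
  by rewrite rsum_sub; ring.
apply: Rle_trans (Rabs_triang _ _) _; apply: Rplus_le_compat_r; exact: rsum_abs.
Qed.

Definition encm (x : X) (m : M) := rsum (fun l => genc x (m, l)).
Definition decm (my : M * Y) (z : Z) := c (C (my.1, dec_l my.1 my.2), my.2) z.

Lemma encm_kernel : is_kernel encm.
Proof.
have [g0 g1] := genc_kernel.
split=> [x m|x]; first by apply: rsum_ge0.
by rewrite -(g1 x) rsum_pairE.
Qed.

Lemma decm_kernel : is_kernel decm.
Proof. by case: kc => c0 c1; split=> *; [apply: c0 | apply: c1]. Qed.

Lemma realmE m x y z : pXY x y * encm x m * decm (m, y) z = realm m (x, y, z).
Proof.
by rewrite /realm /encm -rsum_mull -rsum_mulr.
Qed.

Lemma realm_ge0 m w : 0 <= realm m w.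
Proof.
have [g0 _] := genc_kernel; have [c0 _] := kc.
apply: rsum_ge0 => l; do 2! apply: Rmult_le_pos => //.
rewrite pXYE; apply: rsum_ge0 => z.
rewrite -(pE (w.1.1, w.1.2, z)); apply: outp_ge0 => // u v; exact: testch_ge0.
Qed.

Lemma realm_sum : rsum (fun m => rsum (realm m)) = 1.
Proof.
have -> : 1 = rsum (outp pA testch).
  rewrite /outp rsum_exch -pA1; apply: eq_rsum => u.
  by rewrite rsum_mull testch_sum Rmult_1_r.
rewrite rsum_exch [LHS]rsum_pairE [RHS]rsum_pairE; apply: eq_rsum => -[x y].
have [_ c1] := kc; have [_ g1] := encm_kernel; have [_ d1] := decm_kernel.
transitivity (pXY x y); last by rewrite pXYE; apply: eq_rsum => z; rewrite pE.
rewrite rsum_exch; transitivity (rsum (fun m => pXY x y * encm x m)).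
  apply: eq_rsum => m; rewrite -[RHS](kernel_mull (m, y) _ decm_kernel).
  by apply: eq_rsum => z; rewrite realmE.
by rewrite kernel_mull //; apply: encm_kernel.
Qed.

Hypothesis C0 : forall k, 0 < pA (C k).

(** All codewords share the kernel [e], so it factors out of the sum over the index l that is not
    sent. *)
Lemma idealm_markov m x y z :
  idealm m (x, y, z) = rsum (fun x' => idealm m (x', y, z)) * e (y, z) x.
Proof.
rewrite /idealm rsum_exch -rsum_mulr; apply: eq_rsum => l; rewrite /ideal eE //.
by rewrite rsum_mull; ring.
Qed.

(** [condMI_close] with s = 1 and t = 1/2, whose logarithms become [log2 4] and [log2 (2 * #|X|)].
    The ideal law factors exactly through [e], so the distance of the real law from its own
    factorization is at most twice the distance of the two laws. For blocks the constant 2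
    disappears after division by n. *)
Lemma realm_leak :
  condMI (fun m x (yz : Y * Z) => realm m (x, yz.1, yz.2)) <=
  2 + 4 * (cov + 2 * err) * (1 + log2 (INR #|X|)).
Proof.
have X1 : 1 <= INR #|X| by apply: (le_INR 1); apply/leP.
set j := fun m x (yz : Y * Z) => _.
have toW (F : M -> X * Y * Z -> R) :
   rsum (fun m => rsum (fun x => rsum (fun yz : Y * Z => F m (x, yz.1, yz.2)))) =
   rsum (fun m => rsum (F m)).
  apply: eq_rsum => m; rewrite [RHS]rsum_pairE [RHS]rsum_pairE.
  by apply: eq_rsum => x; rewrite (rsum_pair (fun y z => F m (x, y, z))).
have := @condMI_close M X (Y * Z)%type j _ e (2 * (cov + 2 * err)) 1 (/ 2) ke.
have -> : (1 + 1) / (1 - / 2) = 2 * 2 by field.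
rewrite log2_mul ?log2_2; try lra.
have -> : INR #|X| / / 2 = 2 * INR #|X| by field.
rewrite log2_mul ?log2_2; try lra.
move=> H; apply: Rle_trans (H _ _ _ _ _ X0) _; try lra.
- by move=> *; apply: realm_ge0.
- by rewrite (toW realm) realm_sum; lra.
apply: Rle_trans (_ : rsum (fun m => rsum (fun x => rsum (fun yz : Y * Z =>
   Rabs (realm m (x, yz.1, yz.2) - idealm m (x, yz.1, yz.2)) +
   rsum (fun x' => Rabs (realm m (x', yz.1, yz.2) - idealm m (x', yz.1, yz.2))) * e yz x))) <= _).
  apply: rsum3_le => m x [y z] /=.
  have -> : j m x (y, z) - margAC j m (y, z) * e (y, z) x =
    (realm m (x, y, z) - idealm m (x, y, z)) +
    - (rsum (fun x' => realm m (x', y, z) - idealm m (x', y, z)) * e (y, z) x).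
    rewrite rsum_sub /margAC /j /= (idealm_markov m x); ring.
  apply: Rle_trans (Rabs_triang _ _) _; apply: Rplus_le_compat_l.
  have [e0 _] := ke.
  rewrite Rabs_Ropp Rabs_mult (Rabs_pos_eq (e _ _)) //.
  by apply: Rmult_le_compat_r => //; apply: rsum_abs.
have dist := realm_dist.
set S := rsum _.
suff -> : S = 2 * rsum (fun m => rsum (fun w => Rabs (realm m w - idealm m w))) by lra.
rewrite /S.
under eq_rsum => m.
  under eq_rsum => x do rewrite rsum_add.
  rewrite rsum_add; over.
rewrite rsum_add (toW (fun m w => Rabs (realm m w - idealm m w))).
have -> : rsum (fun m => rsum (fun x => rsum (fun yz : Y * Z =>
   rsum (fun x' => Rabs (realm m (x', yz.1, yz.2) - idealm m (x', yz.1, yz.2))) * e yz x))) =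
  rsum (fun m => rsum (fun w => Rabs (realm m w - idealm m w))).
  rewrite -[RHS](toW (fun m w => Rabs (realm m w - idealm m w))).
  apply: eq_rsum => m; rewrite rsum_exch [RHS]rsum_exch; apply: eq_rsum => yz.
  by rewrite kernel_mull.
have dbl x : x + x = 2 * x by ring.
exact: dbl.
Qed.
End Codebook.

Definition total_err := sqrt (tau / INR #|{: M * L}|) + 2 * covering_tail +
  2 * (decoding_tail + (INR #|L| - 1) / sg).

Lemma one_shot : exists (enc : X -> M -> R) (dec : M * Y -> Z -> R),
  [/\ is_kernel enc, is_kernel dec,
   rsum (fun x => rsum (fun y => rsum (fun z =>
     Rabs (rsum (fun m => pXY x y * enc x m * dec (m, y) z) - p x y z)))) <= 2 * total_err &
   condMI (fun m x (yz : Y * Z) => pXY x yz.1 * enc x m * dec (m, yz.1) yz.2) <=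
   2 + 4 * total_err * (1 + log2 (INR #|X|))].
Proof.
have X1 : 1 <= INR #|X| by apply: (le_INR 1); apply/leP.
have K0 : (0 < #|{: M * L}|)%nat by rewrite card_prod muln_gt0 M0.
have o1 : rsum (outp pA testch) = 1.
  rewrite /outp rsum_exch -pA1; apply: eq_rsum => u.
  by rewrite rsum_mull testch_sum Rmult_1_r.
have cv := soft_covering pA0 pA1 testch_ge0 K0 t0 o1.
have dc := decoding l0 pA0 pA1 testchY_ge0 testchY_sum M0 s0.
(* Closeness and leakage are both controlled by this one combination, so a single codebook serves
   for both. *)
have [C Cp Ce] : exists2 C, 0 < pm pA C & cov C + 2 * err C <= total_err.
  apply: rsum_exists_le; [exact: pm_ge0 | exact: pm_sum1 | ].
  rewrite (eq_rsum (g := fun C => pm pA C * cov C + 2 * (pm pA C * err C))); last by move=> C; ring.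
  rewrite rsum_add rsum_mull /total_err.
  by apply: Rplus_le_compat; [exact: cv | apply: Rmult_le_compat_l; [lra | exact: dc]].
exists (encm C), (decm C); split.
- exact: encm_kernel.
- exact: decm_kernel.
- apply: Rle_trans (_ : 2 * (cov C + 2 * err C) <= _); last lra.
  apply: Rle_trans (realm_target C); right; rewrite -rsum3; apply: eq_rsum => -[[x y] z] /=.
  by congr (Rabs (_ - _)); apply: eq_rsum => m; rewrite realmE.
- have -> : condMI (fun m x (yz : Y * Z) => pXY x yz.1 * encm C x m * decm C (m, yz.1) yz.2)
    = condMI (fun m x (yz : Y * Z) => realm C m (x, yz.1, yz.2)).
    congr condMI; do 3! apply: functional_extensionality => ?; exact: realmE.
  apply: Rle_trans (realm_leak (pm_gt0 pA0 Cp)) _; apply: Rplus_le_compat_l.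
  have lX := log2_ge0 X1; apply: Rmult_le_compat_r; lra.
Qed.
End OneShot.

(** * Block codes from an admissible auxiliary variable *)

Lemma rprod_gt0 (I : finType) (f : I -> R) : (forall i, 0 < f i) -> 0 < \big[Rmult/R1]_i f i.
Proof. by move=> h; elim/big_rec: _ => [|i x _ l]; [lra | apply: Rmult_lt_0_compat]. Qed.

Lemma log2_prod (I : finType) (f : I -> R) : (forall i, 0 < f i) ->
  log2 (\big[Rmult/R1]_i f i) = rsum (fun i => log2 (f i)).
Proof.
move=> h.
suff : 0 < \big[Rmult/R1]_i f i /\ log2 (\big[Rmult/R1]_i f i) = rsum (fun i => log2 (f i)) by case.
rewrite /rsum; elim/big_rec2: _ => [|i x y _ [y0 <-]]; first by split; [lra | apply: log2_1].
by split; [apply: Rmult_lt_0_compat | rewrite log2_mul].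
Qed.

Definition zipf (I A B : finType) (u : {ffun I -> A}) (v : {ffun I -> B}) :
  {ffun I -> A * B} := [ffun i => (u i, v i)].

Lemma rsum_zipf (I A B : finType) (F : {ffun I -> A * B} -> R) :
  rsum F = rsum (fun u => rsum (fun v => F (zipf u v))).
Proof.
rewrite -(rsum_pair (fun u v => F (zipf u v))).
apply: (rsum_reindex (h := fun uv => zipf uv.1 uv.2)).
exists (fun w : {ffun I -> A * B} => ([ffun i => (w i).1], [ffun i => (w i).2])).
  by move=> [u v]; congr pair; apply/ffunP => i; rewrite !ffunE.
by move=> w; apply/ffunP => i; rewrite !ffunE /=; case: (w i).
Qed.

Lemma prod_kernel (S I A B : finType) (k : A -> B -> R) (g : S -> I -> A) :
  is_kernel k -> is_kernel (fun s (z : {ffun I -> B}) => \big[Rmult/R1]_i k (g s i) (z i)).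
Proof.
move=> [k0 k1]; split=> [s z|s].
  by elim/big_rec: _ => [|i x _ h]; [lra | apply: Rmult_le_pos].
by rewrite (rsum_ffun (fun i => k (g s i))) big1 // => i _; apply: k1.
Qed.

Section Single.
Variables (X Y Z : finType) (pXY : X -> Y -> R) (pZ : X -> Y -> Z -> R).
Variables (U : finType) (q : (X * Y * Z) -> U -> R).
Hypothesis HXY : is_pmf2 pXY.
Hypothesis HZ : is_kernel (fun xy : X * Y => pZ xy.1 xy.2).
Hypothesis Hq : admissible pXY pZ q.

Let J := jointU pXY pZ q.
Let pXY0 x y : 0 <= pXY x y. Proof. by case: HXY. Qed.
Let pZ0 x y z : 0 <= pZ x y z. Proof. by case: HZ => h _; apply: (h (x, y)). Qed.
Let pZ1 x y : rsum (pZ x y) = 1. Proof. by case: HZ => _ h; apply: (h (x, y)). Qed.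
Let q0 w u : 0 <= q w u. Proof. by case: Hq => -[]. Qed.
Let q1 w : rsum (q w) = 1. Proof. by case: Hq => -[]. Qed.

Lemma J_ge0 u x y z : 0 <= J u x y z.
Proof. by do 2! apply: Rmult_le_pos => //. Qed.

Lemma sumU_J x y z : rsum (fun u => J u x y z) = pXY x y * pZ x y z.
Proof. by rewrite /J /jointU rsum_mull q1 Rmult_1_r. Qed.

Lemma sumUZ_J x y : rsum (fun u => rsum (fun z => J u x y z)) = pXY x y.
Proof.
rewrite rsum_exch (eq_rsum (fun z => sumU_J x y z)) rsum_mull pZ1; ring.
Qed.

(* The names below record the retained variables: sUYZ is the marginal of J on (U,Y,Z),
   and so on. *)
Definition sU u := rsum (fun x => rsum (fun y => rsum (fun z => J u x y z))).
Definition sUX u x := rsum (fun y => rsum (fun z => J u x y z)).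
Definition sUYZ u y z := rsum (fun x => J u x y z).
Definition sUY u y := rsum (fun z => sUYZ u y z).
Definition sYZ y z := rsum (fun x => pXY x y * pZ x y z).
Definition sY y := rsum (fun x => pXY x y).
Definition ka1 := disint sUX.
Definition kb1 := disint pXY.
Definition kc1 := disint (fun uy : U * Y => sUYZ uy.1 uy.2).
Definition ke1 := disint (fun (yz : Y * Z) x => pXY x yz.1 * pZ x yz.1 yz.2).
Definition V1 u x y z := ka1 u x * kb1 x y * kc1 (u, y) z.

Lemma sUX_ge0 u x : 0 <= sUX u x.
Proof. by do 2! apply: rsum_ge0 => ?; apply: J_ge0. Qed.
Lemma sU_ge0 u : 0 <= sU u.
Proof. by apply: rsum_ge0 => x; apply: sUX_ge0. Qed.
Lemma sUYZ_ge0 u y z : 0 <= sUYZ u y z.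
Proof. by apply: rsum_ge0 => ?; apply: J_ge0. Qed.
Lemma sUY_ge0 u y : 0 <= sUY u y.
Proof. by apply: rsum_ge0 => ?; apply: sUYZ_ge0. Qed.

Lemma J_le_sUYZ u x y z : J u x y z <= sUYZ u y z.
Proof. by apply: (rsum_term x (f := fun x => J u x y z)) => ?; apply: J_ge0. Qed.
Lemma sUYZ_le_sUY u y z : sUYZ u y z <= sUY u y.
Proof. by apply: (rsum_term z (f := fun z => sUYZ u y z)) => ?; apply: sUYZ_ge0. Qed.
Lemma sUYE u y : sUY u y = rsum (fun x => rsum (fun z => J u x y z)).
Proof. by rewrite /sUY /sUYZ rsum_exch. Qed.
Lemma pXY_le_sX x y : pXY x y <= rsum (pXY x).
Proof. by apply: (rsum_term y). Qed.

Lemma sU_sum : rsum sU = 1.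
Proof.
rewrite /sU rsum_exch; case: HXY => _ <-; apply: eq_rsum => x.
by rewrite rsum_exch; apply: eq_rsum => y; rewrite sumUZ_J.
Qed.

Lemma sUXY_b u x y : rsum (fun z => J u x y z) = sUX u x * kb1 x y.
Proof.
case: Hq => _ [+ _] => /(_ u x y); rewrite /markov /margB /margAB /margBC -/J.
have -> : rsum (fun u => rsum (fun y => rsum (fun z => J u x y z))) = rsum (pXY x).
  by rewrite rsum_exch; apply: eq_rsum => y'; rewrite sumUZ_J.
rewrite -/(sUX u x) sumUZ_J (disintE x y pXY0) -/kb1.
case: (Req_dec (rsum (pXY x)) 0) => [z0 _|nz h]; last first.
  by apply: (Rmult_eq_reg_r _ _ _ _ nz); rewrite h /kb1; ring.
have z1 y' : pXY x y' = 0 by apply: (rsum_eq0 (f := pXY x)).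
have z2 y' z : J u x y' z = 0 by rewrite /J /jointU z1 !Rmult_0_l.
rewrite /sUX !rsum_eq0f ?Rmult_0_l // => y'; exact: rsum_eq0f.
Qed.

(** The first two Markov chains in product form. Where a conditioning event has mass zero both sides
    vanish, so the filler values of [disint] are harmless. *)
Lemma JE u x y z : J u x y z = sU u * V1 u x y z.
Proof.
have e1 : sU u * ka1 u x = sUX u x.
  by rewrite /ka1 (disintE (j := sUX)) //; apply: sUX_ge0.
have -> : sU u * V1 u x y z = rsum (fun z => J u x y z) * kc1 (u, y) z.
  by rewrite sUXY_b -e1 /V1; ring.
case: Hq => _ [_ [+ _]] => /(_ z (u, y) x); rewrite /markov /margB /margAB /margBC /= -/J.
have -> : rsum (fun z => rsum (fun x => J u x y z)) = sUY u y by [].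
rewrite -/(sUYZ u y z).
have := disintE (j := fun uy : U * Y => sUYZ uy.1 uy.2) (u, y) z.
rewrite /= -/kc1 => -> //; last by move=> *; apply: sUYZ_ge0.
rewrite -/(sUY u y).
case: (Req_dec (sUY u y) 0) => [z0 _|nz h]; last first.
  by apply: (Rmult_eq_reg_r _ _ _ _ nz); rewrite h; ring.
have jz x' z' : J u x' y z' = 0.
  have := J_le_sUYZ u x' y z'; have := sUYZ_le_sUY u y z'; have := J_ge0 u x' y z'; lra.
by rewrite jz rsum_eq0f ?Rmult_0_l.
Qed.

Lemma J_e u x y z : J u x y z = sUYZ u y z * ke1 (y, z) x.
Proof.
case: Hq => _ [_ [_ +]] => /(_ u (y, z) x); rewrite /markov /margB /margAB /margBC /= -/J.
rewrite sumU_J -/(sUYZ u y z).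
have -> : rsum (fun u => rsum (fun x => J u x y z)) = sYZ y z.
  by rewrite rsum_exch; apply: eq_rsum => x'; rewrite sumU_J.
have := disintE (j := fun (yz : Y * Z) x => pXY x yz.1 * pZ x yz.1 yz.2) (y, z) x.
rewrite /= -/ke1 => -> //; last by move=> *; apply: Rmult_le_pos.
rewrite -/(sYZ y z).
case: (Req_dec (sYZ y z) 0) => [z0 _|nz h]; last first.
  by apply: (Rmult_eq_reg_r _ _ _ _ nz); rewrite h; ring.
have jz x' : J u x' y z = 0.
  have w0 : pXY x' y * pZ x' y z = 0.
    by apply: (rsum_eq0 (f := fun x => pXY x y * pZ x y z)) => // ?; apply: Rmult_le_pos.
  by rewrite /J /jointU w0 Rmult_0_l.
by rewrite /sUYZ jz rsum_eq0f ?Rmult_0_l.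
Qed.

Lemma V1_e u x y z : 0 < sU u -> V1 u x y z = rsum (fun x' => V1 u x' y z) * ke1 (y, z) x.
Proof.
move=> h; apply: (Rmult_eq_reg_l (sU u)); last lra.
rewrite -JE J_e -Rmult_assoc -rsum_mull; congr (_ * _).
by apply: eq_rsum => x'; rewrite JE.
Qed.

(** Information density of U and (X,Y,Z); [dens2] is that of U and Y. Their means [info1] and
    [info2] are I(U;XYZ) and I(U;Y). *)
Definition dens1 u x y z := log2 (V1 u x y z / (pXY x y * pZ x y z)).
Definition VY1 u y := rsum (fun x => ka1 u x * kb1 x y).
Definition dens2 u y := log2 (VY1 u y / sY y).
Definition info1 := rsum (fun t : U * X * Y * Z =>
  J t.1.1.1 t.1.1.2 t.1.2 t.2 * dens1 t.1.1.1 t.1.1.2 t.1.2 t.2).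
Definition info2 := rsum (fun t : U * Y => sUY t.1 t.2 * dens2 t.1 t.2).

Lemma sUY_VY u y : sUY u y = sU u * VY1 u y.
Proof.
rewrite sUYE /VY1 -rsum_mull; apply: eq_rsum => x.
rewrite sUXY_b; have := disintE (j := sUX) u x; rewrite -/ka1 => -> //; last exact: sUX_ge0.
by rewrite -/(sU u); ring.
Qed.

Lemma sum_sUY y : rsum (fun u => sUY u y) = sY y.
Proof.
under eq_rsum => u do rewrite sUYE.
by rewrite rsum_exch; apply: eq_rsum => x; rewrite sumUZ_J.
Qed.

Hypothesis X0 : (0 < #|X|)%nat.
Hypothesis Y0 : (0 < #|Y|)%nat.
Hypothesis Z0 : (0 < #|Z|)%nat.

Lemma ka1_kernel : is_kernel ka1.
Proof. by apply: disint_kernel => //; apply: sUX_ge0. Qed.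
Lemma kb1_kernel : is_kernel kb1.
Proof. by apply: disint_kernel. Qed.
Lemma kc1_kernel : is_kernel kc1.
Proof. by apply: disint_kernel => // *; apply: sUYZ_ge0. Qed.
Lemma ke1_kernel : is_kernel ke1.
Proof. by apply: disint_kernel => // *; apply: Rmult_le_pos. Qed.

Lemma V1_ge0 u x y z : 0 <= V1 u x y z.
Proof. by case: ka1_kernel kb1_kernel kc1_kernel => ? _ [? _] [? _]; do 2! apply: Rmult_le_pos => //. Qed.
Lemma VY1_ge0 u y : 0 <= VY1 u y.
Proof. by case: ka1_kernel kb1_kernel => ? _ [? _]; apply: rsum_ge0 => x; apply: Rmult_le_pos => //. Qed.

Lemma pos_of_mul x y : 0 <= x -> 0 <= y -> 0 < x * y -> 0 < x /\ 0 < y.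
Proof.
move=> x0 y0 h; split; apply: Rnot_le_lt => l.
  have : x = 0 by lra. by move=> e; move: h; rewrite e Rmult_0_l; lra.
have : y = 0 by lra. by move=> e; move: h; rewrite e Rmult_0_r; lra.
Qed.

Lemma J_pos u x y z : 0 < J u x y z ->
  [/\ 0 < sU u, 0 < V1 u x y z & 0 < pXY x y * pZ x y z].
Proof.
move=> h; have := h; rewrite JE => /pos_of_mul[||? ?]; [exact: sU_ge0 | exact: V1_ge0 | split=> //].
by rewrite -sumU_J; apply: Rlt_le_trans h _; apply: (rsum_term u (f := fun u => J u x y z)) => ?; apply: J_ge0.
Qed.

Lemma sUY_pos u y : 0 < sUY u y -> [/\ 0 < sU u, 0 < VY1 u y & 0 < sY y].
Proof.
move=> h; have := h; rewrite sUY_VY => /pos_of_mul[||? ?]; [exact: sU_ge0 | exact: VY1_ge0 | split=> //].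
by rewrite -sum_sUY; apply: Rlt_le_trans h _; apply: (rsum_term u (f := fun u => sUY u y)) => ?; apply: sUY_ge0.
Qed.

(** By U - (Y,Z) - X the factor [ke1] cancels inside [dens1], so I(U;XYZ) = I(U;YZ); removing I(U;Y)
    leaves I(Z;U|Y). *)
Lemma objU_info : objU pXY pZ q = info1 - info2.
Proof.
rewrite /objU condMIE; last by move=> *; apply: sUYZ_ge0.
rewrite -/J.
set F := fun z u y => log2 (sUYZ u y z * sY y / (sYZ y z * sUY u y)).
transitivity (rsum (fun z => rsum (fun u => rsum (fun y => sUYZ u y z * F z u y)))).
  apply: eq_rsum3 => z u y; congr (_ * log2 (_ * _ / (_ * _))).
    by rewrite /margC /= rsum_exch -sum_sUY.
  by rewrite /margAC rsum_exch; apply: eq_rsum => x; rewrite sumU_J.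
transitivity (rsum (fun u => rsum (fun x => rsum (fun y => rsum (fun z => J u x y z * F z u y))))).
  rewrite rsum_exch; apply: eq_rsum => u; rewrite rsum_exch [RHS]rsum_exch; apply: eq_rsum => y.
  by rewrite [RHS]rsum_exch; apply: eq_rsum => z; rewrite /sUYZ -rsum_mulr.
transitivity (rsum (fun u => rsum (fun x => rsum (fun y => rsum (fun z =>
   J u x y z * dens1 u x y z - J u x y z * dens2 u y))))).
  apply: eq_rsum => u; apply: eq_rsum => x; apply: eq_rsum => y; apply: eq_rsum => z.
  case: (Rle_lt_or_eq_dec _ _ (J_ge0 u x y z)) => [h|<-]; last by ring.
  have [u0 v0 w0] := J_pos h.
  have yz0 : 0 < sUYZ u y z by apply: Rlt_le_trans h (J_le_sUYZ _ _ _ _).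
  have uy0 : 0 < sUY u y by apply: Rlt_le_trans yz0 (sUYZ_le_sUY _ _ _).
  have [_ vy0 y0] := sUY_pos uy0.
  have pyz : 0 < sYZ y z.
    apply: Rlt_le_trans w0 _.
    by apply: (rsum_term x (f := fun x => pXY x y * pZ x y z)) => ?; apply: Rmult_le_pos.
  have e0 : 0 < ke1 (y, z) x.
    have := h; rewrite J_e => /pos_of_mul[||//]; [exact: sUYZ_ge0 | by case: ke1_kernel].
  have wE : pXY x y * pZ x y z = sYZ y z * ke1 (y, z) x.
    have := disintE (j := fun (yz : Y * Z) x => pXY x yz.1 * pZ x yz.1 yz.2) (y, z) x.
    by rewrite /= -/ke1 => -> // *; apply: Rmult_le_pos.
  have vE : V1 u x y z = sUYZ u y z * ke1 (y, z) x / sU u.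
    by rewrite -J_e JE; field; lra.
  have vyE : VY1 u y = sUY u y / sU u by rewrite sUY_VY; field; lra.
  rewrite /F /dens1 /dens2 vE vyE wE !log2_div ?log2_mul; try lra;
    by repeat (apply: Rmult_lt_0_compat || apply: Rdiv_lt_0_compat).
rewrite /info1 /info2.
rewrite [X in _ = _ - X](rsum_pair (fun u y => sUY u y * dens2 u y)).
rewrite [X in _ = X - _]rsum_pairE [X in _ = X - _]rsum_pairE [X in _ = X - _]rsum_pairE /=.
rewrite -rsum_sub; apply: eq_rsum => u.
rewrite [X in _ = _ - X](eq_rsum (g := fun y => rsum (fun x => rsum (fun z => J u x y z * dens2 u y)))); last first.
  by move=> y; rewrite sUYE -rsum_mulr; apply: eq_rsum => x; rewrite rsum_mulr.
rewrite [X in _ = _ - X]rsum_exch -rsum_sub; apply: eq_rsum => x.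
rewrite -rsum_sub; apply: eq_rsum => y.
by rewrite -rsum_sub.
Qed.

Section Block.
Variable n : nat.
Notation bl T := {ffun 'I_n -> T}.

Definition an (u : bl U) (x : bl X) := \big[Rmult/R1]_i ka1 (u i) (x i).
Definition bn (x : bl X) (y : bl Y) := \big[Rmult/R1]_i kb1 (x i) (y i).
Definition cn (uy : bl U * bl Y) (z : bl Z) := \big[Rmult/R1]_i kc1 (uy.1 i, uy.2 i) (z i).
Definition en (yz : bl Y * bl Z) (x : bl X) := \big[Rmult/R1]_i ke1 (yz.1 i, yz.2 i) (x i).

Lemma testch_prod u w : testch an bn cn u w =
  \big[Rmult/R1]_i V1 (u i) (w.1.1 i) (w.1.2 i) (w.2 i).
Proof. by rewrite /testch /an /bn /cn -!big_split. Qed.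

Lemma pm_testch u w : pm sU u * testch an bn cn u w =
  \big[Rmult/R1]_i J (u i) (w.1.1 i) (w.1.2 i) (w.2 i).
Proof.
rewrite testch_prod /pm -big_split; apply: eq_bigr => i _ /=; by rewrite JE.
Qed.

Lemma outp_testch w : outp (pm sU) (testch an bn cn) w = pXYZn pXY pZ w.1.1 w.1.2 w.2.
Proof.
rewrite /outp (eq_rsum (fun u => pm_testch u w)).
rewrite (rsum_ffun (fun i u => J u (w.1.1 i) (w.1.2 i) (w.2 i))).
by apply: eq_bigr => i _; rewrite sumU_J.
Qed.

Lemma pXYn_b (x : bl X) (y : bl Y) : pXYn pXY x y = rsum (pXYn pXY x) * bn x y.
Proof.
have -> : rsum (pXYn pXY x) = \big[Rmult/R1]_i rsum (pXY (x i)).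
  exact: (rsum_ffun (fun i y => pXY (x i) y)).
by rewrite /bn -big_split; apply: eq_bigr => i _; apply: disintE.
Qed.

Lemma pXYn_sum (x : bl X) (y : bl Y) : pXYn pXY x y = rsum (pXYZn pXY pZ x y).
Proof.
rewrite /pXYZn /rprod (rsum_ffun (fun i z => pXY (x i) (y i) * pZ (x i) (y i) z)).
by apply: eq_bigr => i _; rewrite rsum_mull pZ1 Rmult_1_r.
Qed.

Lemma testch_e u x y z : 0 < pm sU u ->
  testch an bn cn u (x, y, z) = rsum (fun x' => testch an bn cn u (x', y, z)) * en (y, z) x.
Proof.
move=> /(pm_gt0 sU_ge0) u0.
rewrite testch_prod /= (eq_rsum (fun x' => testch_prod u (x', y, z))) /=.
rewrite (rsum_ffun (fun i x' => V1 (u i) x' (y i) (z i))) /en -big_split.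
by apply: eq_bigr => i _; apply: V1_e.
Qed.

Lemma testchY_prod u y : testchY an bn u y = \big[Rmult/R1]_i VY1 (u i) (y i).
Proof.
rewrite /testchY /an /bn.
rewrite (eq_rsum (g := fun x : bl X => \big[Rmult/R1]_i (ka1 (u i) (x i) * kb1 (x i) (y i)))).
  by rewrite (rsum_ffun (fun i x => ka1 (u i) x * kb1 x (y i))).
by move=> x; rewrite big_split.
Qed.

Lemma outp_testchY y : outp (pm sU) (testchY an bn) y = \big[Rmult/R1]_i sY (y i).
Proof.
rewrite /outp (eq_rsum (g := fun u : bl U => \big[Rmult/R1]_i sUY (u i) (y i))).
  rewrite (rsum_ffun (fun i u => sUY u (y i))).
  by apply: eq_bigr => i _; rewrite sum_sUY.
by move=> u; rewrite testchY_prod /pm -big_split; apply: eq_bigr => i _; rewrite sUY_VY.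
Qed.

Variable d : R.
Hypothesis d0 : 0 < d.
Hypothesis n0 : (0 < n)%nat.

Definition var1 := rsum (fun t : U * X * Y * Z =>
  J t.1.1.1 t.1.1.2 t.1.2 t.2 *
  ((dens1 t.1.1.1 t.1.1.2 t.1.2 t.2 - info1) * (dens1 t.1.1.1 t.1.1.2 t.1.2 t.2 - info1))).
Definition var2 := rsum (fun t : U * Y => sUY t.1 t.2 *
  ((dens2 t.1 t.2 - info2) * (dens2 t.1 t.2 - info2))).

(** After taking logarithms, exceeding the threshold means that the empirical mean of [dens1]
    exceeds [info1] by at least d, an event bounded by Chebyshev's inequality. *)
Lemma covering_tail_le :
  covering_tail (pm sU) an bn cn (Rpower 2 (INR n * (info1 + d))) <= var1 / (INR n * d * d).
Proof.
pose p4 (t : U * X * Y * Z) := J t.1.1.1 t.1.1.2 t.1.2 t.2.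
pose f4 (t : U * X * Y * Z) := dens1 t.1.1.1 t.1.1.2 t.1.2 t.2.
pose tau := Rpower 2 (INR n * (info1 + d)).
pose ev (w : {ffun 'I_n -> U * X * Y * Z}) :=
  Rltb (tau * \big[Rmult/R1]_i (pXY (w i).1.1.2 (w i).1.2 * pZ (w i).1.1.2 (w i).1.2 (w i).2))
       (\big[Rmult/R1]_i V1 (w i).1.1.1 (w i).1.1.2 (w i).1.2 (w i).2).
have p41 : rsum p4 = 1.
  rewrite rsum_pairE rsum_pairE rsum_pairE -sU_sum; apply: eq_rsum => u.
  by [].
have := @pm_chebyshev n _ p4 f4 info1 d ev (fun t => J_ge0 _ _ _ _) p41 erefl d0 n0.
move=> H; apply: Rle_trans (H _) => {H}; last first.
  move=> w wp /RltbP lt.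
  have V0 i := let: And3 _ h _ := J_pos (wp i) in h.
  have W0 i := let: And3 _ _ h := J_pos (wp i) in h.
  have := log2_le _ (Rlt_le _ _ lt).
  rewrite log2_mul; [|exact: Rpower2_gt0 | exact: rprod_gt0].
  rewrite /tau log2_Rpower !log2_prod // => /(_ (Rmult_lt_0_compat _ _ (Rpower2_gt0 _) (rprod_gt0 W0))) le.
  apply: Rle_trans (Rle_abs _).
  rewrite /f4 /dens1 (eq_rsum (fun i => log2_div (V0 i) (W0 i))) rsum_sub.
  have aux k v w' : k * (info1 + d) + w' <= v -> k * d <= v - w' - k * info1 by lra.
  exact: aux.
right; rewrite rsum_zipf rsum_zipf rsum_zipf /covering_tail.
apply: eq_rsum => u; rewrite rsum_pairE rsum_pairE.
apply: eq_rsum => x; apply: eq_rsum => y; apply: eq_rsum => z.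
rewrite pm_testch outp_testch testch_prod /ev /pm /p4 /pXYZn /rprod /=.
congr (_ * ind (Rltb (_ * _) _)); apply: eq_bigr => i _; by rewrite !ffunE.
Qed.

(** The same argument in the other direction: the empirical mean of [dens2] falls at least d below
    [info2]. *)
Lemma decoding_tail_le :
  decoding_tail (pm sU) an bn (Rpower 2 (INR n * (info2 - d))) <= var2 / (INR n * d * d).
Proof.
pose p2 (t : U * Y) := sUY t.1 t.2.
pose f2 (t : U * Y) := dens2 t.1 t.2.
pose sg := Rpower 2 (INR n * (info2 - d)).
pose ev (w : {ffun 'I_n -> U * Y}) :=
  Rltb (\big[Rmult/R1]_i VY1 (w i).1 (w i).2) (sg * \big[Rmult/R1]_i sY (w i).2).
have p21 : rsum p2 = 1.
  rewrite rsum_pairE -sU_sum; apply: eq_rsum => u.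
  by rewrite /sU [RHS]rsum_exch; apply: eq_rsum => y; rewrite /p2 /= sUYE.
have := @pm_chebyshev n _ p2 f2 info2 d ev (fun t => sUY_ge0 _ _) p21 erefl d0 n0.
move=> H; apply: Rle_trans (H _) => {H}; last first.
  move=> w wp /RltbP lt.
  have V0 i := let: And3 _ h _ := sUY_pos (wp i) in h.
  have W0 i := let: And3 _ _ h := sUY_pos (wp i) in h.
  have := log2_le (rprod_gt0 V0) (Rlt_le _ _ lt).
  rewrite log2_mul; [|exact: Rpower2_gt0 | exact: rprod_gt0].
  rewrite /sg log2_Rpower !log2_prod // => le.
  rewrite Rabs_minus_sym; apply: Rle_trans (Rle_abs _).
  rewrite /f2 /dens2 (eq_rsum (fun i => log2_div (V0 i) (W0 i))) rsum_sub.
  have aux k v w' : v <= k * (info2 - d) + w' -> k * d <= k * info2 - (v - w') by lra.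
  exact: aux.
right; rewrite rsum_zipf /decoding_tail.
apply: eq_rsum => u; apply: eq_rsum => y.
rewrite /fails outp_testchY !testchY_prod /ev /pm -big_split /=.
congr (_ * ind (Rltb _ (_ * _))); apply: eq_bigr => i _; rewrite !ffunE //=.
by rewrite -sUY_VY.
Qed.
End Block.
End Single.

Lemma nat_floor x : 0 <= x -> exists k : nat, INR k <= x < INR k + 1.
Proof.
move=> x0; have [u1 u2] := archimed x.
have up0 : (0 < up x)%Z by apply: lt_IZR; lra.
have [k kE] := IZN (up x - 1) ltac:(lia).
by exists k; rewrite INR_IZR_INZ -kE minus_IZR; lra.
Qed.

Lemma log2_card_ffun (n : nat) (T : finType) : (0 < #|T|)%nat ->
  log2 (INR #|{ffun 'I_n -> T}|) = INR n * log2 (INR #|T|).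
Proof.
move=> T0; rewrite card_ffun card_ord.
have t0 : 0 < INR #|T| by apply: lt_0_INR; apply/ltP.
suff : 0 < INR (expn #|T| n) /\ log2 (INR (expn #|T| n)) = INR n * log2 (INR #|T|) by case.
elim: n => [|n [IH1 IH2]]; first by rewrite expn0 /= log2_1; split; [lra|ring].
rewrite expnS mult_INR; split; first exact: Rmult_lt_0_compat.
by rewrite log2_mul // IH2 S_INR; ring.
Qed.

(** A decay of order 1/x is enough, since the Chebyshev bounds decay no faster. *)
Lemma Rpower2_neg_le x : 0 < x -> Rpower 2 (- x) <= / (x * ln 2).
Proof.
move=> x0; have l := ln2_gt0.
rewrite Rpower_Ropp; apply: Rinv_le_contravar; first exact: Rmult_lt_0_compat.
have p0 : 0 < x * ln 2 by apply: Rmult_lt_0_compat.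
by rewrite /Rpower; have := @exp_ineq1 (x * ln 2) ltac:(lra); lra.
Qed.

Lemma div_n_le K t (n : nat) : 0 < t -> K / t <= INR n -> 0 < INR n -> K / INR n <= t.
Proof.
move=> t0 h n0; apply: Rle_div_l => //.
have := Rmult_le_compat_l _ _ _ (Rlt_le _ _ t0) h.
by rewrite (_ : t * (K / t) = K) //; field; lra.
Qed.

Lemma exists_nat_ge x : exists N : nat, x <= INR N.
Proof.
have [k [k1 k2]] := nat_floor (Rle_trans _ _ _ (Rabs_pos x) (Rle_refl _)).
by exists k.+1; rewrite S_INR; have := Rle_abs x; lra.
Qed.

Lemma rsum1_card (T : finType) (f : T -> R) : rsum f = 1 -> (0 < #|T|)%nat.
Proof.
move=> f1; rewrite lt0n; apply/eqP => c0.
have : rsum f = 0.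
  by rewrite /rsum big1 // => t _; have := fintype0 t c0.
lra.
Qed.

(** * Every rate above the objective is achievable *)

Section Achievability.
Variables (X Y Z : finType) (pXY : X -> Y -> R) (pZ : X -> Y -> Z -> R).
Variables (U : finType) (q : (X * Y * Z) -> U -> R).
Hypothesis HXY : is_pmf2 pXY.
Hypothesis HZ : is_kernel (fun xy : X * Y => pZ xy.1 xy.2).
Hypothesis Hq : admissible pXY pZ q.

Lemma cardX_gt0 : (0 < #|X|)%nat.
Proof. by case: HXY => _; apply: rsum1_card. Qed.
Lemma cardY_gt0 : (0 < #|Y|)%nat.
Proof. by case: HXY => _; rewrite rsum_exch; apply: rsum1_card. Qed.
Lemma cardZ_gt0 : (0 < #|Z|)%nat.
Proof.
have /card_gt0P [x _] := cardX_gt0; have /card_gt0P [y _] := cardY_gt0.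
by case: HZ => _ /(_ (x, y)); apply: rsum1_card.
Qed.
Let X0 := cardX_gt0.
Let Y0 := cardY_gt0.
Let Z0 := cardZ_gt0.

Let pA n := @pm 'I_n U (sU pXY pZ q).
Let terr n M L tau sg := @total_err {ffun 'I_n -> U} {ffun 'I_n -> X} {ffun 'I_n -> Y}
  {ffun 'I_n -> Z} 'I_M 'I_L (@pA n) (@an _ _ _ pXY pZ _ q n)
  (@bn _ _ pXY n) (@cn _ _ _ pXY pZ _ q n) tau sg.

Lemma block_code (n M L : nat) tau sg : (0 < M)%nat -> (0 < L)%nat -> 0 < tau -> 0 < sg ->
  exists c : code X Y Z n, [/\ valid_code c, nmsg c = M,
    code_tv pXY pZ c <= terr n M L tau sg &
    code_leak pXY c <= 2 + 4 * terr n M L tau sg * (1 + INR n * log2 (INR #|X|))].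
Proof.
move=> M0 L0 t0 s0.
have ca := ka1_kernel HXY HZ Hq X0.
have cb := kb1_kernel HXY Y0.
have cc := kc1_kernel HXY HZ Hq Z0.
have ce := ke1_kernel HXY HZ X0.
have sU0 := sU_ge0 HXY HZ Hq.
have X0n : (0 < #|{ffun 'I_n -> X}|)%nat by rewrite card_ffun expn_gt0 X0.
have [] := @one_shot {ffun 'I_n -> U} {ffun 'I_n -> X} {ffun 'I_n -> Y} {ffun 'I_n -> Z}
  'I_M 'I_L (@pA n) (@pXYn X Y pXY n) (@an _ _ _ pXY pZ _ q n) (@bn _ _ pXY n)
  (@cn _ _ _ pXY pZ _ q n) (@en _ _ _ pXY pZ n) (@pXYZn _ _ _ pXY pZ n) tau sg.
- exact: pm_ge0.
- by apply: pm_sum1; apply: sU_sum.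
- exact: (prod_kernel (fun (u : {ffun 'I_n -> U}) i => u i) ca).
- exact: (prod_kernel (fun (x : {ffun 'I_n -> X}) i => x i) cb).
- exact: (prod_kernel (fun (uy : {ffun 'I_n -> U} * {ffun 'I_n -> Y}) i => (uy.1 i, uy.2 i)) cc).
- exact: (prod_kernel (fun (yz : {ffun 'I_n -> Y} * {ffun 'I_n -> Z}) i => (yz.1 i, yz.2 i)) ce).
- exact: outp_testch.
- exact: pXYn_b.
- exact: pXYn_sum.
- by move=> *; apply: testch_e.
- exact: t0.
- exact: s0.
- by rewrite card_ord.
- by rewrite card_ord.
- exact: X0n.
- exact: (Ordinal L0).
move=> enc [dec [ke kd tv lk]].
exists (@Code X Y Z n M enc dec); split=> //.
  have half x y : x <= 2 * y -> / 2 * x <= y by lra.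
  exact: half tv.
by move: lk; rewrite log2_card_ffun.
Qed.


Let v := objU pXY pZ q.
Variable R0 : R.
Hypothesis vR : v < R0.
(** The excess rate pays for four gaps of d: [tau] lies above 2^(n I1), the number of words above
    [tau], [sg] below 2^(n I2), and the number of values of l below [sg]. *)
Let d := (R0 - v) / 4.
Let d0 : 0 < d. Proof. rewrite /d; lra. Qed.
Let I1 := info1 pXY pZ q.
Let I2 := info2 pXY pZ q.
Let vE : v = I1 - I2. Proof. exact: objU_info. Qed.
Let v0 : 0 <= v.
Proof.
apply: condMI_ge0 => z u y; apply: rsum_ge0 => x.
exact: (J_ge0 HXY HZ Hq).
Qed.

Let tau n := Rpower 2 (INR n * (I1 + d)).
Let sg n := Rpower 2 (INR n * (I2 - d)).

Lemma sizes n : exists ML : nat * nat, [/\ (0 < ML.1)%nat, (0 < ML.2)%nat,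
  INR ML.1 <= Rpower 2 (INR n * R0),
  tau n / (INR ML.1 * INR ML.2) <= 2 * Rpower 2 (- (INR n * d)) &
  (INR ML.2 - 1) / sg n <= Rpower 2 (- (INR n * d))].
Proof.
have nn := pos_INR n.
have [M [M1 M2]] := nat_floor (Rlt_le _ _ (Rpower2_gt0 (INR n * R0))).
have [L [L1 L2]] := nat_floor (Rlt_le _ _ (Rpower2_gt0 (INR n * (I2 - 2 * d)))).
have R1 : 1 <= Rpower 2 (INR n * R0).
  rewrite -(Rpower_O 2); last lra.
  apply: Rle_Rpower; first lra.
  by apply: Rmult_le_pos; lra.
have Mpos : (0 < M)%nat.
  by rewrite lt0n; apply/eqP => e; move: M2; rewrite e /=; lra.
have M1' : 1 <= INR M by apply: (le_INR 1); apply/leP.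
have L0 := pos_INR L.
(* The successor keeps the number of values of l positive even if [I2 - 2 * d < 0]; the decoding
   bound subtracts 1 again. The factor 2 in the covering bound comes from rounding: a floor [M >= 1]
   is at least half of its argument. *)
exists (M, L.+1); split=> //=.
- rewrite -/(INR L.+1) S_INR; apply: Rle_div_l; first by apply: Rmult_lt_0_compat; lra.
  have h : Rpower 2 (INR n * R0) * Rpower 2 (INR n * (I2 - 2 * d)) <= 2 * (INR M * (INR L + 1)).
    rewrite -Rmult_assoc; apply: Rmult_le_compat; try (apply/Rlt_le/Rpower2_gt0); lra.
  have p0 := Rpower2_gt0 (- (INR n * d)).
  have := Rmult_le_compat_l _ _ _ (Rlt_le _ _ p0) h.
  rewrite -!Rpower_plus /tau.
  have -> : - (INR n * d) + (INR n * R0 + INR n * (I2 - 2 * d)) = INR n * (I1 + d).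
    have -> : I2 = I1 - v by rewrite vE; ring.
    rewrite /d; field.
  lra.
- rewrite -/(INR L.+1) S_INR; apply: Rle_div_l; first exact: Rpower2_gt0.
  rewrite /sg -Rpower_plus (_ : - (INR n * d) + INR n * (I2 - d) = INR n * (I2 - 2 * d)); [lra | ring].
Qed.

Lemma achievability : achievable pXY pZ R0.
Proof.
have szs n := constructive_indefinite_description _ (sizes n).
pose M n := (proj1_sig (szs n)).1; pose L n := (proj1_sig (szs n)).2.
have szP n : [/\ (0 < M n)%nat, (0 < L n)%nat,
  INR (M n) <= Rpower 2 (INR n * R0),
  tau n / (INR (M n) * INR (L n)) <= 2 * Rpower 2 (- (INR n * d)) &
  (INR (L n) - 1) / sg n <= Rpower 2 (- (INR n * d))] := proj2_sig (szs n).
have cds n := constructive_indefinite_description _ (block_code n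
  (let: And5 h _ _ _ _ := szP n in h) (let: And5 _ h _ _ _ := szP n in h)
  (Rpower2_gt0 _ : 0 < tau n) (Rpower2_gt0 _ : 0 < sg n)).
pose te n := terr n (M n) (L n) (tau n) (sg n).
exists (fun n => proj1_sig (cds n)); split.
  move=> n; case: (proj2_sig (cds n)) => vc nm _ _; split=> //.
  by rewrite nm; case: (szP n).
set lam := log2 (INR #|X|).
have lam0 : 0 <= lam by apply: log2_ge0; apply: (le_INR 1); apply/leP.
have te_small eta : 0 < eta -> exists N : nat, forall n : nat, (N <= n)%nat -> te n <= eta.
  move=> e0; have l := ln2_gt0.
  (* [A / INR n] bounds 2^(-n d). [W / INR n] collects the bounds of all terms of [total_err] except
     the square root, which is kept below [eta / 2] through its square. *)
  pose A := / (d * ln 2).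
  have A0 : 0 < A by apply/Rinv_0_lt_compat/Rmult_lt_0_compat.
  pose W := 2 * (var1 pXY pZ q + var2 pXY pZ q) / (d * d) + 2 * A.
  have [N1 h1] := exists_nat_ge (2 * A / ((eta / 2) * (eta / 2))).
  have [N2 h2] := exists_nat_ge (W / (eta / 2)).
  exists (maxn 1 (maxn N1 N2)) => n; rewrite !geq_max => /andP[n1 /andP[nN1 nN2]].
  have np : 0 < INR n by apply: lt_0_INR; apply/ltP.
  have e20 : 0 < eta / 2 by lra.
  have b1 : 2 * A / INR n <= eta / 2 * (eta / 2).
    apply: div_n_le => //; first exact: Rmult_lt_0_compat.
    by apply: Rle_trans h1 _; apply: le_INR; apply/leP.
  have b2 : W / INR n <= eta / 2.
    by apply: div_n_le => //; apply: Rle_trans h2 _; apply: le_INR; apply/leP.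
  have pw : Rpower 2 (- (INR n * d)) <= A / INR n.
    apply: Rle_trans (Rpower2_neg_le _) _; first exact: Rmult_lt_0_compat.
    by right; rewrite /A; field; split; lra.
  have [Mp Lp _ s1 s2] := szP n.
  have nd : 0 < INR n * d * d by exact: (Rmult_lt_0_compat _ _ (Rmult_lt_0_compat _ _ np d0) d0).
  have c1 := covering_tail_le HXY HZ Hq X0 Y0 Z0 d0 n1.
  have c2 := decoding_tail_le HXY HZ Hq X0 Y0 d0 n1.
  have sq : sqrt (tau n / INR #|{: 'I_(M n) * 'I_(L n)}|) <= eta / 2.
    rewrite card_prod !card_ord mult_INR -(sqrt_square (eta / 2)); last lra.
    apply: sqrt_le_1_alt; apply: Rle_trans s1 _; lra.
  rewrite /te /terr /total_err card_ord -/I1 -/I2.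
  have e1 : W / INR n = 2 * (var1 pXY pZ q / (INR n * d * d)) +
     2 * (var2 pXY pZ q / (INR n * d * d)) + 2 * (A / INR n).
    rewrite /W; field; repeat split; lra.
  move: c1 c2; rewrite -/I1 -/I2 -/(tau n) -/(sg n) -/(@pA n) => c1 c2.
  rewrite e1 in b2.
  have aux S C D E a b c w : S <= eta / 2 -> C <= a -> D <= b -> E <= w -> w <= c ->
    2 * a + 2 * b + 2 * c <= eta / 2 -> S + 2 * C + 2 * (D + E) <= eta by lra.
  exact: aux sq c1 c2 s2 pw b2.
move=> eps e0.
(* The leakage bound is 2 + 4 te (1 + n lam). For large n the 2 is at most n eps / 2, and te at most
   eps / (8 (1 + lam)) does the same for the rest. *)
pose eta := Rmin eps (eps / (8 * (1 + lam))).
have e80 : 0 < eps / (8 * (1 + lam)) by apply: Rdiv_lt_0_compat; lra.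
have eta0 : 0 < eta by apply: Rmin_pos.
have [N1 h1] := te_small eta eta0.
have [N2 h2] := exists_nat_ge (4 / eps).
exists (maxn 1 (maxn N1 N2)) => n; rewrite !geq_max => /andP[n1 /andP[nN1 nN2]].
have np : 1 <= INR n by apply: (le_INR 1); apply/leP.
have := h1 n nN1; case: (proj2_sig (cds n)) => _ _ tv lk le.
split.
  by apply: Rle_trans tv _; apply: Rle_trans le (Rmin_l _ _).
apply: Rle_trans lk _; rewrite -/(te n) -/lam.
have b : 2 <= INR n * (eps / 2).
  have : 4 / eps <= INR n by apply: Rle_trans h2 _; apply: le_INR; apply/leP.
  move=> /(Rmult_le_compat_r eps _ _ (Rlt_le _ _ e0)).
  by rewrite /Rdiv Rmult_assoc Rinv_l; lra.
have c : te n * (8 * (1 + lam)) <= eps.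
  apply: (Rle_trans _ (eps / (8 * (1 + lam)) * (8 * (1 + lam)))).
    by apply: Rmult_le_compat_r; [lra | apply: Rle_trans le (Rmin_r _ _)].
  by right; field; lra.
(* No sign of [te n] is at hand, so the negative case is treated separately. *)
case: (Rle_lt_dec 0 (te n)) => t0.
  have : te n * (1 + INR n * lam) <= te n * (INR n * (1 + lam)).
    by apply: Rmult_le_compat_l => //; lra.
  have := Rmult_le_compat_l (INR n) _ _ (Rle_trans _ _ _ Rle_0_1 np) c.
  lra.
have : te n * (1 + INR n * lam) <= 0.
  rewrite -(Rmult_0_l (1 + INR n * lam)); apply: Rmult_le_compat_r; last lra.
  by have := Rmult_le_pos (INR n) lam ltac:(lra) lam0; lra.
have := Rmult_le_pos (INR n) eps ltac:(lra) ltac:(lra); lra.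
Qed.
End Achievability.

(** * Entropies of random variables *)

Section RV.
Variables (W : finType) (P : W -> R).

Definition pr (A : finType) (f : W -> A) (a : A) : R := rsum (fun w => P w * ind (f w == a)).
Definition entropy (A : finType) (f : W -> A) : R := rsum (fun w => P w * - log2 (pr f (f w))).
(** With random variables as functions on one space, chain rules become linear arithmetic on
    entropies. *)
Definition CMI (A B C : finType) (f : W -> A) (g : W -> B) (h : W -> C) : R :=
  entropy (fun w => (f w, h w)) + entropy (fun w => (g w, h w))
  - entropy (fun w => (f w, g w, h w)) - entropy h.

Lemma pr_transfer (A : finType) (f : W -> A) (F : A -> R) :
  rsum (fun a => pr f a * F a) = rsum (fun w => P w * F (f w)).
Proof.
transitivity (rsum (fun a => rsum (fun w => P w * F a * ind (f w == a)))).
  by apply: eq_rsum => a; rewrite -rsum_mulr; apply: eq_rsum => w; ring.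
rewrite rsum_exch; apply: eq_rsum => w.
by rewrite (rsum_delta (f w) (fun a => P w * F a)).
Qed.

Lemma entropy_xlg (A : finType) (f : W -> A) : entropy f = - rsum (fun a => xlg (pr f a)).
Proof.
rewrite /entropy -(pr_transfer f (fun a => - log2 (pr f a))) -rsum_opp.
by apply: eq_rsum => a; rewrite /xlg; ring.
Qed.

(** Entropy depends only on the partition of the space induced by the variable. This replaces every
    regrouping of tuples and every insertion of a determined component. *)
Lemma entropy_inj (A B : finType) (f : W -> A) (g : W -> B) :
  (forall w w', f w = f w' <-> g w = g w') -> entropy f = entropy g.
Proof.
move=> fg; apply: eq_rsum => w; congr (_ * - log2 _); apply: eq_rsum => w'.
by congr (_ * ind _); apply/eqP/eqP => /fg.
Qed.

Lemma pr_fst (A B : finType) (f : W -> A) (g : W -> B) a :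
  rsum (fun b => pr (fun w => (f w, g w)) (a, b)) = pr f a.
Proof.
rewrite /pr rsum_exch; apply: eq_rsum => w.
transitivity (rsum (fun b => P w * ind (f w == a) * ind (g w == b))).
  by apply: eq_rsum => b; rewrite xpair_eqE ind_and; ring.
exact: (rsum_delta (g w) (fun _ => P w * ind (f w == a))).
Qed.

Lemma eq_pr (A B : finType) (f : W -> A) (g : W -> B) a b :
  (forall w, (f w == a) = (g w == b)) -> pr f a = pr g b.
Proof. by move=> e; apply: eq_rsum => w; rewrite e. Qed.

Hypothesis P0 : forall w, 0 <= P w.

Lemma pr_ge0 (A : finType) (f : W -> A) a : 0 <= pr f a.
Proof. by apply: rsum_ge0 => w; apply: Rmult_le_pos => //; apply: ind_ge0. Qed.

Lemma pr_gt0 (A : finType) (f : W -> A) w : 0 < P w -> 0 < pr f (f w).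
Proof.
move=> h; apply: Rlt_le_trans h _.
have := @rsum_term W w (fun w' => P w' * ind (f w' == f w)).
rewrite eqxx /ind Rmult_1_r; apply => w'.
by apply: Rmult_le_pos => //; apply: ind_ge0.
Qed.

Section Triple.
Variables (A B C : finType) (f : W -> A) (g : W -> B) (h : W -> C).
Definition triple a b c := pr (fun w => (f w, g w, h w)) (a, b, c).

Lemma triple_ge0 a b c : 0 <= triple a b c. Proof. exact: pr_ge0. Qed.

Lemma margAC_triple a c : margAC triple a c = pr (fun w => (f w, h w)) (a, c).
Proof.
rewrite -(pr_fst (fun w => (f w, h w)) g); apply: eq_rsum => b.
by apply: eq_pr => w; rewrite !xpair_eqE -!andbA; congr andb; rewrite andbC.
Qed.
Lemma margBC_triple b c : margBC triple b c = pr (fun w => (g w, h w)) (b, c).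
Proof.
rewrite -(pr_fst (fun w => (g w, h w)) f); apply: eq_rsum => a.
by apply: eq_pr => w; rewrite !xpair_eqE -!andbA; rewrite andbC andbA.
Qed.
Lemma margC_triple c : margC triple c = pr h c.
Proof.
rewrite -(pr_fst h f); apply: eq_rsum => a; rewrite -/(margAC triple a c) margAC_triple.
by apply: eq_pr => w; rewrite !xpair_eqE andbC.
Qed.
Lemma triple_sum : rsum (fun a => rsum (fun b => rsum (fun c => triple a b c))) = rsum P.
Proof.
rewrite -rsum3 (eq_rsum (g := fun t => pr (fun w => (f w, g w, h w)) t * 1)).
  by rewrite pr_transfer; apply: eq_rsum => w; ring.
by move=> [[a b] c]; rewrite /triple /=; ring.
Qed.

Lemma condMI_triple : condMI triple = CMI f g h.
Proof.
rewrite condMI_xlg; last exact: triple_ge0.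
rewrite /CMI !entropy_xlg !(rsum_pairE (S := (A * B)%type)) !rsum_pairE.
rewrite (eq_rsum3 (g := fun a b c => xlg (triple a b c))) //.
have -> : rsum (fun s => rsum (fun t => xlg (pr (fun w => (f w, h w)) (s, t)))) =
  rsum (fun a => rsum (fun c => xlg (margAC triple a c))).
  by apply: eq_rsum => a; apply: eq_rsum => c; rewrite margAC_triple.
have -> : rsum (fun s => rsum (fun t => xlg (pr (fun w => (g w, h w)) (s, t)))) =
  rsum (fun a => rsum (fun c => xlg (margBC triple a c))).
  by apply: eq_rsum => a; apply: eq_rsum => c; rewrite margBC_triple.
have -> : rsum (fun s => xlg (pr h s)) = rsum (fun c => xlg (margC triple c)).
  by apply: eq_rsum => c; rewrite margC_triple.
ring.
Qed.

Lemma CMI_ge0 : 0 <= CMI f g h.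
Proof. by rewrite -condMI_triple; apply: condMI_ge0; apply: triple_ge0. Qed.
End Triple.

Lemma entropy_mono (A B : finType) (f : W -> A) (g : W -> B) : entropy f <= entropy (fun w => (f w, g w)).
Proof.
apply: rsum_le => w; case: (Rle_lt_or_eq_dec _ _ (P0 w)) => [h|<-]; last lra.
apply: Rmult_le_compat_l => //; apply: Ropp_le_contravar.
apply: log2_le; first exact: (pr_gt0 (fun w => (f w, g w))).
apply: rsum_le => w'; apply: Rmult_le_compat_l => //.
by rewrite xpair_eqE ind_and; have := ind_ge0 (f w' == f w); have := ind_le1 (g w' == g w); nra.
Qed.

(** Gibbs' inequality against the law under which f is uniform and independent of g. *)
Lemma entropy_cond_card (A B : finType) (f : W -> A) (g : W -> B) : rsum P = 1 -> (0 < #|A|)%nat ->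
  entropy (fun w => (f w, g w)) - entropy g <= log2 (INR #|A|).
Proof.
move=> P1 A0; have a0 : 0 < INR #|A| by apply: lt_0_INR; apply/ltP.
pose p2 (t : A * B) := pr (fun w => (f w, g w)) t.
pose q2 (t : A * B) := pr g t.2 / INR #|A|.
have p20 t : 0 <= p2 t by apply: pr_ge0.
have q20 t : 0 <= q2 t.
  by apply: Rmult_le_pos; [apply: pr_ge0 | apply/Rlt_le/Rinv_0_lt_compat].
have tot (C : finType) (k : W -> C) : rsum (pr k) = 1.
  rewrite -P1 (eq_rsum (g := fun t => pr k t * 1)); last by move=> t; ring.
  by rewrite pr_transfer; apply: eq_rsum => w; ring.
have pq t : 0 < p2 t -> 0 < q2 t.
  move=> h; apply: Rdiv_lt_0_compat => //; apply: Rlt_le_trans h _.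
  apply: rsum_le => w; apply: Rmult_le_compat_l => //; case: t => a b /=.
  rewrite xpair_eqE ind_and; have := ind_ge0 (g w == b); have := ind_le1 (f w == a).
  have := ind_ge0 (f w == a); nra.
have le : rsum q2 <= rsum p2.
  right; rewrite [RHS](tot _ (fun w => (f w, g w))) rsum_pairE.
  rewrite (eq_rsum (g := fun _ => / INR #|A|)); last first.
    by move=> a; rewrite /q2 /= /Rdiv rsum_mulr (tot _ g); ring.
  by rewrite rsum_const; apply: Rinv_r; lra.
have := gibbs p20 q20 pq le.
rewrite pr_transfer => G.
suff e : entropy (fun w => (f w, g w)) - entropy g - log2 (INR #|A|) =
   rsum (fun w => P w * log2 (q2 (f w, g w) / p2 (f w, g w))) by rewrite -e in G; lra.
rewrite -[log2 _]Rmult_1_l -P1 -rsum_mulr -!rsum_sub; apply: eq_rsum => w.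
case: (Rle_lt_or_eq_dec _ _ (P0 w)) => [h|<-]; last by ring.
have g1 := pr_gt0 g h; have g2 := pr_gt0 (fun w => (f w, g w)) h.
rewrite /q2 /p2 /= !log2_div //; last exact: Rdiv_lt_0_compat.
ring.
Qed.

End RV.

Lemma entropy_snd (M W A : finType) (P : M * W -> R) (f : W -> A) :
  entropy P (fun t => f t.2) = entropy (fun w => rsum (fun m => P (m, w))) f.
Proof.
rewrite /entropy [LHS]rsum_pairE rsum_exch; apply: eq_rsum => w /=.
rewrite -rsum_mulr; apply: eq_rsum => m; congr (_ * - log2 _).
rewrite /pr rsum_pairE rsum_exch; apply: eq_rsum => w' /=.
by rewrite -rsum_mulr.
Qed.

Lemma pr_dist (W A : finType) (P Q : W -> R) (f : W -> A) :
  rsum (fun a => Rabs (pr P f a - pr Q f a)) <= rsum (fun w => Rabs (P w - Q w)).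
Proof.
apply: Rle_trans (_ : rsum (fun a => pr (fun w => Rabs (P w - Q w)) f a * 1) <= _).
  apply: rsum_le => a; rewrite Rmult_1_r /pr -rsum_sub.
  apply: Rle_trans (rsum_abs _) _; apply: rsum_le => w.
  rewrite -Rmult_minus_distr_r Rabs_mult (Rabs_pos_eq (ind _)); [lra | exact: ind_ge0].
rewrite pr_transfer; apply: rsum_le => w; lra.
Qed.

(** * Conditional independence under a nearly memoryless law *)

Section Resample.
Variables (I T B C : finType) (p : T -> R) (phi : T -> B) (psi : T -> C) (i : I).
Hypothesis p0 : forall t, 0 <= p t.
Hypothesis p1 : rsum p = 1.

Definition cond_law (c : C) (b : B) : R :=
  disint (fun c b => rsum (fun t => p t * (ind (phi t == b) * ind (psi t == c)))) c b.

(** Redraw coordinate i: given [psi (w i)], the value [phi (w i)] is independent of every quantity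
    that sees coordinate i only through [psi]. *)
Lemma cond_resample (s : {ffun I -> T} -> R) b c :
  (forall w t t', psi t = psi t' -> s (upd w i t) = s (upd w i t')) ->
  rsum (fun w => pm p w * (s w * (ind (phi (w i) == b) * ind (psi (w i) == c)))) =
  rsum (fun w => pm p w * (s w * ind (psi (w i) == c))) * cond_law c b.
Proof.
move=> sP; rewrite (pm_resample p1 i) [X in _ = X * _](pm_resample p1 i) -rsum_mulr.
apply: eq_rsum => w; rewrite Rmult_assoc; congr (_ * _).
case: (pickP (fun t => psi t == c)) => [t0 /eqP t0c|no]; last first.
  by rewrite !rsum_eq0f ?Rmult_0_l // => t; rewrite upd_same no /ind !Rmult_0_r.
rewrite (eq_rsum (g := fun t => s (upd w i t0) * (p t * (ind (phi t == b) * ind (psi t == c))))); last first.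
  move=> t; rewrite upd_same; case: eqP => [e|_]; last by rewrite /ind; ring.
  case: eqP => [ec|_]; last by rewrite /ind; ring.
  by rewrite (sP w t t0) ?ec //; ring.
rewrite [X in _ = X * _](eq_rsum (g := fun t => s (upd w i t0) * (p t * ind (psi t == c)))); last first.
  move=> t; rewrite upd_same; case: eqP => [ec|_]; last by rewrite /ind; ring.
  by rewrite (sP w t t0) ?ec //; ring.
rewrite !rsum_mull Rmult_assoc; congr (_ * _).
rewrite /cond_law (disintE (j := fun c b => rsum (fun t => p t * (ind (phi t == b) * ind (psi t == c))))).
  congr (_ * _); rewrite rsum_exch; apply: eq_rsum => t.
  rewrite (eq_rsum (g := fun b => (p t * ind (psi t == c)) * ind (phi t == b))); last by move=> ?; ring.
  exact: (rsum_delta (phi t) (fun _ => p t * ind (psi t == c))).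
move=> c' b'; apply: rsum_ge0 => t; apply: Rmult_le_pos => //.
by apply: Rmult_le_pos; apply: ind_ge0.
Qed.

Hypothesis B0 : (0 < #|B|)%nat.

Lemma cond_law_kernel : is_kernel cond_law.
Proof.
apply: disint_kernel => // c b; apply: rsum_ge0 => t; apply: Rmult_le_pos => //.
by apply: Rmult_le_pos; apply: ind_ge0.
Qed.

(** Under [pm p] the triple factors exactly through [cond_law]. Replacing [pm p] by [P] costs d for
    the triple and d for its marginal on [G] and [psi], hence [2 * d]. The bound depends on |B| but
    not on the number of coordinates. *)
Lemma CMI_close (A : finType) (P : {ffun I -> T} -> R) (G : {ffun I -> T} -> A) d s t :
  (forall w, 0 <= P w) -> rsum P = 1 ->
  rsum (fun w => Rabs (P w - pm p w)) <= d ->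
  (forall w t t', psi t = psi t' -> G (upd w i t) = G (upd w i t')) ->
  0 < s -> 0 < t < 1 ->
  CMI P G (fun w => phi (w i)) (fun w => psi (w i)) <=
  log2 ((1 + s) / (1 - t)) + (1 + s) / s * (2 * d) * log2 (INR #|B| / t).
Proof.
move=> P0 P1 dP GP s0 t01; rewrite -condMI_triple //.
set f := fun w => phi (w i); set h := fun w => psi (w i).
apply: (@condMI_close _ _ _ _ _ cond_law) => //.
- by move=> *; apply: triple_ge0.
- exact: cond_law_kernel.
- by rewrite triple_sum; lra.
have Q a b c : triple (pm p) G f h a b c = margAC (triple (pm p) G f h) a c * cond_law c b.
  rewrite margAC_triple /triple /pr.
  rewrite (eq_rsum (g := fun w => pm p w * (ind (G w == a) * (ind (f w == b) * ind (h w == c))))).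
    rewrite (cond_resample (s := fun w => ind (G w == a))).
      by congr (_ * _); apply: eq_rsum => w; rewrite xpair_eqE ind_and.
    by move=> w t1 t2 e; rewrite (GP w t1 t2).
  by move=> w; rewrite !xpair_eqE !ind_and; ring.
have [k0 k1] := cond_law_kernel.
apply: Rle_trans (_ : rsum (fun a => rsum (fun b => rsum (fun c =>
   Rabs (triple P G f h a b c - triple (pm p) G f h a b c) +
   Rabs (margAC (triple P G f h) a c - margAC (triple (pm p) G f h) a c) * cond_law c b))) <= _).
  apply: rsum3_le => a b c.
  have -> : triple P G f h a b c - margAC (triple P G f h) a c * cond_law c b =
    (triple P G f h a b c - triple (pm p) G f h a b c) +
    - ((margAC (triple P G f h) a c - margAC (triple (pm p) G f h) a c) * cond_law c b).
    by rewrite Q; ring.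
  apply: Rle_trans (Rabs_triang _ _) _; apply: Rplus_le_compat_l.
  by rewrite Rabs_Ropp Rabs_mult (Rabs_pos_eq (cond_law _ _)) //; lra.
have d1 := pr_dist P (pm p) (fun w => (G w, f w, h w)).
have d2 := pr_dist P (pm p) (fun w => (G w, h w)).
have e1 : rsum (fun a => rsum (fun b => rsum (fun c =>
   Rabs (triple P G f h a b c - triple (pm p) G f h a b c)))) =
   rsum (fun t => Rabs (pr P (fun w => (G w, f w, h w)) t - pr (pm p) (fun w => (G w, f w, h w)) t)).
  by rewrite -rsum3; apply: eq_rsum => -[[a b] c].
have e2 : rsum (fun a => rsum (fun b => rsum (fun c =>
   Rabs (margAC (triple P G f h) a c - margAC (triple (pm p) G f h) a c) * cond_law c b))) =
   rsum (fun t => Rabs (pr P (fun w => (G w, h w)) t - pr (pm p) (fun w => (G w, h w)) t)).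
  rewrite [RHS]rsum_pairE; apply: eq_rsum => a; rewrite rsum_exch; apply: eq_rsum => c.
  by rewrite rsum_mull k1 !margAC_triple Rmult_1_r.
have -> : rsum (fun a => rsum (fun b => rsum (fun c =>
   Rabs (triple P G f h a b c - triple (pm p) G f h a b c) +
   Rabs (margAC (triple P G f h) a c - margAC (triple (pm p) G f h) a c) * cond_law c b))) =
  rsum (fun a => rsum (fun b => rsum (fun c =>
   Rabs (triple P G f h a b c - triple (pm p) G f h a b c)))) +
  rsum (fun a => rsum (fun b => rsum (fun c =>
   Rabs (margAC (triple P G f h) a c - margAC (triple (pm p) G f h) a c) * cond_law c b))).
  rewrite -rsum_add; apply: eq_rsum => a; rewrite -rsum_add; apply: eq_rsum => b.
  by rewrite -rsum_add.
rewrite e1 e2.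
have aux x y D : x <= D -> y <= D -> D <= d -> x + y <= 2 * d by lra.
exact: aux d1 d2 dP.
Qed.
End Resample.

Lemma telescope (n : nat) (F : nat -> R) :
  rsum (fun i : 'I_n => F i.+1 - F i) = F n - F O.
Proof.
rewrite /rsum; elim: n => [|n IH]; first by rewrite big_ord0; ring.
by rewrite big_ord_recr /= IH; ring.
Qed.

Lemma exists_le_mean (n : nat) (f : 'I_n -> R) c : (0 < n)%nat ->
  rsum f <= INR n * c -> exists i, f i <= c.
Proof.
move=> n0 le; apply: NNPP => no.
have n1 : 0 < INR n by apply: lt_0_INR; apply/ltP.
have lt i : c < f i by apply: Rnot_le_lt => h; apply: no; exists i.
have z : rsum (fun i => f i - c) = 0.
  apply: Rle_antisym; last by apply: rsum_ge0 => i; have := lt i; lra.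
  by rewrite rsum_sub rsum_const card_ord; lra.
have := rsum_eq0 _ z (Ordinal n0) => /(_ (fun i => _)) E.
have : f (Ordinal n0) - c = 0 by apply: E => i; have := lt i; lra.
by have := lt (Ordinal n0); lra.
Qed.

(** * Single-letterization *)

Lemma rsum_deltar (T : finType) (t : T) (f : T -> R) :
  rsum (fun s => f s * ind (s == t)) = f t.
Proof. by rewrite -[RHS](rsum_delta t f); apply: eq_rsum => s; rewrite eq_sym. Qed.

Lemma pr_injective (W A : finType) (P : W -> R) (f : W -> A) w :
  injective f -> pr P f (f w) = P w.
Proof.
move=> fI; rewrite -[RHS](rsum_deltar w P); apply: eq_rsum => w'.
by rewrite inj_eq.
Qed.

Lemma pr_snd (M W A : finType) (P : M * W -> R) (f : W -> A) a :
  pr P (fun t => f t.2) a = pr (fun w => rsum (fun m => P (m, w))) f a.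
Proof.
rewrite /pr rsum_pairE rsum_exch; apply: eq_rsum => w /=.
by rewrite -rsum_mulr.
Qed.

Lemma CMI_snd (M W A B C : finType) (P : M * W -> R) (f : W -> A) (g : W -> B) (h : W -> C) :
  CMI P (fun t => f t.2) (fun t => g t.2) (fun t => h t.2) =
  CMI (fun w => rsum (fun m => P (m, w))) f g h.
Proof.
by rewrite /CMI (entropy_snd P (fun w => (f w, h w))) (entropy_snd P (fun w => (g w, h w)))
  (entropy_snd P (fun w => (f w, g w, h w))) (entropy_snd P h).
Qed.

(** * Forgetting coordinates of a word *)

Section Coords.
Variables (n : nat) (S T : finType).
Definition fsts (w : {ffun 'I_n -> S * T}) : {ffun 'I_n -> S} := [ffun i => (w i).1].
Definition snds (w : {ffun 'I_n -> S * T}) : {ffun 'I_n -> T} := [ffun i => (w i).2].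
Lemma fsts_zipf x y : fsts (zipf x y) = x.
Proof. by apply/ffunP => i => /=; rewrite !ffunE. Qed.
Lemma snds_zipf x y : snds (zipf x y) = y.
Proof. by apply/ffunP => i => /=; rewrite !ffunE. Qed.
Lemma zipf_fsts_snds w : zipf (fsts w) (snds w) = w.
Proof. by apply/ffunP => i => /=; rewrite !ffunE; case: (w i). Qed.

(* [None] marks forgotten coordinates: [mask i] forgets coordinate i, [pre k] keeps
   only the first k coordinates. *)
Definition mask (i : 'I_n) (y : {ffun 'I_n -> T}) : {ffun 'I_n -> option T} :=
  [ffun j => if j == i then None else Some (y j)].
(** Total on all partial words: other gaps are filled with t as well, so that [Db] is a kernel for
    every value of u. *)
Definition unmask (i : 'I_n) (a : {ffun 'I_n -> option T}) (t : T) : {ffun 'I_n -> T} :=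
  [ffun j => if j == i then t else odflt t (a j)].
Definition pre (k : nat) (y : {ffun 'I_n -> T}) : {ffun 'I_n -> option T} :=
  [ffun j : 'I_n => if (j < k)%nat then Some (y j) else None].

Lemma unmaskK i y : unmask i (mask i y) (y i) = y.
Proof. by apply/ffunP => j => /=; rewrite !ffunE; case: eqP => [->|]. Qed.

Lemma maskP i y y' : mask i y = mask i y' /\ y i = y' i <-> y = y'.
Proof.
split=> [[e1 e2]|->] //; by rewrite -(unmaskK i y) e1 e2 unmaskK.
Qed.

Lemma preSP (i : 'I_n) y y' : pre i.+1 y = pre i.+1 y' <-> pre i y = pre i y' /\ y i = y' i.
Proof.
split=> [e|[e1 e2]].
  split; last by have := congr1 (fun f : {ffun 'I_n -> option T} => f i) e => /=; rewrite !ffunE ltnSn => -[].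
  apply/ffunP => j => /=; rewrite !ffunE; case: ifP => // ji.
  by have := congr1 (fun f : {ffun 'I_n -> option T} => f j) e => /=; rewrite !ffunE (ltn_trans ji (ltnSn i)).
apply/ffunP => j => /=; rewrite !ffunE ltnS leq_eqVlt.
case: eqP => [ji|_] /=; first by rewrite (_ : j = i) ?e2 //; apply: val_inj.
by have := congr1 (fun f : {ffun 'I_n -> option T} => f j) e1 => /=; rewrite !ffunE.
Qed.

Lemma preNP y y' : pre n y = pre n y' <-> y = y'.
Proof.
split=> [e|->] //; apply/ffunP => j.
by have := congr1 (fun f : {ffun 'I_n -> option T} => f j) e => /=; rewrite !ffunE ltn_ord => -[].
Qed.

Lemma pre0E y y' : pre 0 y = pre 0 y'.
Proof. by apply/ffunP => j => /=; rewrite !ffunE. Qed.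
End Coords.

Section Block.
Variables (X Y Z : finType) (pXY : X -> Y -> R) (pZ : X -> Y -> Z -> R).
Hypothesis HXY : is_pmf2 pXY.
Hypothesis HZ : is_kernel (fun xy : X * Y => pZ xy.1 xy.2).
Variables (n : nat) (c : code X Y Z n).
Hypothesis Hc : valid_code c.

Let pXY0 x y : 0 <= pXY x y. Proof. by case: HXY. Qed.
Let pZ0 x y z : 0 <= pZ x y z. Proof. by case: HZ => h _; apply: (h (x, y)). Qed.
Let pZ1 x y : rsum (pZ x y) = 1. Proof. by case: HZ => _ h; apply: (h (x, y)). Qed.
Let X0 := cardX_gt0 HXY.
Let Y0 := cardY_gt0 HXY.
Let Z0 := cardZ_gt0 HXY HZ.

Notation W := {ffun 'I_n -> X * Y * Z}.
Notation Om := ('I_(nmsg c) * W)%type.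
Definition xs (w : W) : {ffun 'I_n -> X} := fsts (fsts w).
Definition ys (w : W) : {ffun 'I_n -> Y} := snds (fsts w).
Definition zs (w : W) : {ffun 'I_n -> Z} := snds w.
Definition pxy (t : X * Y) := pXY t.1 t.2.
Definition p3 (t : X * Y * Z) := pXY t.1.1 t.1.2 * pZ t.1.1 t.1.2 t.2.
Definition Pj (t : Om) : R := @code_joint X Y Z pXY n c (xs t.2) (ys t.2) t.1 (zs t.2).
Definition PW (w : W) : R := rsum (fun m => Pj (m, w)).

Lemma pxy_sum : rsum pxy = 1.
Proof. by case: HXY => _ <-; rewrite rsum_pairE. Qed.
Lemma p3_ge0 t : 0 <= p3 t. Proof. exact: Rmult_le_pos. Qed.
Lemma p3_sum : rsum p3 = 1.
Proof.
rewrite -pxy_sum rsum_pairE; apply: eq_rsum => -[x y].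
by rewrite /p3 /= rsum_mull pZ1; apply: Rmult_1_r.
Qed.

Lemma pXYn_pm (x : {ffun 'I_n -> X}) (y : {ffun 'I_n -> Y}) : pXYn pXY x y = pm pxy (zipf x y).
Proof. by apply: eq_bigr => i _; rewrite ffunE. Qed.

Lemma pXYn_ge0 (x : {ffun 'I_n -> X}) (y : {ffun 'I_n -> Y}) : 0 <= pXYn pXY x y.
Proof. by rewrite pXYn_pm; apply: pm_ge0 => -[a b]; apply: pXY0. Qed.

Lemma rsumW (F : {ffun 'I_n -> X} -> {ffun 'I_n -> Y} -> {ffun 'I_n -> Z} -> R) :
  rsum (fun w => F (xs w) (ys w) (zs w)) = rsum (fun x => rsum (fun y => rsum (fun z => F x y z))).
Proof.
rewrite rsum_zipf rsum_zipf; do 3! [apply: eq_rsum => ?].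
by rewrite /xs /ys /zs !fsts_zipf !snds_zipf.
Qed.

Lemma Pj_ge0 t : 0 <= Pj t.
Proof.
case: Hc => -[e0 _] [d0 _].
by do 2! apply: Rmult_le_pos => //; apply: pXYn_ge0.
Qed.

Lemma PW_ge0 w : 0 <= PW w. Proof. by apply: rsum_ge0 => m; apply: Pj_ge0. Qed.

Lemma Pj_sum : rsum Pj = 1.
Proof.
case: Hc => ke kd.
rewrite rsum_pairE.
rewrite (eq_rsum (fun m => rsumW (fun x y z => @code_joint X Y Z pXY n c x y m z))).
rewrite -(@pm_sum1 'I_n _ _ pxy_sum) rsum_zipf rsum_exch; apply: eq_rsum => x.
rewrite rsum_exch; apply: eq_rsum => y.
rewrite -pXYn_pm -[RHS](kernel_mull x _ ke); apply: eq_rsum => m.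
by rewrite kernel_mull.
Qed.

Lemma PW_sum : rsum PW = 1.
Proof. by rewrite -Pj_sum [RHS]rsum_pairE rsum_exch. Qed.

Lemma PW_tv : rsum (fun w => Rabs (PW w - pm p3 w)) = 2 * code_tv pXY pZ c.
Proof.
rewrite /code_tv -Rmult_assoc Rinv_r ?Rmult_1_l; last lra.
rewrite -(rsumW (fun x y z => Rabs (rsum (fun m => @code_joint X Y Z pXY n c x y m z) - pXYZn pXY pZ x y z))).
apply: eq_rsum => w; congr (Rabs (_ - _)); apply: eq_bigr => i _.
by rewrite !ffunE.
Qed.

Variable i : 'I_n.
Definition UU : finType := ('I_(nmsg c) * {ffun 'I_n -> option Y})%type.
Definition Ui (t : Om) : UU := (t.1, mask i (ys t.2)).
Definition Xi (t : Om) : X := (t.2 i).1.1.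
Definition Yi (t : Om) : Y := (t.2 i).1.2.
Definition Zi (t : Om) : Z := (t.2 i).2.
Definition Jb (u : UU) x y z := pr Pj (fun t => (Ui t, Xi t, Yi t, Zi t)) (u, x, y, z).

Lemma Jb_ge0 u x y z : 0 <= Jb u x y z.
Proof. by apply: pr_ge0; apply: Pj_ge0. Qed.

(* The factors of the joint law of (U_i, X_i, Y_i, Z_i): p(u,x), p(y|x) and p(z|u,y). *)
Definition Sb (u : UU) (x : X) := rsum (fun w : {ffun 'I_n -> X * Y} =>
  pm pxy w * (enc c (fsts w) u.1 * ind (mask i (snds w) == u.2) * ind ((w i).1 == x))).
Definition lawb : X -> Y -> R := cond_law pxy snd fst.
Definition Db (u : UU) (y : Y) (z : Z) := rsum (fun zn : {ffun 'I_n -> Z} =>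
  dec c (u.1, unmask i u.2 y) zn * ind (zn i == z)).

Lemma lawb_kernel : is_kernel lawb.
Proof. by apply: cond_law_kernel => // -[x y]; apply: pXY0. Qed.

Lemma lawbE x y : pXY x y = rsum (pXY x) * lawb x y.
Proof.
have jE x' y' : rsum (fun t : X * Y => pxy t * (ind (t.2 == y') * ind (t.1 == x'))) = pXY x' y'.
  rewrite -[RHS](rsum_deltar (x', y') pxy); apply: eq_rsum => -[a b] /=.
  by rewrite xpair_eqE andbC ind_and.
rewrite /lawb /cond_law -[LHS]jE.
rewrite (disintE (j := fun c b => rsum (fun t : X * Y => pxy t * (ind (t.2 == b) * ind (t.1 == c))))).
  by congr (_ * _); apply: eq_rsum => y'; rewrite jE.
by move=> x' y'; rewrite jE.
Qed.

Lemma Db_sum u y : rsum (Db u y) = 1.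
Proof.
case: Hc => _ [_ d1]; rewrite -(d1 (u.1, unmask i u.2 y)) /Db rsum_exch.
by apply: eq_rsum => zn; rewrite (rsum_delta (zn i) (fun _ => dec c (u.1, unmask i u.2 y) zn)).
Qed.

(** M and the masked word do not involve y_i beyond its dependence on x_i, so [cond_resample] splits
    off p(y|x). The decoder sees M and Y^n, which U_i and Y_i determine through [unmask], so z_i
    depends on the rest only through (u,y). *)
Lemma JbE u x y z : Jb u x y z = Sb u x * lawb x y * Db u y z.
Proof.
case: u => m a.
have -> : Jb (m, a) x y z = rsum (fun xn => rsum (fun yn => rsum (fun zn =>
   @code_joint X Y Z pXY n c xn yn m zn * (ind (mask i yn == a) * (ind (yn i == y) * ind (xn i == x)))
     * ind (zn i == z)))).
  rewrite -(rsumW (fun xn yn zn => @code_joint X Y Z pXY n c xn yn m zn * (ind (mask i yn == a) *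
    (ind (yn i == y) * ind (xn i == x))) * ind (zn i == z))).
  rewrite /Jb /pr rsum_pairE.
  rewrite -(rsum_deltar m (fun m => rsum (fun w => @code_joint X Y Z pXY n c (xs w) (ys w) m (zs w) *
    (ind (mask i (ys w) == a) * (ind (ys w i == y) * ind (xs w i == x))) * ind (zs w i == z)))).
  apply: eq_rsum => m'; rewrite -rsum_mulr; apply: eq_rsum => w.
  rewrite /Pj /= !xpair_eqE !ind_and /xs /ys /zs !ffunE /Xi /Yi /Zi /=.
  have perm j k1 k2 k3 k4 k5 : j * (k1 * k2 * k3 * k4 * k5) = j * (k2 * (k4 * k3)) * k5 * k1 by ring.
  exact: perm.
have step xn yn : rsum (fun zn =>
   @code_joint X Y Z pXY n c xn yn m zn * (ind (mask i yn == a) * (ind (yn i == y) * ind (xn i == x)))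
     * ind (zn i == z)) =
   pXYn pXY xn yn * (enc c xn m * ind (mask i yn == a) * (ind (yn i == y) * ind (xn i == x))) * Db (m, a) y z.
  rewrite /Db /= -rsum_mull; apply: eq_rsum => zn; rewrite /code_joint.
  case: eqP => [e1|_]; last by rewrite /(ind false); ring.
  case: eqP => [e2|_]; last by rewrite /(ind false); ring.
  by rewrite -e1 -e2 unmaskK; ring.
transitivity (rsum (fun xn => rsum (fun yn => pXYn pXY xn yn * (enc c xn m * ind (mask i yn == a) *
   (ind (yn i == y) * ind (xn i == x))))) * Db (m, a) y z).
  rewrite -rsum_mulr; apply: eq_rsum => xn; rewrite -rsum_mulr; apply: eq_rsum => yn.
  exact: step.
congr (_ * _).
transitivity (rsum (fun w : {ffun 'I_n -> X * Y} => pm pxy w *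
   (enc c (fsts w) m * ind (mask i (snds w) == a) * (ind ((w i).2 == y) * ind ((w i).1 == x))))).
  rewrite rsum_zipf; apply: eq_rsum => xn; apply: eq_rsum => yn.
  by rewrite fsts_zipf snds_zipf -pXYn_pm ffunE.
rewrite (@cond_resample _ _ _ _ pxy snd fst i _ pxy_sum
  (fun w => enc c (fsts w) m * ind (mask i (snds w) == a))) //.
  by case.
move=> w t t' e; congr (enc c _ m * ind (_ == a)); apply/ffunP => j => /=; rewrite !ffunE; case: eqP => //.
Qed.

(** The chain is stated with the source law, which makes it a linear condition on the slice u
    alone. *)
Lemma Jb_markov1 u x y : rsum (fun z => Jb u x y z) * rsum (pXY x) =
  rsum (fun y => rsum (fun z => Jb u x y z)) * pXY x y.
Proof.
have sz y' : rsum (fun z => Jb u x y' z) = Sb u x * lawb x y'.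
  by rewrite (eq_rsum (fun z => JbE u x y' z)) rsum_mull Db_sum Rmult_1_r.
rewrite sz (eq_rsum sz) kernel_mull; last exact: lawb_kernel.
by rewrite lawbE; ring.
Qed.

Lemma Jb_markov2 u x y z : Jb u x y z * rsum (fun z => rsum (fun x => Jb u x y z)) =
  rsum (fun x => Jb u x y z) * rsum (fun z => Jb u x y z).
Proof.
have sx z' : rsum (fun x => Jb u x y z') = rsum (fun x => Sb u x * lawb x y) * Db u y z'.
  by rewrite (eq_rsum (fun x => JbE u x y z')) rsum_mulr.
rewrite (eq_rsum sx) sx (eq_rsum (fun z => JbE u x y z)) !rsum_mull Db_sum JbE; ring.
Qed.

Lemma Jb_close x y z :
  Rabs (rsum (fun u => Jb u x y z) - pXY x y * pZ x y z) <= 2 * code_tv pXY pZ c.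
Proof.
have -> : rsum (fun u => Jb u x y z) = pr PW (fun w => w i) (x, y, z).
  rewrite -(pr_snd Pj (fun w => w i)) -(pr_fst _ _ Ui); apply: eq_rsum => u.
  apply: eq_pr => t; rewrite !xpair_eqE -!andbA.
  rewrite /Xi /Yi /Zi; case: (t.2 i) => -[a b] d /=.
  rewrite (_ : (Ui t == u) = (t.1 == u.1) && (mask i (ys t.2) == u.2)) //.
  by case: (_ == u.1); case: (_ == u.2); case: (a == x); case: (b == y); case: (d == z).
have -> : pXY x y * pZ x y z = pr (pm p3) (fun w => w i) (x, y, z).
  by rewrite /pr (pm_E1 p3_sum i (fun t => ind (t == (x, y, z)))) rsum_deltar.
rewrite -PW_tv; apply: Rle_trans _ (pr_dist PW (pm p3) (fun w : W => w i)).
apply: (@rsum_term _ (x, y, z) (fun a => Rabs (pr PW (fun w => w i) a - pr (pm p3) (fun w => w i) a))) => t.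
exact: Rabs_pos.
Qed.

Lemma obj_CMI : condMI (fun z u y => rsum (fun x => Jb u x y z)) = CMI Pj Zi Ui Yi.
Proof.
rewrite -condMI_triple; last exact: Pj_ge0.
congr condMI; do 3! [apply: functional_extensionality => ?].
rewrite /triple -(pr_fst _ _ Xi); apply: eq_rsum => x'.
apply: eq_pr => t; rewrite !xpair_eqE.
by case: (Ui t == _); case: (Xi t == _); case: (Yi t == _); case: (Zi t == _).
Qed.

Lemma leak_CMI : condMI (fun u x (yz : Y * Z) => Jb u x yz.1 yz.2) =
  CMI Pj Ui Xi (fun t => (Yi t, Zi t)).
Proof.
rewrite -condMI_triple; last exact: Pj_ge0.
congr condMI; do 2! [apply: functional_extensionality => ?].
apply: functional_extensionality => -[y z].
by apply: eq_pr => t; rewrite !xpair_eqE !andbA.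
Qed.

Definition Mt (t : Om) : 'I_(nmsg c) := t.1.
Definition Xt (t : Om) := xs t.2.
Definition Yt (t : Om) := ys t.2.
Definition Zt (t : Om) := zs t.2.

Lemma code_leak_CMI : code_leak pXY c = CMI Pj Mt Xt (fun t => (Yt t, Zt t)).
Proof.
rewrite -condMI_triple; last exact: Pj_ge0.
congr condMI; apply: functional_extensionality => m; apply: functional_extensionality => x.
apply: functional_extensionality => -[y z] /=.
pose f (t : Om) := (Mt t, Xt t, (Yt t, Zt t)).
pose w0 : Om := (m, zipf (zipf x y) z).
have e : f w0 = (m, x, (y, z)).
  by rewrite /f /Mt /Xt /Yt /Zt /xs /ys /zs /= !fsts_zipf !snds_zipf.
rewrite /triple -/f -e pr_injective; first by rewrite /Pj /xs /ys /zs /= !fsts_zipf !snds_zipf.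
move=> [m1 w1] [m2 w2] []; rewrite /Mt /Xt /Yt /Zt /xs /ys /zs /= => -> e1 e2 e3.
by congr pair; rewrite -(zipf_fsts_snds w1) -(zipf_fsts_snds w2) e3 -(zipf_fsts_snds (fsts w1)) e1 e2 zipf_fsts_snds.
Qed.

End Block.

(** * Chain rules along prefixes *)

Section Chain.
Variables (X Y Z : finType) (pXY : X -> Y -> R) (pZ : X -> Y -> Z -> R).
Hypothesis HXY : is_pmf2 pXY.
Hypothesis HZ : is_kernel (fun xy : X * Y => pZ xy.1 xy.2).
Variables (n : nat) (c : code X Y Z n).
Hypothesis Hc : valid_code c.
Variables (s t : R) (gam : R).
Hypothesis s0 : 0 < s.
Hypothesis t01 : 0 < t < 1.
(** The bound of [CMI_close]; the distance there is an unhalved sum, hence [2 * code_tv]. *)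
Let bound B := log2 ((1 + s) / (1 - t)) + (1 + s) / s * (2 * (2 * code_tv pXY pZ c)) * log2 (B / t).
Hypothesis gX : bound (INR #|X|) <= gam.
Hypothesis gZ : bound (INR #|Z|) <= gam.

Let P := @Pj X Y Z pXY n c.
Let P0 := Pj_ge0 HXY Hc.
Notation Om := ('I_(nmsg c) * {ffun 'I_n -> X * Y * Z})%type.
Let M (u : Om) : 'I_(nmsg c) := u.1.
Let Xn (u : Om) := xs u.2.
Let Yn (u : Om) := ys u.2.
Let Zn (u : Om) := zs u.2.

Lemma ys_upd (w : {ffun 'I_n -> X * Y * Z}) i v v' : v.1.2 = v'.1.2 -> ys (upd w i v) = ys (upd w i v').
Proof. by move=> e; apply/ffunP => j => /=; rewrite !ffunE; case: eqP. Qed.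

Lemma zs_upd (w : {ffun 'I_n -> X * Y * Z}) i v v' : v.2 = v'.2 -> zs (upd w i v) = zs (upd w i v').
Proof. by move=> e; apply/ffunP => j => /=; rewrite !ffunE; case: eqP. Qed.

(** Under the target law Z_i is independent of all other coordinates given Y_i. M stays out, since
    closeness to the target law concerns only (X,Y,Z)^n. *)
Lemma gapZ (i : 'I_n) : CMI P (fun u => (Yn u, pre i (Zn u))) (@Zi _ _ _ _ c i) (@Yi _ _ _ _ c i) <= gam.
Proof.
rewrite /Zi /Yi (CMI_snd P (fun w => (ys w, pre i (zs w))) (fun w => (w i).2) (fun w => (w i).1.2)).
apply: Rle_trans gZ.
apply: (@CMI_close _ _ _ _ (p3 pXY pZ) snd (fun v => v.1.2) i) => //.
- exact: p3_ge0.
- exact: p3_sum.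
- exact: cardZ_gt0 HXY HZ.
- exact: PW_ge0.
- exact: PW_sum.
- by rewrite PW_tv; lra.
move=> w v v' e; congr pair; first exact: ys_upd.
by apply/ffunP => j => /=; rewrite !ffunE; case: ifP => // ji; case: eqP ji => // ->; rewrite ltnn.
Qed.

Lemma gapX (i : 'I_n) : CMI P (fun u => (Yn u, Zn u, pre i (Xn u))) (@Xi _ _ _ _ c i)
   (fun u => (@Yi _ _ _ _ c i u, @Zi _ _ _ _ c i u)) <= gam.
Proof.
rewrite /Zi /Yi /Xi (CMI_snd P (fun w => (ys w, zs w, pre i (xs w))) (fun w => (w i).1.1)
  (fun w => ((w i).1.2, (w i).2))).
apply: Rle_trans gX.
apply: (@CMI_close _ _ _ _ (p3 pXY pZ) (fun v => v.1.1) (fun v => (v.1.2, v.2)) i) => //.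
- exact: p3_ge0.
- exact: p3_sum.
- exact: cardX_gt0 HXY.
- exact: PW_ge0.
- exact: PW_sum.
- by rewrite PW_tv; lra.
move=> w v v' [e1 e2]; congr (_, _, _); [exact: ys_upd | exact: zs_upd | ].
by apply/ffunP => j => /=; rewrite !ffunE; case: ifP => // ji; case: eqP ji => // ->; rewrite ltnn.
Qed.

(** Their increments in k are conditional entropies of single letters given the prefix, without M
    for [aZ], [aX] and with M for [bZ], [bX]; they telescope over i. *)
Let aZ k := entropy P (fun u => (Yn u, pre k (Zn u))).
Let bZ k := entropy P (fun u => (M u, Yn u, pre k (Zn u))).
Let aX k := entropy P (fun u => (Yn u, Zn u, pre k (Xn u))).
Let bX k := entropy P (fun u => (M u, Yn u, Zn u, pre k (Xn u))).

Lemma ysE (u : Om) (i : 'I_n) : ys u.2 i = Yi i u. Proof. by rewrite !ffunE. Qed.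
Lemma zsE (u : Om) (i : 'I_n) : zs u.2 i = Zi i u. Proof. by rewrite !ffunE. Qed.
Lemma xsE (u : Om) (i : 'I_n) : xs u.2 i = Xi i u. Proof. by rewrite !ffunE. Qed.

(** (U_i,Y_i) carries the same information as (M,Y^n), which does not depend on i; this makes
    telescoping possible. *)
Lemma UYP (i : 'I_n) (u u' : Om) : Ui i u = Ui i u' /\ Yi i u = Yi i u' <-> M u = M u' /\ Yn u = Yn u'.
Proof.
rewrite /Ui -!ysE /M /Yn; split.
  by case=> -[-> e] e2; split=> //; apply/(maskP i).
by case=> -> e; rewrite e.
Qed.

Lemma ZSP (i : 'I_n) (u u' : Om) : pre i.+1 (Zn u) = pre i.+1 (Zn u') <->
  pre i (Zn u) = pre i (Zn u') /\ Zi i u = Zi i u'.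
Proof. by rewrite preSP -!zsE. Qed.
Lemma XSP (i : 'I_n) (u u' : Om) : pre i.+1 (Xn u) = pre i.+1 (Xn u') <->
  pre i (Xn u) = pre i (Xn u') /\ Xi i u = Xi i u'.
Proof. by rewrite preSP -!xsE. Qed.

(** The left side is H(Z_i|Y_i) - H(Z_i|M,Y^n). By [gapZ] the first term is at most gam +
    H(Z_i|Y^n,Z^{i-1}); the second is at least H(Z_i|M,Y^n,Z^{i-1}). *)
Lemma obj_le (i : 'I_n) : CMI P (Zi i) (Ui i) (Yi i) <= gam + (aZ i.+1 - aZ i) - (bZ i.+1 - bZ i).
Proof.
have A := gapZ i.
have B := CMI_ge0 P0 (Zi i) (fun u => pre i (Zn u)) (fun u => (M u, Yn u)).
move: A B; rewrite /CMI.
have Yeq u u' : Yn u = Yn u' -> Yi i u = Yi i u' by rewrite -!ysE /Yn => ->.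
have -> : entropy P (fun u => (Yn u, pre i (Zn u), Yi i u)) = aZ i.
  by apply: entropy_inj => u u'; split=> [[-> -> _] //|[e ->]]; rewrite (Yeq _ _ e) e.
have -> : entropy P (fun u => (Yn u, pre i (Zn u), Zi i u, Yi i u)) = aZ i.+1.
  apply: entropy_inj => u u'; split=> [[-> e1 e2 _]|[e /ZSP[-> ->]]].
    by congr pair; apply/ZSP.
  by rewrite (Yeq _ _ e) e.
have -> : entropy P (fun u => (pre i (Zn u), (M u, Yn u))) = bZ i.
  by apply: entropy_inj => u u'; split=> [[-> -> ->]|[-> -> ->]].
have -> : entropy P (fun u => (Zi i u, pre i (Zn u), (M u, Yn u))) = bZ i.+1.
  apply: entropy_inj => u u'; split=> [[e1 e2 -> ->]|[-> -> /ZSP[-> ->]]] //.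
  by congr pair; apply/ZSP.
have -> : entropy P (fun u => (Ui i u, Yi i u)) = entropy P (fun u => (M u, Yn u)).
  apply: entropy_inj => u u'; split=> [[e1 e2 e3]|[e1 e2]].
    by have [-> ->] : M u = M u' /\ Yn u = Yn u' by apply/(UYP i); split=> //; rewrite /Ui e1 e2.
  by have [-> ->] : Ui i u = Ui i u' /\ Yi i u = Yi i u' by apply/UYP.
have -> : entropy P (fun u => (Zi i u, Ui i u, Yi i u)) = entropy P (fun u => (Zi i u, (M u, Yn u))).
  apply: entropy_inj => u u'; split=> [[-> e1 e2 e3]|[-> e1 e2]].
    by have [-> ->] : M u = M u' /\ Yn u = Yn u' by apply/(UYP i); split=> //; rewrite /Ui e1 e2.
  by have [-> ->] : Ui i u = Ui i u' /\ Yi i u = Yi i u' by apply/UYP.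
have aux a1 a2 b1 b2 h1 h2 h3 h4 : a1 + h1 - a2 - h2 <= gam -> 0 <= h3 + b1 - b2 - h4 ->
  h1 + h4 - h3 - h2 <= gam + (a2 - a1) - (b2 - b1) by lra.
exact: aux.
Qed.

(** The same scheme: [gapX] bounds H(X_i|Y_i,Z_i), and conditioning in addition on Z^n and X^{i-1}
    lowers H(X_i|M,Y^n,Z_i). *)
Lemma leak_le (i : 'I_n) : CMI P (Ui i) (Xi i) (fun u => (Yi i u, Zi i u)) <=
  gam + (aX i.+1 - aX i) - (bX i.+1 - bX i).
Proof.
have A := gapX i.
have B := CMI_ge0 P0 (Xi i) (fun u => (Zn u, pre i (Xn u))) (fun u => (Ui i u, (Yi i u, Zi i u))).
move: A B; rewrite /CMI.
have Yeq u u' : Yn u = Yn u' -> Yi i u = Yi i u' by rewrite -!ysE /Yn => ->.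
have Zeq u u' : Zn u = Zn u' -> Zi i u = Zi i u' by rewrite -!zsE /Zn => ->.
have -> : entropy P (fun u => (Yn u, Zn u, pre i (Xn u), (Yi i u, Zi i u))) = aX i.
  by apply: entropy_inj => u u'; split=> [[-> -> ->] //|[e1 e2 ->]]; rewrite (Yeq _ _ e1) (Zeq _ _ e2) e1 e2.
have -> : entropy P (fun u => (Yn u, Zn u, pre i (Xn u), Xi i u, (Yi i u, Zi i u))) = aX i.+1.
  apply: entropy_inj => u u'; split=> [[-> -> e1 e2 _ _]|[e1 e2 /XSP[-> ->]]].
    by congr pair; apply/XSP.
  by rewrite (Yeq _ _ e1) (Zeq _ _ e2) e1 e2.
have -> : entropy P (fun u => (Zn u, pre i (Xn u), (Ui i u, (Yi i u, Zi i u)))) = bX i.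
  apply: entropy_inj => u u'; split=> [[-> -> e1 e2 e3 e4]|[e1 e2 e3 ->]].
    by have [-> ->] : M u = M u' /\ Yn u = Yn u' by apply/(UYP i); split=> //; rewrite /Ui e1 e2.
  have [-> ->] : Ui i u = Ui i u' /\ Yi i u = Yi i u' by apply/UYP.
  by rewrite (Zeq _ _ e3) e3.
have -> : entropy P (fun u => (Xi i u, (Zn u, pre i (Xn u)), (Ui i u, (Yi i u, Zi i u)))) = bX i.+1.
  apply: entropy_inj => u u'; split=> [[e5 -> e6 e1 e2 e3 e4]|[e1 e2 e3 /XSP[-> ->]]].
    have [-> ->] : M u = M u' /\ Yn u = Yn u' by apply/(UYP i); split=> //; rewrite /Ui e1 e2.
    by congr pair; apply/XSP.
  have [-> ->] : Ui i u = Ui i u' /\ Yi i u = Yi i u' by apply/UYP.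
  by rewrite (Zeq _ _ e3) e3.
have -> : entropy P (fun u => (Xi i u, (Ui i u, (Yi i u, Zi i u)))) = entropy P (fun u => (Ui i u, Xi i u, (Yi i u, Zi i u))).
  by apply: entropy_inj => u u'; split=> [[-> e1 e2 -> ->]|[e1 e2 -> -> ->]]; rewrite /Ui e1 e2.
have aux a1 a2 b1 b2 h1 h2 h3 h4 : a1 + h1 - a2 - h2 <= gam -> 0 <= h3 + b1 - b2 - h4 ->
  h4 + h1 - h3 - h2 <= gam + (a2 - a1) - (b2 - b1) by lra.
exact: aux.
Qed.

(** The increments telescope to I(M;Z^n|Y^n), which is at most H(M|Y^n). *)
Lemma obj_sum : rsum (fun i : 'I_n => CMI P (Zi i) (Ui i) (Yi i)) <= INR n * gam + log2 (INR (nmsg c)).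
Proof.
apply: Rle_trans (rsum_le obj_le) _.
rewrite rsum_sub rsum_add !telescope rsum_const card_ord.
have m0 : (0 < #|'I_(nmsg c)|)%nat.
  case: Hc => -[_ e1] _.
  have /card_gt0P[x _] : (0 < #|{ffun 'I_n -> X}|)%nat.
    by rewrite card_ffun expn_gt0 (cardX_gt0 HXY).
  exact: rsum1_card (e1 x).
have := entropy_cond_card P0 M Yn (Pj_sum HXY Hc) m0; rewrite card_ord.
have -> : entropy P Yn = aZ 0.
  by apply: entropy_inj => u u'; split=> [->|[->]] //; rewrite (pre0E (Zn u) (Zn u')).
have -> : entropy P (fun u => (M u, Yn u)) = bZ 0.
  by apply: entropy_inj => u u'; split=> [[-> ->]|[-> ->]] //; rewrite (pre0E (Zn u) (Zn u')).
have := entropy_mono P0 (fun u => (Yn u, pre n (Zn u))) M.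
have -> : entropy P (fun u => (Yn u, pre n (Zn u), M u)) = bZ n.
  by apply: entropy_inj => u u'; split=> [[-> -> ->]|[-> -> ->]].
have aux a0 a1 b0 b1 g l : a1 <= b1 -> b0 - a0 <= l -> g + (a1 - a0) - (b1 - b0) <= g + l by lra.
exact: aux.
Qed.

(** Here the increments telescope to the leakage I(M;X^n|Y^n,Z^n) itself. *)
Lemma leak_sum : rsum (fun i : 'I_n => CMI P (Ui i) (Xi i) (fun u => (Yi i u, Zi i u))) <=
  INR n * gam + code_leak pXY c.
Proof.
apply: Rle_trans (rsum_le leak_le) _.
rewrite rsum_sub rsum_add !telescope rsum_const card_ord.
rewrite (code_leak_CMI HXY Hc) /CMI.
have -> : entropy P (fun u => (Mt u, (Yt u, Zt u))) = bX 0.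
  apply: entropy_inj => u u'; rewrite /Mt /Yt /Zt -/(M u) -/(M u') -/(Yn u) -/(Zn u) -/(Yn u') -/(Zn u').
  by split=> [[-> -> ->]|[-> -> ->]] //; rewrite (pre0E (Xn u) (Xn u')).
have -> : entropy P (fun u => (Xt u, (Yt u, Zt u))) = aX n.
  apply: entropy_inj => u u'; rewrite /Xt /Yt /Zt -/(Xn u) -/(Yn u) -/(Zn u) -/(Xn u') -/(Yn u') -/(Zn u').
  by split=> [[-> -> ->]|[-> -> /preNP ->]].
have -> : entropy P (fun u => (Mt u, Xt u, (Yt u, Zt u))) = bX n.
  apply: entropy_inj => u u'; rewrite /Mt /Xt /Yt /Zt -/(M u) -/(M u') -/(Xn u) -/(Yn u) -/(Zn u) -/(Xn u') -/(Yn u') -/(Zn u').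
  by split=> [[-> -> -> ->]|[-> -> -> /preNP ->]].
have -> : entropy P (fun u => (Yt u, Zt u)) = aX 0.
  apply: entropy_inj => u u'; rewrite /Yt /Zt -/(Yn u) -/(Zn u) -/(Yn u') -/(Zn u').
  by split=> [[-> ->]|[-> ->]] //; rewrite (pre0E (Xn u) (Xn u')).
have aux a0 a1 b0 b1 g : g + (a1 - a0) - (b1 - b0) <= g + (b0 + a1 - b1 - a0) by lra.
exact: aux.
Qed.
End Chain.

(** * Conic Caratheodory, compactness and continuity *)

Lemma lin_dep (T : finType) (m : nat) (v : nat -> T -> R) (S : {set T}) : (m < #|S|)%nat ->
  exists c : T -> R, [/\ forall t, t \notin S -> c t = 0, exists t, c t <> 0 &
    forall k, (k < m)%nat -> rsum (fun t => c t * v k t) = 0].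
Proof.
elim: m S => [|m IH] S mS.
  have /card_gt0P[t0 t0S] := mS.
  exists (fun t => ind (t == t0)); split=> [t|| //].
    by case: eqP => [->|//]; rewrite t0S.
  by exists t0; rewrite eqxx /ind; lra.
have rem t : t \in S -> (m < #|S :\ t|)%nat.
  by move=> tS; move: mS; rewrite (cardsD1 t) tS add1n ltnS.
have sub t t' (c : T -> R) : (forall t', t' \notin S :\ t -> c t' = 0) -> t' \notin S -> c t' = 0.
  by move=> h t'S; apply: h; rewrite in_setD1 negb_and t'S orbT.
have /card_gt0P[t0 t0S] : (0 < #|S|)%nat by apply: leq_trans mS.
have [c1 [s1 [t1 n1] e1]] := IH _ (rem _ t0S).
have small k : (k < m.+1)%nat -> (k < m)%nat \/ k = m.
  by rewrite ltnS leq_eqVlt => /orP[/eqP ->|]; [right|left].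
case: (Req_dec (rsum (fun t => c1 t * v m t)) 0) => [a0|a0].
  exists c1; split=> [t tS||k /small[/e1 //|-> //]]; first exact: sub s1 tS.
  by exists t1.
have t1S : t1 \in S.
  by case: (boolP (t1 \in S)) => // h; case: n1; apply: sub s1 h.
(* This second dependency avoids [t1], where [c1] is nonzero, so the combination that cancels
   functional m does not vanish at [t1]. *)
have [c2 [s2 [t2 n2] e2]] := IH _ (rem _ t1S).
case: (Req_dec (rsum (fun t => c2 t * v m t)) 0) => [b0|b0].
  exists c2; split=> [t tS||k /small[/e2 //|-> //]]; first exact: sub s2 tS.
  by exists t2.
set al := rsum _ in a0; set be := rsum _ in b0.
exists (fun t => be * c1 t - al * c2 t).
have comb k : rsum (fun t => (be * c1 t - al * c2 t) * v k t) =
   be * rsum (fun t => c1 t * v k t) - al * rsum (fun t => c2 t * v k t).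
  by rewrite -2!rsum_mull -rsum_sub; apply: eq_rsum => t; ring.
split=> [t tS||k /small[km|->]].
- by rewrite (sub _ _ _ s1 tS) (sub _ _ _ s2 tS); ring.
- exists t1; rewrite (s2 t1); last by rewrite !inE eqxx.
  by rewrite Rmult_0_r Rminus_0_r => /Rmult_integral[].
- by rewrite comb e1 // e2 //; ring.
- by rewrite comb -/al -/be; ring.
Qed.

Lemma exists_argmin (T : finType) (p : pred T) (f : T -> R) t0 : p t0 ->
  exists2 t, p t & forall t', p t' -> f t <= f t'.
Proof.
move=> pt0.
suff [t pt h] : exists2 t, p t & forall t', t' \in enum T -> p t' -> f t <= f t'.
  by exists t => // t' pt'; apply: h => //; rewrite mem_enum.
elim: (enum T) => [|a l [t pt h]]; first by exists t0.
case pa: (p a); last first.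
  by exists t => // t'; rewrite inE => /orP[/eqP ->|/h //]; rewrite pa.
case: (Rle_lt_dec (f t) (f a)) => le.
  by exists t => // t'; rewrite inE => /orP[/eqP -> //|/h].
exists a => // t'; rewrite inE => /orP[/eqP -> _|/h k pt']; first lra.
by have := k pt'; lra.
Qed.

Definition supp (T : finType) (mu : T -> R) : {set T} := [set t | Rltb 0 (mu t)].

Lemma supp_out (T : finType) (mu : T -> R) t : (forall t, 0 <= mu t) -> t \notin supp mu -> mu t = 0.
Proof. by move=> m0; rewrite inE => /RltbP h; have := m0 t; lra. Qed.

(** Moving along a linear dependency keeps the m sums and can remove a support point. Weights need
    not sum to 1, so m points suffice rather than m + 1. *)
Lemma conic_caratheodory (T : finType) (m : nat) (v : nat -> T -> R) (lam : T -> R) :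
  (forall t, 0 <= lam t) ->
  exists mu : T -> R, [/\ forall t, 0 <= mu t, (#|supp mu| <= m)%nat &
    forall k, (k < m)%nat -> rsum (fun t => mu t * v k t) = rsum (fun t => lam t * v k t)].
Proof.
have [N] := ubnP #|supp lam|; elim: N lam => // N IH lam leN lam0.
case: (leqP #|supp lam| m) => [le|gt]; first by exists lam.
have [c [cS cpos ce]] : exists c : T -> R, [/\ forall t, t \notin supp lam -> c t = 0,
    exists t, 0 < c t & forall k, (k < m)%nat -> rsum (fun t => c t * v k t) = 0].
  have [c [cS [t ct] ce]] := lin_dep v gt.
  case: (Rlt_dec 0 (c t)) => h; first by exists c; split=> //; exists t.
  exists (fun t => - c t); split=> [t' /cS ->||k km]; first by ring.
    by exists t; lra.
  rewrite (eq_rsum (g := fun t => - (c t * v k t))); last by move=> t'; ring.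
  by rewrite rsum_opp ce //; ring.
have [t0 t0p] := cpos.
(* The minimal ratio is the largest step that keeps all weights nonnegative; the weight at its
   minimizer becomes 0. *)
have [t /RltbP tp tmin] := @exists_argmin T (fun t => Rltb 0 (c t)) (fun t => lam t / c t) t0 (introT (RltbP _ _) t0p).
pose th := lam t / c t.
have th0 : 0 <= th by apply: Rmult_le_pos => //; apply/Rlt_le/Rinv_0_lt_compat.
pose mu s := lam s - th * c s.
have mu0 s : 0 <= mu s.
  rewrite /mu; case: (Rlt_dec 0 (c s)) => h.
    have := tmin s (introT (RltbP _ _) h); rewrite -/th => le.
    have := Rmult_le_compat_r _ _ _ (Rlt_le _ _ h) le.
    rewrite (_ : lam s / c s * c s = lam s); [lra | field; lra].
  have := lam0 s; have : th * c s <= th * 0 by apply: Rmult_le_compat_l; lra.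
  lra.
have mut : mu t = 0 by rewrite /mu /th; field; lra.
have tS : t \in supp lam.
  by case: (boolP (t \in supp lam)) => // /cS; lra.
have lt : (#|supp mu| < #|supp lam|)%nat.
  apply: proper_card; apply/properP; split; last first.
    by exists t => //; rewrite inE mut; apply/RltbP; lra.
  apply/subsetP => s; apply: contraLR => sS; rewrite inE /mu (cS _ sS) (supp_out lam0 sS).
  by apply/RltbP; lra.
have [nu [nu0 nuc nue]] := IH mu (leq_trans lt leN) mu0.
exists nu; split=> // k km; rewrite nue //.
rewrite (eq_rsum (g := fun s => lam s * v k s - th * (c s * v k s))); last by move=> s; rewrite /mu; ring.
by rewrite rsum_sub rsum_mull ce //; ring.
Qed.

Lemma rsum_supp (T : finType) (m : nat) (mu : T -> R) (t0 : T) :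
  (forall t, 0 <= mu t) -> (#|supp mu| <= m)%nat ->
  exists (f : 'I_m -> T) (c : 'I_m -> R), (forall i, 0 <= c i) /\
    forall F : T -> R, rsum (fun i => c i * F (f i)) = rsum (fun t => mu t * F t).
Proof.
move=> mu0 le; set S := supp mu in le *.
pose g k := nth t0 (enum S) k.
(* Indices beyond the support are padded with [t0] and weight 0, so that the index type has exactly
   m elements. *)
exists (fun i => g i), (fun i => if (i < #|S|)%nat then mu (g i) else 0); split=> [i|F].
  by case: ifP => _; [apply: mu0 | lra].
transitivity (\big[Rplus/R0]_(t in S) (mu t * F t)); last first.
  rewrite big_mkcond; apply: eq_bigr => t _; case: ifP => // /negbT h.
  by rewrite (supp_out mu0 h) Rmult_0_l.
rewrite -big_enum (big_nth t0) /= -cardE.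
rewrite /rsum -(big_mkord xpredT (fun i => (if (i < #|S|)%nat then mu (g i) else 0) * F (g i))).
rewrite (@big_cat_nat _ _ _ #|S|) //= [X in Rplus _ X]big1_seq ?Rplus_0_r; last first.
  by move=> i; rewrite mem_index_iota => /andP[_ /andP[h _]]; rewrite ltnNge h Rmult_0_l.
by apply: eq_big_nat => i /andP[_ h]; rewrite h.
Qed.

(** The initial weights are all 1, because each slice of an unnormalized law already carries its own
    mass. *)
Lemma caratheodory (T D : finType) (w : T -> D -> R) : (0 < #|T|)%nat ->
  exists (f : 'I_#|D| -> T) (c : 'I_#|D| -> R), (forall i, 0 <= c i) /\
    forall d, rsum (fun i => c i * w (f i) d) = rsum (fun t => w t d).
Proof.
move=> /card_gt0P[t0 _].
pose v k t := nth 0 [seq w t d | d <- enum D] k.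
have [mu [mu0 mc me]] := @conic_caratheodory T #|D| v (fun _ => 1) (fun _ => Rle_0_1).
have [f [c [c0 ce]]] := rsum_supp t0 mu0 mc.
exists f, c; split=> // d; rewrite (ce (fun t => w t d)).
have ix : (index d (enum D) < size (enum D))%nat by rewrite index_mem mem_enum.
have := me (index d (enum D)); rewrite cardE => /(_ ix).
have vE t : v (index d (enum D)) t = w t d.
  by rewrite /v (nth_map d) // nth_index // mem_enum.
rewrite (eq_rsum (g := fun t => mu t * w t d)); last by move=> t; rewrite vE.
by move=> ->; apply: eq_rsum => t; rewrite vE Rmult_1_l.
Qed.

(** * Continuity of conditional mutual information *)

Lemma xlg0 : xlg 0 = 0. Proof. by rewrite /xlg Rmult_0_l. Qed.

Lemma xlg_mul a b : 0 <= a -> 0 <= b -> xlg (a * b) = a * xlg b + b * xlg a.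
Proof.
move=> a0 b0.
case: (Rle_lt_or_eq_dec _ _ a0) => [ha|<-]; last by rewrite Rmult_0_l xlg0; ring.
case: (Rle_lt_or_eq_dec _ _ b0) => [hb|<-]; last by rewrite Rmult_0_r xlg0; ring.
by rewrite /xlg log2_mul //; ring.
Qed.

(** Apply ln t <= t - 1 to t = 1 / sqrt x. This gives continuity at 0, where the logarithm itself is
    of no use. *)
Lemma xlg_small x : 0 < x <= 1 -> Rabs (xlg x) <= 2 / ln 2 * sqrt x.
Proof.
move=> [x0 x1]; have l := ln2_gt0.
have s0 := sqrt_lt_R0 _ x0; have ss := sqrt_sqrt x (Rlt_le _ _ x0).
have ln0 : ln x <= 0 by rewrite -ln_1; case: x1 => [h|->]; [apply/Rlt_le/ln_increasing|lra].
have lnx : - ln x = 2 * ln (/ sqrt x).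
  by rewrite ln_Rinv // -{1}ss ln_mult //; ring.
have le : x * - ln x <= 2 * sqrt x.
  have i0 : 0 < / sqrt x by apply: Rinv_0_lt_compat.
  have := ln_le_sub1 i0 => h.
  have h2 : x * - ln x <= x * (2 * (/ sqrt x)) by apply: Rmult_le_compat_l; lra.
  apply: Rle_trans h2 _; right; rewrite -{1}ss; field; lra.
have xp : 0 <= x * - ln x by apply: Rmult_le_pos; lra.
rewrite /xlg /log2 (_ : x * (ln x / ln 2) = - (x * - ln x / ln 2)); last by field; lra.
have i2 : 0 < / ln 2 by apply: Rinv_0_lt_compat.
rewrite Rabs_Ropp Rabs_pos_eq; last by apply: Rmult_le_pos; lra.
have := Rmult_le_compat_r _ _ _ (Rlt_le _ _ i2) le; rewrite /Rdiv; lra.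
Qed.

Lemma xlg_cv (a : nat -> R) l : (forall k, 0 <= a k) -> Un_cv a l ->
  Un_cv (fun k => xlg (a k)) (xlg l).
Proof.
move=> a0 al; have l2 := ln2_gt0.
have l0 : 0 <= l.
  by apply: (@Rle_cv_lim (fun _ => 0) a) => //; move=> e e0; exists O => *; rewrite R_dist_eq.
case: (Rle_lt_or_eq_dec _ _ l0) => [lp|lz].
  apply: (continuity_seq xlg a l) => //.
  apply: (continuity_pt_mult id log2); first exact: derivable_continuous_pt (derivable_pt_id l).
  apply: (continuity_pt_mult ln (fun _ => / ln 2)).
    by apply: derivable_continuous_pt; exists (/ l); apply: derivable_pt_lim_ln.
  by apply: continuity_pt_const => ? ?.
move=> e e0; rewrite -lz xlg0.
pose de := e * ln 2 / 2.
have de0 : 0 < de by apply: Rdiv_lt_0_compat; [apply: Rmult_lt_0_compat|lra].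
have [N hN] := al (Rmin 1 (de * de)) (Rmin_pos _ _ Rlt_0_1 (Rmult_lt_0_compat _ _ de0 de0)).
exists N => k /hN; rewrite -lz /R_dist !Rminus_0_r (Rabs_pos_eq (a k)) // => lt.
have lt1 : a k < 1 by apply: Rlt_le_trans lt (Rmin_l _ _).
have lt2 : a k < de * de by apply: Rlt_le_trans lt (Rmin_r _ _).
case: (Rle_lt_or_eq_dec _ _ (a0 k)) => [kp|<-]; last by rewrite xlg0 Rabs_R0.
apply: Rle_lt_trans (xlg_small (conj kp (Rlt_le _ _ lt1))) _.
have : sqrt (a k) < de.
  by rewrite -(sqrt_square de); [apply: sqrt_lt_1_alt; lra | lra].
move=> /(Rmult_lt_compat_l (2 / ln 2) _ _ (Rdiv_lt_0_compat _ _ Rlt_0_2 l2)).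
by rewrite (_ : 2 / ln 2 * de = e) //; rewrite /de; field; lra.
Qed.

Lemma rsum_cv (T : finType) (F : nat -> T -> R) (l : T -> R) :
  (forall t, Un_cv (fun k => F k t) (l t)) -> Un_cv (fun k => rsum (F k)) (rsum l).
Proof.
move=> h; rewrite /rsum; elim: (index_enum T) => [|t s IH].
  move=> e e0; exists O => k _; by rewrite !big_nil R_dist_eq.
have E : (fun k => \big[Rplus/R0]_(t <- t :: s) F k t) =
   (fun k => F k t + \big[Rplus/R0]_(t <- s) F k t).
  by apply: functional_extensionality => k; rewrite big_cons.
by rewrite E big_cons; apply: CV_plus.
Qed.

Lemma const_cv c : Un_cv (fun _ => c) c.
Proof. by move=> e e0; exists O => *; rewrite R_dist_eq. Qed.

Lemma rsum3_cv (A B C : finType) (F : nat -> A -> B -> C -> R) (l : A -> B -> C -> R) :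
  (forall a b c, Un_cv (fun k => F k a b c) (l a b c)) ->
  Un_cv (fun k => rsum (fun a => rsum (fun b => rsum (fun c => F k a b c))))
    (rsum (fun a => rsum (fun b => rsum (fun c => l a b c)))).
Proof.
move=> h; apply: (rsum_cv (F := fun k a => _)) => a.
by apply: (rsum_cv (F := fun k b => _)) => b; apply: (rsum_cv (F := fun k c => _)).
Qed.

Lemma condMI_cv (A B C : finType) (j : nat -> A -> B -> C -> R) (l : A -> B -> C -> R) :
  (forall k a b c, 0 <= j k a b c) -> (forall a b c, 0 <= l a b c) ->
  (forall a b c, Un_cv (fun k => j k a b c) (l a b c)) ->
  Un_cv (fun k => condMI (j k)) (condMI l).
Proof.
move=> j0 l0 h.
have -> : (fun k => condMI (j k)) = (fun k =>
  rsum (fun a => rsum (fun b => rsum (fun c => xlg (j k a b c)))) +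
  rsum (fun c => xlg (margC (j k) c)) -
  rsum (fun a => rsum (fun c => xlg (margAC (j k) a c))) -
  rsum (fun b => rsum (fun c => xlg (margBC (j k) b c)))).
  by apply: functional_extensionality => k; apply: condMI_xlg.
rewrite condMI_xlg //; apply: CV_minus; first apply: CV_minus; first apply: CV_plus.
- by apply: (rsum3_cv (F := fun k a b c => _)) => a b c; apply: xlg_cv.
- apply: (rsum_cv (F := fun k c => _)) => c; apply: xlg_cv; first by move=> k; apply: margC_ge0.
  by apply: (rsum_cv (F := fun k a => _)) => a; apply: (rsum_cv (F := fun k b => _)).
- apply: (rsum_cv (F := fun k a => _)) => a; apply: (rsum_cv (F := fun k c => _)) => c.
  by apply: xlg_cv; [move=> k; apply: margAC_ge0 | apply: (rsum_cv (F := fun k b => _))].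
- apply: (rsum_cv (F := fun k b => _)) => b; apply: (rsum_cv (F := fun k c => _)) => c.
  by apply: xlg_cv; [move=> k; apply: margBC_ge0 | apply: (rsum_cv (F := fun k a => _))].
Qed.

(** * Extraction of convergent subsequences *)

Lemma subseq_cv (a : nat -> R) l (s : nat -> nat) : (forall k, (k <= s k)%nat) ->
  Un_cv a l -> Un_cv (fun k => a (s k)) l.
Proof.
move=> sk al e e0; have [N hN] := al e e0; exists N => k /leP Nk.
by apply: hN; apply/leP; apply: leq_trans Nk (sk k).
Qed.

Lemma inv_S_cv : Un_cv (fun k => / (INR k + 1)) 0.
Proof.
move=> e e0; have [N hN] := exists_nat_ge (/ e).
exists N => k /le_INR Nk.
have k0 := pos_INR k.
rewrite /R_dist Rminus_0_r Rabs_pos_eq; last by apply/Rlt_le/Rinv_0_lt_compat; lra.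
by rewrite -(Rinv_inv e); apply: Rinv_lt_contravar; [apply: Rmult_lt_0_compat; [apply: Rinv_0_lt_compat|]|]; lra.
Qed.

(** The condition k <= s k, in place of strict monotonicity, already preserves limits and is stable
    under composition. *)
Lemma bounded_subseq (a : nat -> R) B : (forall k, Rabs (a k) <= B) ->
  exists (s : nat -> nat) (l : R), (forall k, (k <= s k)%nat) /\ Un_cv (fun k => a (s k)) l.
Proof.
move=> aB.
have [] := Bolzano_Weierstrass a (fun x => - B <= x <= B) (compact_P3 _ _).
  by move=> k; have := aB k; rewrite /Rabs; case: Rcase_abs; lra.
move=> l lP.
have ex k : exists p, (k <= p)%nat /\ Rabs (a p - l) < / (INR k + 1).
  have k0 : 0 < / (INR k + 1) by apply: Rinv_0_lt_compat; have := pos_INR k; lra.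
  have [] := lP (fun x => Rabs (x - l) < / (INR k + 1)) k.
    by exists (mkposreal _ k0) => x.
  by move=> p [/leP kp h]; exists p.
pose s k := proj1_sig (constructive_indefinite_description _ (ex k)).
have sP k : (k <= s k)%nat /\ Rabs (a (s k) - l) < / (INR k + 1).
  exact: proj2_sig (constructive_indefinite_description _ (ex k)).
exists s, l; split; first by move=> k; case: (sP k).
move=> e e0; have [N hN] := inv_S_cv e0; exists N => k /hN.
have [_ h] := sP k; rewrite /R_dist Rminus_0_r => h2.
by apply: Rlt_trans h _; apply: Rle_lt_trans (Rle_abs _) h2.
Qed.

Lemma finite_subseq (T : finType) (F : nat -> T -> R) B : (forall k t, Rabs (F k t) <= B) ->
  exists (s : nat -> nat) (l : T -> R), (forall k, (k <= s k)%nat) /\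
    forall t, Un_cv (fun k => F (s k) t) (l t).
Proof.
move=> FB.
suff [s [sk h]] : exists s : nat -> nat, (forall k, (k <= s k)%nat) /\
    forall t, t \in enum T -> exists l, Un_cv (fun k => F (s k) t) l.
  have h' t : exists l, Un_cv (fun k => F (s k) t) l by apply: h; rewrite mem_enum.
  exists s, (fun t => proj1_sig (constructive_indefinite_description _ (h' t))); split=> // t.
  exact: proj2_sig (constructive_indefinite_description _ (h' t)).
elim: (enum T) => [|t r [s [sk h]]]; first by exists (fun k => k).
have [s' [l [sk' cv]]] := bounded_subseq (fun k => FB (s k) t).
exists (fun k => s (s' k)); split=> [k|t'].
  exact: leq_trans (sk' k) (sk _).
rewrite inE => /orP[/eqP ->|/h[l' cv']]; first by exists l.
by exists l'; apply: (subseq_cv (a := fun k => F (s k) t')).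
Qed.

(** * The optimal rate *)

Lemma condMI_sym (A B C : finType) (j : A -> B -> C -> R) : (forall a b c, 0 <= j a b c) ->
  condMI j = condMI (fun b a c => j a b c).
Proof.
move=> j0; rewrite !condMI_xlg //.
have -> : margC (fun b a c => j a b c) = margC j.
  by apply: functional_extensionality => c; rewrite /margC rsum_exch.
rewrite [X in X + _ - _ - _ = _]rsum_exch; rewrite /margAC /margBC; ring.
Qed.

(* Minus the conditional entropy H(B|C) of an unnormalized law: homogeneous of degree one;
   this is what makes rescaling the slices J u harmless. *)
Definition slice_ent (B C : finType) (k : B -> C -> R) : R :=
  rsum (fun b => rsum (fun c => xlg (k b c))) - rsum (fun c => xlg (rsum (fun b => k b c))).

(** A sum of contributions of the slices plus a term depending only on the law of (B,C): exactly the
    shape that a reweighting of slices can preserve. *)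
Lemma condMI_slices (T B C : finType) (j : T -> B -> C -> R) : (forall a b c, 0 <= j a b c) ->
  condMI j = rsum (fun u => slice_ent (j u)) - slice_ent (fun b c => rsum (fun u => j u b c)).
Proof.
move=> j0; rewrite condMI_xlg // /slice_ent rsum_sub.
have -> : rsum (fun c => xlg (rsum (fun b => rsum (fun u => j u b c)))) = rsum (fun c => xlg (margC j c)).
  by apply: eq_rsum => c; rewrite /margC rsum_exch.
rewrite /margAC /margBC; ring.
Qed.

Lemma slice_ent_scale (B C : finType) (k : B -> C -> R) a : 0 <= a -> (forall b c, 0 <= k b c) ->
  slice_ent (fun b c => a * k b c) = a * slice_ent k.
Proof.
move=> a0 k0; rewrite /slice_ent.
have -> : rsum (fun b => rsum (fun c => xlg (a * k b c))) =
   a * rsum (fun b => rsum (fun c => xlg (k b c))) + rsum (fun b => rsum (fun c => k b c)) * xlg a.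
  rewrite -rsum_mull -rsum_mulr -rsum_add; apply: eq_rsum => b.
  rewrite -rsum_mull -rsum_mulr -rsum_add; apply: eq_rsum => c; exact: xlg_mul.
have -> : rsum (fun c => xlg (rsum (fun b => a * k b c))) =
   a * rsum (fun c => xlg (rsum (fun b => k b c))) + rsum (fun b => rsum (fun c => k b c)) * xlg a.
  rewrite [X in _ + X * _]rsum_exch -rsum_mull -rsum_mulr -rsum_add; apply: eq_rsum => c.
  by rewrite rsum_mull xlg_mul //; apply: rsum_ge0.
ring.
Qed.

(** The order of choices matters: s (also used as t) is fixed first to make the first logarithm at
    most gam / 2, and the distance is then chosen small relative to the constant that s produces. *)
Lemma gap_small (B gam : R) : 1 <= B -> 0 < gam -> exists s d, [/\ 0 < s < 1, 0 < d &
  forall B' tv, 1 <= B' <= B -> 0 <= tv <= d ->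
   log2 ((1 + s) / (1 - s)) + (1 + s) / s * (2 * (2 * tv)) * log2 (B' / s) <= gam].
Proof.
move=> B1 g0; have l := ln2_gt0.
pose s := Rmin (/ 2) (gam * ln 2 / 8).
have gl : 0 < gam * ln 2 by apply: Rmult_lt_0_compat.
have s0 : 0 < s by apply: Rmin_pos; lra.
have s1 : s <= / 2 by apply: Rmin_l.
have s2 : s <= gam * ln 2 / 8 by apply: Rmin_r.
pose C := (1 + s) / s * (2 * 2) * log2 (B / s).
have ratio (b : R) : 1 <= b -> 1 <= b / s by move=> b1; apply: Rle_div_r => //; lra.
have K0 : 0 <= (1 + s) / s * (2 * 2).
  by apply: Rmult_le_pos; [apply/Rlt_le/Rdiv_lt_0_compat|]; lra.
have C0 : 0 <= C by apply: Rmult_le_pos => //; apply/log2_ge0/ratio.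
exists s, (gam / (2 * (C + 1))); split; first lra.
  by apply: Rdiv_lt_0_compat; lra.
move=> B' tv [b1 b2] [tv0 tv1].
have h1 : log2 ((1 + s) / (1 - s)) <= gam / 2.
  have p : 0 < (1 + s) / (1 - s) by apply: Rdiv_lt_0_compat; lra.
  have h := ln_le_sub1 p.
  apply: Rle_div_l => //; apply: Rle_trans h _.
  have -> : (1 + s) / (1 - s) - 1 = 2 * s / (1 - s) by field; lra.
  apply: Rle_div_l; first lra.
  have : gam / 2 * ln 2 * (1 - s) >= gam / 2 * ln 2 * / 2.
    by apply/Rle_ge/Rmult_le_compat_l; lra.
  lra.
have h2 : (1 + s) / s * (2 * (2 * tv)) * log2 (B' / s) <= C * tv.
  have -> : (1 + s) / s * (2 * (2 * tv)) * log2 (B' / s) = ((1 + s) / s * (2 * 2) * log2 (B' / s)) * tv by ring.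
  apply: Rmult_le_compat_r => //; apply: Rmult_le_compat_l => //.
  apply: log2_le; first by have := ratio B' b1; lra.
  by apply: Rmult_le_compat_r => //; apply/Rlt_le/Rinv_0_lt_compat.
have h3 : C * tv <= gam / 2.
  apply: (Rle_trans _ ((C + 1) * (gam / (2 * (C + 1))))).
    by apply: Rmult_le_compat; lra.
  by right; field; lra.
lra.
Qed.

(** * Bounded alphabets, the limit and the infimum *)

Section Main.
Variables (X Y Z : finType) (pXY : X -> Y -> R) (pZ : X -> Y -> Z -> R).
Hypothesis HXY : is_pmf2 pXY.
Hypothesis HZ : is_kernel (fun xy : X * Y => pZ xy.1 xy.2).

Let pXY0 x y : 0 <= pXY x y. Proof. by case: HXY. Qed.
Let pZ0 x y z : 0 <= pZ x y z. Proof. by case: HZ => h _; apply: (h (x, y)). Qed.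
Let pZ1 x y : rsum (pZ x y) = 1. Proof. by case: HZ => _ h; apply: (h (x, y)). Qed.

(* The single-letter constraints up to [eta]; the first two Markov chains hold exactly. *)
Definition approx (T : finType) (J : T -> X -> Y -> Z -> R) (v eta : R) : Prop :=
  [/\ (forall u x y z, 0 <= J u x y z),
   (forall u x y, rsum (fun z => J u x y z) * rsum (pXY x) =
      rsum (fun y => rsum (fun z => J u x y z)) * pXY x y),
   (forall u x y z, J u x y z * rsum (fun z => rsum (fun x => J u x y z)) =
      rsum (fun x => J u x y z) * rsum (fun z => J u x y z)),
   (forall x y z, Rabs (rsum (fun u => J u x y z) - pXY x y * pZ x y z) <= eta) &
   condMI (fun u x (yz : Y * Z) => J u x yz.1 yz.2) <= eta /\
   condMI (fun z u y => rsum (fun x => J u x y z)) <= v + eta].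

Lemma nmsg_gt0 n (c : code X Y Z n) : valid_code c -> (0 < nmsg c)%nat.
Proof.
move=> [[_ e1] _].
have /card_gt0P[x _] : (0 < #|{ffun 'I_n -> X}|)%nat.
  by rewrite card_ffun expn_gt0 (cardX_gt0 HXY).
by have := rsum1_card (e1 x); rewrite card_ord.
Qed.

(** The size constraint at n = 1 already gives 1 <= 2^r. This bounds the achievable rates below, so
    that they have a real infimum. *)
Lemma achievable_ge0 r : achievable pXY pZ r -> 0 <= r.
Proof.
move=> [cs [h _]]; have [vc le] := h 1%nat.
have m1 : 1 <= INR (nmsg (cs 1%nat)) by apply: (le_INR 1); apply/leP; apply: nmsg_gt0.
have := log2_le _ le; rewrite log2_Rpower /= Rmult_1_l => /(_ ltac:(lra)).
by have := log2_ge0 m1; lra.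
Qed.

Lemma achievable_approx r eta : achievable pXY pZ r -> 0 < eta ->
  exists (T : finType) (J : T -> X -> Y -> Z -> R), (0 < #|T|)%nat /\ approx J r eta.
Proof.
move=> ach e0; have r0 := achievable_ge0 ach; move: ach => [cs [csv cse]].
(* One index i must be good for two averages, so [obj i + K * lea i] is averaged. It comes out at
   most r + eta / 2; since [obj i >= 0] and [K * eta = r + eta + 1], this forces [lea i <= eta],
   while [lea i >= 0] gives [obj i <= r + eta]. *)
pose K := (r + eta + 1) / eta.
have K0 : 0 < K by apply: Rdiv_lt_0_compat; lra.
pose gam := eta / (4 * (1 + K)).
have g0 : 0 < gam by apply: Rdiv_lt_0_compat; lra.
have cX : 1 <= INR #|X| by apply: (le_INR 1); apply/leP; apply: cardX_gt0 HXY.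
have cZ : 1 <= INR #|Z| by apply: (le_INR 1); apply/leP; apply: cardZ_gt0 HXY HZ.
have [s [d [s01 d0 gap]]] := @gap_small (INR #|X| + INR #|Z|) gam ltac:(lra) g0.
pose eps := Rmin gam (Rmin d (eta / 2)).
have eps0 : 0 < eps by do 2! [apply: Rmin_pos => //]; lra.
have eg : eps <= gam by apply: Rmin_l.
have ed : eps <= d by apply: Rle_trans (Rmin_r _ _) (Rmin_l _ _).
have ee : eps <= eta / 2 by apply: Rle_trans (Rmin_r _ _) (Rmin_r _ _).
have [N hN] := cse eps eps0.
have [tv lk] := hN N.+1 (leqnSn N).
have [vc nm] := csv N.+1; move: (cs N.+1) vc nm tv lk => c vc nm tv lk.
have n0 : 0 < INR N.+1 by apply: lt_0_INR; apply/ltP.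
have tv0 : 0 <= code_tv pXY pZ c.
  apply: Rmult_le_pos; first lra.
  by do 3! apply: rsum_ge0 => ?; apply: Rabs_pos.
have gX := gap (INR #|X|) (code_tv pXY pZ c) ltac:(lra) ltac:(lra).
have gZ := gap (INR #|Z|) (code_tv pXY pZ c) ltac:(lra) ltac:(lra).
have O := obj_sum HXY HZ vc (proj1 s01) s01 gZ.
have L := leak_sum HXY HZ vc (proj1 s01) s01 gX.
have lm : log2 (INR (nmsg c)) <= INR N.+1 * r.
  rewrite -(log2_Rpower (INR N.+1 * r)); apply: log2_le => //.
  by apply: lt_0_INR; apply/ltP; apply: nmsg_gt0.
set obj := fun i : 'I_N.+1 => _ in O; set lea := fun i : 'I_N.+1 => _ in L.
have [i hi] : exists i, obj i + K * lea i <= gam + r + K * (gam + eps).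
  apply: exists_le_mean => //; rewrite rsum_add rsum_mull.
  have := Rmult_le_compat_l _ _ _ (Rlt_le _ _ K0) L.
  have := Rmult_le_compat_l _ _ _ (Rlt_le _ _ K0) lk.
  lra.
have P0 := Pj_ge0 HXY vc.
have o0 : 0 <= obj i by apply: CMI_ge0.
have l0 : 0 <= lea i by apply: CMI_ge0.
have gE : gam * (1 + K) = eta / 4 by rewrite /gam; field; lra.
have KE : K * eta = r + eta + 1 by rewrite /K; field; lra.
have Keps : K * eps <= K * gam by apply: Rmult_le_compat_l; lra.
have Kl : 0 <= K * lea i by apply: Rmult_le_pos; lra.
exists (UU c), (Jb pXY i); split.
  apply/card_gt0P; exists (Ordinal (nmsg_gt0 vc), [ffun => None]) => //.
split.
- by move=> *; apply: Jb_ge0.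
- by move=> *; apply: Jb_markov1.
- by move=> *; apply: Jb_markov2.
- by move=> x y z; have := Jb_close HXY HZ c i x y z; lra.
- rewrite leak_CMI // obj_CMI // -/(obj i) -/(lea i); split; last lra.
  by apply: (Rmult_le_reg_l K) => //; lra.
Qed.

Notation d := (#|X| * #|Y| * #|Z| + 2)%nat.

(** The preserved functionals: one for each (x,y,z), and one slice entropy for each of the two
    mutual informations. The total mass is fixed by the former. *)
Lemma card_constraints : #|{: option (option (X * Y * Z))}| = d.
Proof. by rewrite !card_option !card_prod addn2. Qed.

(** Both exact chains are homogeneous in each slice, so they survive any rescaling; the other
    conditions depend only on the preserved functionals. *)
Lemma approx_reduce (T : finType) (J : T -> X -> Y -> Z -> R) v eta :
  (0 < #|T|)%nat -> approx J v eta -> exists J' : 'I_d -> X -> Y -> Z -> R, approx J' v eta.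
Proof.
move=> T0 [J0 M1 M2 cl [lk ob]].
pose h1 (j : X -> Y -> Z -> R) := slice_ent (fun x (yz : Y * Z) => j x yz.1 yz.2).
pose h2 (j : X -> Y -> Z -> R) := slice_ent (fun z y => rsum (fun x => j x y z)).
pose w (u : T) (k : option (option (X * Y * Z))) : R := match k with
  | None => h1 (J u) | Some None => h2 (J u) | Some (Some t) => J u t.1.1 t.1.2 t.2 end.
have := @caratheodory T _ w T0; rewrite card_constraints => -[f [c [c0 cE]]].
pose J' i x y z := c i * J (f i) x y z.
have J'0 i x y z : 0 <= J' i x y z by apply: Rmult_le_pos.
have sE x y z : rsum (fun i => J' i x y z) = rsum (fun u => J u x y z) := cE (Some (Some (x, y, z))).
exists J'; split=> //.
- move=> i x y; rewrite /J' rsum_mull.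
  under [in RHS]eq_rsum => y' do rewrite rsum_mull.
  by rewrite rsum_mull !Rmult_assoc M1.
- move=> i x y z; rewrite /J' !rsum_mull.
  under eq_rsum => z' do rewrite rsum_mull.
  rewrite rsum_mull.
  transitivity (c i * c i * (J (f i) x y z * rsum (fun z => rsum (fun x => J (f i) x y z)))); first by ring.
  have aux a p q : a * a * (p * q) = a * p * (a * q) by ring.
  by rewrite M2; apply: aux.
- by move=> x y z; rewrite sE.
- have e1 : condMI (fun u x (yz : Y * Z) => J' u x yz.1 yz.2) = condMI (fun u x (yz : Y * Z) => J u x yz.1 yz.2).
    rewrite !condMI_slices //; congr (_ - _); last first.
      congr slice_ent; by apply: functional_extensionality => x; apply: functional_extensionality => -[y z]; apply: sE.
    rewrite -[RHS](cE None); apply: eq_rsum => i; exact: slice_ent_scale.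
  have e2 : condMI (fun z u y => rsum (fun x => J' u x y z)) = condMI (fun z u y => rsum (fun x => J u x y z)).
    rewrite condMI_sym; last by move=> *; apply: rsum_ge0.
    rewrite [RHS]condMI_sym; last by move=> *; apply: rsum_ge0.
    rewrite !condMI_slices; try by move=> *; apply: rsum_ge0.
    congr (_ - _); last first.
      congr slice_ent; apply: functional_extensionality => z; apply: functional_extensionality => y.
      by rewrite rsum_exch [RHS]rsum_exch; apply: eq_rsum => x; apply: sE.
    rewrite -[RHS](cE (Some None)); apply: eq_rsum => i.
    rewrite /= /h2 -slice_ent_scale //; last by move=> *; apply: rsum_ge0.
    congr slice_ent; apply: functional_extensionality => z; apply: functional_extensionality => y.
    exact: rsum_mull.
  by rewrite e1 e2.
Qed.

Lemma cv_eq (a b : nat -> R) l m : (forall k, a k = b k) -> Un_cv a l -> Un_cv b m -> l = m.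
Proof.
move=> e al bm; apply: UL_sequence al _.
by rewrite (_ : a = b) //; apply: functional_extensionality.
Qed.

Lemma approx_limit v : (forall eta, 0 < eta -> exists J : 'I_d -> X -> Y -> Z -> R, approx J v eta) ->
  exists J : 'I_d -> X -> Y -> Z -> R, approx J v 0.
Proof.
move=> ex.
have ek k : 0 < / (INR k + 1) by apply: Rinv_0_lt_compat; have := pos_INR k; lra.
pose Jk k := proj1_sig (constructive_indefinite_description _ (ex _ (ek k))).
have JkP k : approx (Jk k) v (/ (INR k + 1)).
  exact: proj2_sig (constructive_indefinite_description _ (ex _ (ek k))).
pose F k (t : 'I_d * X * Y * Z) := Jk k t.1.1.1 t.1.1.2 t.1.2 t.2.
(* Each entry is at most p(x,y,z) plus the tolerance, and both are at most 1. *)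
have FB k t : Rabs (F k t) <= 2.
  case: t => -[[u x] y] z; rewrite /F /=; have [J0 _ _ cl _] := JkP k.
  rewrite Rabs_pos_eq //.
  have h1 := @rsum_term _ u (fun u => Jk k u x y z) (fun u => J0 u x y z).
  have h2 : pXY x y <= 1.
    case: HXY => _ <-; apply: Rle_trans (pXY_le_sX HXY x y) _.
    by apply: (@rsum_term _ x (fun x => rsum (pXY x))) => ?; apply: rsum_ge0.
  have h3 : pZ x y z <= 1 by rewrite -(pZ1 x y); apply: rsum_term.
  have h4 : pXY x y * pZ x y z <= 1 * 1 by apply: Rmult_le_compat.
  have h5 : / (INR k + 1) <= 1.
    by rewrite -Rinv_1; apply: Rinv_le_contravar; have := pos_INR k; lra.
  have := Rle_trans _ _ _ (Rle_abs _) (cl x y z); lra.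
have [s [l [sk cv]]] := finite_subseq FB.
pose L u x y z := l (u, x, y, z).
have cvL u x y z : Un_cv (fun k => Jk (s k) u x y z) (L u x y z) := cv (u, x, y, z).
have e0 : Un_cv (fun k => / (INR (s k) + 1)) 0 := subseq_cv sk inv_S_cv.
have J0 k u x y z : 0 <= Jk (s k) u x y z by case: (JkP (s k)).
have L0 u x y z : 0 <= L u x y z.
  by apply: (@Rle_cv_lim (fun _ => 0) (fun k => Jk (s k) u x y z)) => //; apply: const_cv.
have cz u x y : Un_cv (fun k => rsum (fun z => Jk (s k) u x y z)) (rsum (fun z => L u x y z)).
  exact: (rsum_cv (F := fun k z => _)).
have cx u y z : Un_cv (fun k => rsum (fun x => Jk (s k) u x y z)) (rsum (fun x => L u x y z)).
  exact: (rsum_cv (F := fun k x => _)).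
have cyz u x : Un_cv (fun k => rsum (fun y => rsum (fun z => Jk (s k) u x y z)))
    (rsum (fun y => rsum (fun z => L u x y z))).
  exact: (rsum_cv (F := fun k y => _)).
have czx u y : Un_cv (fun k => rsum (fun z => rsum (fun x => Jk (s k) u x y z)))
    (rsum (fun z => rsum (fun x => L u x y z))).
  exact: (rsum_cv (F := fun k z => _)).
have cu x y z : Un_cv (fun k => rsum (fun u => Jk (s k) u x y z)) (rsum (fun u => L u x y z)).
  exact: (rsum_cv (F := fun k u => _)).
exists L; split=> //.
- move=> u x y.
  apply: (cv_eq _ (CV_mult _ _ _ _ (cz u x y) (const_cv _)) (CV_mult _ _ _ _ (cyz u x) (const_cv _))).
  by move=> k; case: (JkP (s k)).
- move=> u x y z.
  apply: (cv_eq _ (CV_mult _ _ _ _ (cvL u x y z) (czx u y)) (CV_mult _ _ _ _ (cx u y z) (cz u x y))).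
  by move=> k; case: (JkP (s k)).
- move=> x y z.
  have cv1 := cv_cvabs _ _ (CV_minus _ _ _ _ (cu x y z) (const_cv (pXY x y * pZ x y z))).
  by apply: Rle_cv_lim cv1 e0 => k; case: (JkP (s k)).
- split.
    have := @condMI_cv _ _ _ (fun k u x (yz : Y * Z) => Jk (s k) u x yz.1 yz.2)
      (fun u x (yz : Y * Z) => L u x yz.1 yz.2) _ _ _ => /(_ (fun _ _ _ _ => J0 _ _ _ _ _) (fun _ _ _ => L0 _ _ _ _) (fun _ _ _ => cvL _ _ _ _)) cv1.
    by apply: Rle_cv_lim cv1 e0 => k; case: (JkP (s k)) => _ _ _ _ [].
  have cv1 : Un_cv (fun k => condMI (fun z u y => rsum (fun x => Jk (s k) u x y z)))
     (condMI (fun z u y => rsum (fun x => L u x y z))).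
    apply: (@condMI_cv _ _ _ (fun k z u y => rsum (fun x => Jk (s k) u x y z))) => //.
      by move=> *; apply: rsum_ge0.
    by move=> *; apply: rsum_ge0.
  by apply: Rle_cv_lim cv1 (CV_plus _ _ _ _ (const_cv v) e0) => k; case: (JkP (s k)) => _ _ _ _ [].
Qed.

(** At tolerance 0 the (X,Y,Z) marginal is exactly the target, so disintegration recovers [J] as a
    [jointU], and zero mutual information gives the third chain. *)
Lemma approx_admissible v (J : 'I_d -> X -> Y -> Z -> R) : approx J v 0 ->
  exists q : (X * Y * Z) -> 'I_d -> R, admissible pXY pZ q /\ objU pXY pZ q <= v.
Proof.
move=> [J0 M1 M2 cl [lk ob]].
have sE x y z : rsum (fun u => J u x y z) = pXY x y * pZ x y z.
  by have := cl x y z; rewrite /Rabs; case: Rcase_abs; lra.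
pose q := disint (fun (w : X * Y * Z) u => J u w.1.1 w.1.2 w.2).
have qK : is_kernel q.
  by apply: disint_kernel => //; rewrite card_ord addn2.
have jE : jointU pXY pZ q = J.
  do 4! [apply: functional_extensionality => ?]; rewrite /jointU /q -sE.
  by rewrite -(disintE (j := fun (w : X * Y * Z) u => J u w.1.1 w.1.2 w.2) (_, _, _)).
have suz x y : rsum (fun u => rsum (fun z => J u x y z)) = pXY x y.
  by rewrite rsum_exch (eq_rsum (sE x y)) rsum_mull pZ1 Rmult_1_r.
exists q; split; last by rewrite /objU jE; lra.
split=> //; rewrite jE; split; [|split].
- move=> u x y; rewrite /margB /margAB /margBC suz -M1; congr (_ * _).
  by rewrite rsum_exch; apply: eq_rsum => y'; rewrite suz.
- by move=> z [u y] x; apply: M2.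
- exact: (condMI_eq0 (j := fun u x (yz : Y * Z) => J u x yz.1 yz.2)).
Qed.

(** Only rates arbitrarily close to v are asked for, so v may be the infimum without being
    achievable itself. *)
Lemma converse_limit v : (forall eta, 0 < eta -> exists2 r, achievable pXY pZ r & r <= v + eta) ->
  exists q : (X * Y * Z) -> 'I_d -> R, admissible pXY pZ q /\ objU pXY pZ q <= v.
Proof.
move=> h.
have [J aJ] : exists J : 'I_d -> X -> Y -> Z -> R, approx J v 0.
  apply: approx_limit => eta e0.
  have [r ar le] := h (eta / 2) ltac:(lra).
  have [T [J [T0 aJ]]] := @achievable_approx r (eta / 2) ar ltac:(lra).
  have [J' [J0 M1 M2 cl [lk ob]]] := approx_reduce T0 aJ.
  exists J'; split=> //; last by split; lra.
  by move=> x y z; have := cl x y z; lra.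
exact: approx_admissible aJ.
Qed.

Lemma achievable_inf : computable_asym_secure pXY pZ ->
  exists v, is_inf (achievable pXY pZ) v.
Proof.
move=> [r0 ar0].
have [] := @completeness (fun x => achievable pXY pZ (- x)).
- by exists 0 => x /achievable_ge0; lra.
- by exists (- r0); rewrite Ropp_involutive.
move=> m [ub lub]; exists (- m); split=> [r ar|w hw].
  by have := ub (- r); rewrite Ropp_involutive => /(_ ar); lra.
have := lub (- w) => /(_ _) h; suff : m <= - w by lra.
by apply: h => x ax; have := hw _ ax; lra.
Qed.

Lemma is_inf_near (E : R -> Prop) v eta : is_inf E v -> 0 < eta -> exists2 r, E r & r <= v + eta.
Proof.
move=> [_ glb] e0; apply: NNPP => no.
have : v + eta <= v.
  by apply: glb => r Er; apply: Rnot_lt_le => lt; apply: no; exists r => //; lra.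
lra.
Qed.

Lemma inf_le_obj v (U : finType) (q : (X * Y * Z) -> U -> R) :
  is_inf (achievable pXY pZ) v -> admissible pXY pZ q -> v <= objU pXY pZ q.
Proof.
move=> [lb _] aq; apply: Rnot_lt_le => lt.
(* The midpoint lies strictly above the objective, hence is achievable, yet below the infimum. *)
have := lb _ (achievability HXY HZ aq (R0 := (objU pXY pZ q + v) / 2) ltac:(lra)).
lra.
Qed.
End Main.

Theorem theorem1 (X Y Z : finType) (pXY : X -> Y -> R) (pZ : X -> Y -> Z -> R) :
  is_pmf2 pXY -> is_kernel (fun xy : X * Y => pZ xy.1 xy.2) ->
  computable_asym_secure pXY pZ ->
  exists (U : finType) (q : (X * Y * Z) -> U -> R),
    (#|U| <= #|X| * #|Y| * #|Z| + 2)%nat /\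
    admissible pXY pZ q /\
    (forall (U' : finType) (q' : (X * Y * Z) -> U' -> R),
        admissible pXY pZ q' -> objU pXY pZ q <= objU pXY pZ q') /\
    is_inf (achievable pXY pZ) (objU pXY pZ q).
Proof.
move=> HXY HZ cas.
have [v vinf] := achievable_inf HXY cas.
have [q [aq qv]] := converse_limit HXY HZ (fun eta => is_inf_near vinf (eta := eta)).
have vq : objU pXY pZ q = v by apply: Rle_antisym => //; apply: (inf_le_obj HXY HZ vinf).
exists _, q; rewrite vq card_ord; do 3! split=> //.
by move=> U' q' aq'; apply: (inf_le_obj HXY HZ vinf).
Qed.
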